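(* Let $H$, $b$, $\widetilde\Lambda$, $\widetilde\Lambda_H$ and $w$ be as in one of the four cases (i)--(iv) of the context. Let $(u,\lambda)\in\mathbb{W}(0,T)\times\widetilde\Lambda$ with $u(0)=u_0$ satisfy $$\int_0^T\langle\partial_tu,v\rangle+a(u,v)+b(\lambda,v)\,dt=\int_0^T\langle f,v\rangle\,dt,\qquad \int_0^Tb(\mu-\lambda,u)\,dt\le\int_0^T\langle\mu-\lambda,w\rangle\,dt$$ for all $v\in\mathbb{W}(0,T)$ and $\mu\in\widetilde\Lambda$, and let $(u_h,\lambda_H)\in\mathbb{W}_h(0,T)\times\widetilde\Lambda_H$ satisfy $$\int_0^T\langle\partial_tu_h,v_h\rangle+a(u_h,v_h)+b(\lambda_H,v_h)\,dt=\int_0^T\langle f,v_h\rangle\,dt,\qquad \int_0^Tb(\mu_H-\lambda_H,u_h)\,dt\le\int_0^T\langle\mu_H-\lambda_H,w\rangle\,dt$$ for all $v_h\in\mathbb{W}_h(0,T)$ and $\mu_H\in\widetilde\Lambda_H$. Then $$\begin{aligned} &\|(u-u_h)(T)\|^2_{L^2(\Omega)}+\|u-u_h\|^2_{L^2(0,T;H)}\\ &\quad\lesssim\|\partial_t(u-v_h)\|^2_{L^2(0,T;H^* )}+\|u-v_h\|^2_{L^2(0,T;H)}+\|\lambda-\lambda_H\|^2_{L^2(0,T;H^* )}+\|\lambda-\mu_H\|^2_{L^2(0,T;H^* )}\\ &\qquad-\int_0^T\big(b(\mu_H-\lambda,u)-\langle\mu_H-\lambda,w\rangle\big)\,dt-\int_0^T\big(b(\mu-\lambda_H,u)-\langle\mu-\lambda_H,w\rangle\big)\,dt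 \end{aligned}$$ for all $(v_h,\mu_H)\in\mathbb{W}_h(0,T)\times\widetilde\Lambda_H$ and all $\mu\in\widetilde\Lambda$.
   Context: Let $0<s<1$ and let $\Omega\subset\mathbb{R}^n$ be a bounded Lipschitz domain with polygonal boundary. $H^s(\Omega)$ has norm $\|v\|_{L^2(\Omega)}+|v|_{H^s(\Omega)}$, $|v|^2_{H^s(\Omega)}=\iint_{\Omega\times\Omega}\frac{(v(x)-v(y))^2}{|x-y|^{n+2s}}\,dy\,dx$. $H^s_0(\Omega)$ is the closure in $H^s(\Omega)$ of the $v\in C^\infty(\overline\Omega)$ with $v=0$ on $\partial\Omega$; $H^{-s}(\Omega)$ is its dual. For a codimension-one set $\widetilde\Gamma$, $H^s_{\widetilde\Gamma^C}(\Omega)$ is the closure in $H^s(\Omega)$ of the $v\in C^\infty(\overline\Omega)$ with $v=0$ on $\partial\Omega\setminus\widetilde\Gamma$. $H^{1/2-s}(\widetilde\Gamma)$ is the dual of $H^{s-1/2}(\widetilde\Gamma)$. $\langle\cdot,\cdot\rangle$ denotes the appropriate duality pairing, extending the $L^2$ inner product. Functions are extended by $0$ to $\mathbb{R}^n\setminus\overline\Omega$, and $$a(u,v)=\frac{c_{n,s}}2\iint_{(\Omega\times\mathbb{R}^n)\cup(\mathbb{R}^n\times\Omega)}\frac{(u(x)-u(y))(v(x)-v(y))}{|x-y|^{n+2s}}\,dy\,dx,\qquad c_{n,s}=\frac{2^{2s}s\,\Gamma(\frac{n+2s}2)}{\pi^{n/2}\Gamma(1-s)}.$$ Standing fact: $a$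 is continuous and coercive on $H$: $a(u,v)\le C\|u\|_H\|v\|_H$, $a(u,u)\ge\alpha\|u\|_H^2$. $\mathbb{W}(0,T)=\{v\in L^2(0,T;H):\partial_tv\in L^2(0,T;H^* )\}$, a Hilbert space with squared norm $\int_0^T(\|\partial_tv\|_{H^*}^2+\|v\|_H^2)\,dt+\|v(T)\|^2_{L^2(\Omega)}$, continuously embedded in $C^0(0,T;L^2(\Omega))$; $\mathbb{W}^*(0,T)$ is its dual space. Data: $f\in L^2(0,T;H^* )$, initial value $u_0$. $\mathbb{V}_h\subset H$ is the space of continuous piecewise linear functions in $H$ on a shape-regular triangulation $\mathcal{T}_h$ of $\Omega$; $\mathbb{M}_H$ is the space of piecewise constant functions on a triangulation $\mathcal{T}_H$ and $\widetilde{\mathbb{M}}_H$ its analogue on $\widetilde\Gamma$. $\mathbb{W}_h(0,T)$ is the space of $v\in\mathbb{W}(0,T)$ with values in $\mathbb{V}_h$ (discretization in space only). In the following cases, $\mathcal{F}\ge0$ with $\mathcal F\in L^\infty(\Omega)$ in (iii) and $\mathcal F\in L^\infty(\widetilde\Gamma)$ in (iv), and the inequalities defining the sets hold for a.e. $t\in(0,T)$: (i) (obstacle) $H=H^s_0(\Omega)$, $b(\mu,v)=\langle\mu,v\rangle$, $\widetilde\Lambda=\{\mu\in\mathbb{W}^*(0,T):\forall v\in\mathbb{W}(0,T),\ v\le0,\ \langle\mu,v\rangle\ge0\text{ a.e. }t\in(0,T)\}$, $\widetilde\Lambda_H=\{\mu_H\in L^2(0,T;\mathbb{M}_H):\mu_H\le0\}$,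 $w=\chi\in H^s_0(\Omega)$. (ii) (Signorini, $s\in(\frac12,1)$) $H=H^s_{\widetilde\Gamma^C}(\Omega)$, $b(\mu,v)=\langle\mu,v|_{\widetilde\Gamma}\rangle$, $\widetilde\Lambda=\{\mu\in L^2(0,T;H^{1/2-s}(\widetilde\Gamma)):\forall v\in L^2(0,T;H^{s-1/2}(\widetilde\Gamma)),\ v\le0,\ \langle\mu,v\rangle\ge0\text{ a.e. }t\in(0,T)\}$, $\widetilde\Lambda_H=\{\mu_H\in L^2(0,T;\widetilde{\mathbb{M}}_H):\mu_H\le0\}$, $w=g\in H^{s-1/2}(\widetilde\Gamma)$. (iii) (interior friction) $H=H^s_0(\Omega)$, $b(\mu,v)=\langle\mu,v\rangle$, $\widetilde\Lambda=\{\mu\in\mathbb{W}^*(0,T):\forall v\in\mathbb{W}(0,T),\ \langle\mu,v\rangle\le\langle\mathcal{F},|v|\rangle\text{ a.e. }t\in(0,T)\}$, $\widetilde\Lambda_H=\{\mu_H\in L^2(0,T;\mathbb{M}_H):|\mu_H|\le\mathcal{F}\}$, $w=0$. (iv) (friction, $s\in(\frac12,1)$) $H=H^s_{\widetilde\Gamma^C}(\Omega)$, $b(\mu,v)=\langle\mu,v|_{\widetilde\Gamma}\rangle$, $\widetilde\Lambda=\{\mu\in L^2(0,T;H^{1/2-s}(\widetilde\Gamma)):\forall v\in L^2(0,T;H^{s-1/2}(\widetilde\Gamma)),\ \langle\mu,v\rangle\le\langle\mathcal{F},|v|\rangle\text{ a.e. }t\in(0,T)\}$, $\widetilde\Lambda_H=\{\mu_H\in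 L^2(0,T;\widetilde{\mathbb{M}}_H):|\mu_H|\le\mathcal{F}\}$, $w=0$. For $\mu\in\mathbb{W}^*(0,T)$, $\int_0^Tb(\mu,v)\,dt=\int_0^T\langle\mu,v\rangle\,dt$ denotes the pairing of $\mathbb{W}^*(0,T)$ with $\mathbb{W}(0,T)$. A multiplier is identified with the functional $v\mapsto b(\mu,v)$, and $\|\mu\|_{L^2(0,T;H^* )}$ is the norm of this functional in $L^2(0,T;H^* )$ (read as $+\infty$ if it does not lie in that space). $X\lesssim Y$ means $X\le C'Y$ with $C'>0$ independent of the mesh sizes, the data and the solutions.
   Formalization: Adds that u_h(0) is the L²-projection of u_0 onto V_h (no initial condition is given for u_h, and the claim then fails), and uses separate constants for the four squared norms and for the signed residual integrals, since a single common constant fails. *)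

(* Defs.v *)
From HB Require Import structures.
From mathcomp Require Import all_boot all_order all_algebra.
From mathcomp Require Import all_classical all_reals all_analysis measurable_realfun.

Set Implicit Arguments.
Unset Strict Implicit.
Unset Printing Implicit Defensive.
Import Order.TTheory GRing.Theory Num.Theory.
Import numFieldNormedType.Exports.

Local Open Scope classical_set_scope.
Local Open Scope ring_scope.

Definition rV_display : measure_display.
Proof. exact: measure_tuple_display default_measure_display. Qed.

Section measurable_rV.
Context (R : realType) (n : nat).

Let coord (i : 'I_n) (x : 'rV[R]_n) : R := x ord0 i.

Let rV0 : g_sigma_preimage coord set0. Proof. exact: sigma_algebra0. Qed.

Let rVC A : g_sigma_preimage coord A -> g_sigma_preimage coord (~` A).
Proof. exact: sigma_algebraC. Qed.

Let rVU (F : _^nat) : (forall i, g_sigma_preimage coord (F i)) ->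
  g_sigma_preimage coord (\bigcup_i F i).
Proof. exact: sigma_algebra_bigcup. Qed.

(* The sigma-algebra generated by the coordinates, that is, the Borel sets of
   R^n. *)
HB.instance Definition _ := @isMeasurable.Build rV_display 'rV[R]_n
  (g_sigma_preimage coord) rV0 rVC rVU.

Lemma measurable_coord (i : 'I_n) :
  measurable_fun [set: 'rV[R]_n] (fun x : 'rV[R]_n => x ord0 i).
Proof.
move=> _ Y mY; rewrite setTI; apply: sub_sigma_algebra => /=.
rewrite -bigcup_seq/=; exists i => /=; first by rewrite mem_index_enum.
by exists Y => //; rewrite setTI.
Qed.

Lemma measurable_fun_rV d (T : measurableType d) (f : T -> 'rV[R]_n) :
  (forall i, measurable_fun [set: T] (fun x => f x ord0 i)) ->
  measurable_fun [set: T] f.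
Proof.
move=> mf _ A mA; rewrite setTI.
have : g_sigma_preimage coord A by [].
suff : g_sigma_preimage coord `<=` [set B | measurable (f @^-1` B)] by apply.
apply: smallest_sub.
  split=> /=; first by rewrite preimage_set0.
  - by move=> B mB; rewrite setTD preimage_setC; exact: measurableC.
  - by move=> F mF; rewrite preimage_bigcup; exact: bigcup_measurable.
rewrite -bigcup_seq => B [i _ [Y mY]]; rewrite setTI => <- /=.
by have := mf i measurableT _ mY; rewrite setTI.
Qed.

End measurable_rV.

Section push_measure.
Context d d' (T1 : measurableType d) (T2 : measurableType d') (R : realType).
Variables (f : T1 -> T2) (mf : measurable_fun [set: T1] f).
Variable m : {measure set T1 -> \bar R}.

Definition push : set T2 -> \bar R := fun A => m (f @^-1` A).

Let mpre A : measurable A -> measurable (f @^-1` A).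
Proof. by move=> mA; rewrite -[X in measurable X]setTI; exact: mf. Qed.

Let push0 : push set0 = 0%E. Proof. by rewrite /push preimage_set0 measure0. Qed.

Let push_ge0 A : (0 <= push A)%E. Proof. exact: measure_ge0. Qed.

Let push_sigma_additive : semi_sigma_additive push.
Proof.
move=> F mF tF mUF; rewrite /push preimage_bigcup.
apply: measure_semi_sigma_additive.
- by move=> n; exact: mpre.
- apply/trivIsetP => /= i j _ _ ij; rewrite -preimage_setI.
  by move/trivIsetP : tF => /(_ _ _ _ _ ij) ->//; rewrite preimage_set0.
- by rewrite -preimage_bigcup; exact: mpre.
Qed.

Definition push_measure : {measure set T2 -> \bar R} :=
  HB.pack_for {measure set T2 -> \bar R} push
    (isMeasure.Build _ _ _ push push0 push_ge0 push_sigma_additive).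

End push_measure.

Section lebesgue_rV.
Context (R : realType).

Definition rV_cons n (p : 'rV[R]_n * measurableTypeR R) : 'rV[R]_n.+1 :=
  \row_i (if unlift ord0 i is Some j then p.1 ord0 j else p.2).

Lemma measurable_rV_cons n : measurable_fun [set: 'rV[R]_n * measurableTypeR R] (@rV_cons n).
Proof.
apply: measurable_fun_rV => i.
under eq_fun do rewrite mxE.
case: unlift => [j|]; last exact: measurable_snd.
exact: (measurableT_comp (@measurable_coord R n j) measurable_fst).
Qed.

(* Lebesgue measure on R^n: the point mass on R^0, then iterated products. *)
Fixpoint lebesgue_rV_rec n : {measure set 'rV[R]_n -> \bar R} :=
  if n is n'.+1 then
    push_measure (@measurable_rV_cons n')
      (lebesgue_rV_rec n' \x (@lebesgue_measure R))%E
  else dirac (0 : 'rV[R]_0).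

Definition lebesgue_rV n : set 'rV[R]_n -> \bar R := lebesgue_rV_rec n.

HB.instance Definition _ n := Measure.on (@lebesgue_rV n).

Definition cube n (a : R) : set 'rV[R]_n :=
  [set x | forall i, - a <= x ord0 i <= a].

Lemma measurable_cube n a : measurable (@cube n a).
Proof.
rewrite (_ : cube a =
    \bigcap_(i in [set: 'I_n]) ((fun x : 'rV[R]_n => x ord0 i) @^-1` `[- a, a])).
  apply: fin_bigcap_measurable => // i _.
  by rewrite -[X in measurable X]setTI; exact: measurable_coord.
apply/seteqP; split=> x /= xa i; first by move=> _; rewrite /= in_itv/= xa.
by have := xa i I; rewrite /= in_itv.
Qed.

Lemma lebesgue_cube n a : (lebesgue_rV (@cube n a) < +oo)%E.
Proof.
elim: n => [|n ih]; rewrite /lebesgue_rV/=.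
  by rewrite /dirac/= /dirac indicE ltry.
rewrite /push (_ : _ @^-1` _ = @cube n a `*` `[- a, a]).
  rewrite product_measure1E//; last exact: measurable_cube.
  apply: lte_mul_pinfty => //; first by rewrite ge0_fin_numE// measure_ge0.
  rewrite [ltLHS](lebesgue_measure_itv `[- a, a])/=.
  by case: ifP => // _; rewrite -EFinB ltry.
apply/seteqP; split=> -[x y] /=.
- move=> xy; split=> [i|].
    by have := xy (lift ord0 i); rewrite mxE liftK.
  by have := xy ord0; rewrite mxE unlift_none/= in_itv.
- by case=> xa; rewrite in_itv/= => ya i; rewrite mxE; case: unliftP.
Qed.

Let lebesgue_rV_sigma_finite n : sigma_finite [set: 'rV[R]_n] (@lebesgue_rV n).
Proof.
exists (fun k => @cube n k%:R).
  apply/seteqP; split=> // x _.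
  exists (Num.truncn (\sum_i `|x ord0 i|)).+1 => // i.
  rewrite -ler_norml; apply: le_trans (ltW (truncnS_gt _)).
  by rewrite (bigD1 i)//= lerDl sumr_ge0.
by move=> k; split; [exact: measurable_cube|exact: lebesgue_cube].
Qed.

HB.instance Definition _ n := @Measure_isSigmaFinite.Build _ _ _ (@lebesgue_rV n)
  (@lebesgue_rV_sigma_finite n).

End lebesgue_rV.

Section simplices.
Context (R : realType).

(* A k-simplex of R^n is the matrix of its k+1 vertices (the rows). *)
Definition edges k n (V : 'M[R]_(k.+1, n)) : 'M[R]_(k, n) :=
  \matrix_i (row (lift ord0 i) V - row ord0 V).

Definition nondegenerate k n (V : 'M[R]_(k.+1, n)) := row_free (edges V).

Definition hull k n (V : 'M[R]_(k.+1, n)) : set 'rV[R]_n :=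
  [set x | exists c : 'rV[R]_k.+1,
    [/\ forall i, 0 <= c ord0 i, \sum_i c ord0 i = 1 & x = c *m V]].

Definition common_face k n (V W : 'M[R]_(k.+1, n)) : set 'rV[R]_n :=
  [set x | exists c : 'rV[R]_k.+1,
    [/\ forall i, 0 <= c ord0 i, \sum_i c ord0 i = 1, x = c *m V &
        forall i, c ord0 i != 0 -> exists j, row i V = row j W]].

(* Conforming triangulation of D by k-simplices; each simplex is listed once. *)
Definition triangulation k n (D : set 'rV[R]_n) (Th : seq 'M[R]_(k.+1, n)) :=
  [/\ uniq Th,
      (forall V, V \in Th -> nondegenerate V),
      (forall V W, V \in Th -> W \in Th -> hull V `&` hull W = common_face V W),
      (forall V W, V \in Th -> W \in Th -> hull V = hull W -> V = W) &
      D = \bigcup_(V in [set` Th]) hull V].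

Definition std_simplex k : set 'rV[R]_k :=
  [set t | (forall i, 0 <= t ord0 i) /\ \sum_i t ord0 i <= 1].

Lemma measurable_std_simplex k : measurable (@std_simplex k).
Proof.
rewrite (_ : @std_simplex k = (\bigcap_(i in [set: 'I_k])
    ((fun x : 'rV[R]_k => x ord0 i) @^-1` `[0, +oo[)) `&`
    ((fun x : 'rV[R]_k => \sum_i x ord0 i) @^-1` `]-oo, 1])).
  apply: measurableI.
    apply: fin_bigcap_measurable => // i _.
    by rewrite -[X in measurable X]setTI; exact: measurable_coord.
  rewrite -[X in measurable X]setTI; apply: measurable_sum => // i.
  exact: measurable_coord.
apply/seteqP; split=> t /=; rewrite in_itv/= => -[t0 t1]; split=> // i.
  by move=> _; rewrite /= in_itv/= t0.
by have := t0 i I; rewrite /= in_itv/= andbT.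
Qed.

Definition chart k n (V : 'M[R]_(k.+1, n)) (t : 'rV[R]_k) : 'rV[R]_n :=
  row ord0 V + t *m edges V.

Lemma measurable_chart k n (V : 'M[R]_(k.+1, n)) :
  measurable_fun [set: 'rV[R]_k] (chart V).
Proof.
apply: measurable_fun_rV => i.
under eq_fun do rewrite mxE [X in _ + X]mxE.
apply: measurable_funD; first exact: measurable_cst.
apply: measurable_sum => j; apply: measurable_funM.
  exact: measurable_coord.
exact: measurable_cst.
Qed.

Definition gram k n (V : 'M[R]_(k.+1, n)) : R :=
  Num.sqrt (\det (edges V *m (edges V)^T)).

Lemma gram_ge0 k n (V : 'M[R]_(k.+1, n)) : 0 <= gram V.
Proof. exact: sqrtr_ge0. Qed.

(* k-dimensional surface measure of one simplex, by the area formula for its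
   affine chart. *)
Definition simplex_measure k n (V : 'M[R]_(k.+1, n)) :
    {measure set 'rV[R]_n -> \bar R} :=
  mscale (NngNum (gram_ge0 V)) (push_measure (measurable_chart V)
    (mrestr (@lebesgue_rV R k) (@measurable_std_simplex k))).

Definition surface k n (G : seq 'M[R]_(k.+1, n)) : set 'rV[R]_n -> \bar R :=
  msum (fun i => simplex_measure (nth 0 G i)) (size G).

HB.instance Definition _ k n (G : seq 'M[R]_(k.+1, n)) :=
  Measure.on (surface G).

Let surface_fin k n (G : seq 'M[R]_(k.+1, n)) : fin_num_fun (surface G).
Proof.
move=> A mA; rewrite ge0_fin_numE// /surface /msum; apply: lte_sum_pinfty => i _.
rewrite /simplex_measure/= /mscale/=.
apply: lte_mul_pinfty => //; first by rewrite lee_fin gram_ge0.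
apply: le_lt_trans (@lebesgue_cube R k 1).
apply: le_measure; rewrite ?inE.
- apply: measurableI; last exact: measurable_std_simplex.
  by rewrite -[X in measurable X]setTI; exact: measurable_chart.
- exact: measurable_cube.
- move=> t [_ [t0 t1]] j; rewrite (le_trans _ (t0 j)) ?lerN10//=.
  by apply: le_trans t1; rewrite (bigD1 j)//= lerDl sumr_ge0.
Qed.

HB.instance Definition _ k n (G : seq 'M[R]_(k.+1, n)) :=
  @Measure_isFinite.Build _ _ _ (surface G) (surface_fin G).

End simplices.

Section geometry.
Context (R : realType) (n : nat).
Implicit Types (x y : 'rV[R]_n) (D : set 'rV[R]_n).

Definition dotp x y : R := \sum_i x ord0 i * y ord0 i.
(* The library norm on 'rV[R]_n is the sup norm. *)
Definition enorm x : R := Num.sqrt (dotp x x).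

Definition bnd D : set 'rV[R]_n := closure D `\` interior D.

(* Near each boundary point D is the strict epigraph of a Lipschitz function in
   some direction nu; psi is only evaluated on the hyperplane orthogonal to
   nu. *)
Definition lipschitz_bnd D := forall x, bnd D x ->
  exists (nu : 'rV[R]_n) (psi : 'rV[R]_n -> R) (r L : R),
    [/\ enorm nu = 1, 0 < r,
        (forall y z, `|psi y - psi z| <= L * enorm (y - z)) &
        (forall y, enorm (y - x) < r ->
           (D y <-> psi (y - dotp y nu *: nu) < dotp y nu))].

Definition polygonal_bnd D := exists2 F : seq 'M[R]_(n.-1.+1, n),
  (forall V, V \in F -> nondegenerate V) &
  bnd D = \bigcup_(V in [set` F]) hull V.

Definition bounded_polygonal_lipschitz_domain D :=
  [/\ D !=set0, open D, connected D, (exists M, forall x, D x -> enorm x <= M) &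
      lipschitz_bnd D /\ polygonal_bnd D].

Definition shape_regular (kappa : R) (Th : seq 'M[R]_(n.+1, n)) :=
  forall K, K \in Th -> exists x (rho : R),
    [/\ 0 < rho, (forall y, enorm (y - x) < rho -> hull K y) &
        (forall y z, hull K y -> hull K z -> enorm (y - z) <= kappa * rho)].

Fixpoint Ck (k : nat) (f : 'rV[R]_n -> R) : Prop :=
  continuous f /\
  if k is j.+1 then
    forall i : 'I_n, (forall x, derivable f x (delta_mx ord0 i)) /\
                     Ck j (fun x => 'D_(delta_mx ord0 i) f x)
  else True.

(* On a Lipschitz domain D, the restrictions to the closure of D of these
   functions are the smooth functions up to the boundary. *)
Definition smooth (f : 'rV[R]_n -> R) := forall k, Ck k f.

End geometry.

Section sobolev.
Context (R : realType) (n : nat).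
Implicit Types (D : set 'rV[R]_n) (v : 'rV[R]_n -> R)
  (m : {sigma_finite_measure set 'rV[R]_n -> \bar R}).

Definition l2sq m D v : \bar R := \int[m]_(x in D) (v x ^+ 2)%:E.
Definition L2 m D := [set v | measurable_fun D v /\ (l2sq m D v < +oo)%E].
Definition l2norm m D v : R := Num.sqrt (fine (l2sq m D v)).
Definition l2dot m D v1 v2 : R := \int[m]_(x in D) (v1 x * v2 x).

(* Sobolev-Slobodeckij space of order r on the d-dimensional set D with its
   measure m. *)
Definition gagliardo m D (d : nat) (r : R) v : \bar R :=
  \int[(m \x m)%E]_(p in D `*` D)
    ((v p.1 - v p.2) ^+ 2 / enorm (p.1 - p.2) `^ (d%:R + 2 * r))%:E.
Definition slobodeckij m D d r :=
  [set v | L2 m D v /\ (gagliardo m D d r v < +oo)%E].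
Definition slobodeckij_norm m D d r v : R :=
  l2norm m D v + Num.sqrt (fine (gagliardo m D d r v)).

Definition Hs D s := slobodeckij (@lebesgue_rV R n) D n s.
Definition Hs_norm D s := slobodeckij_norm (@lebesgue_rV R n) D n s.

(* Closure in H^s(D) of the smooth functions vanishing on Z. *)
Definition Hs_vanishing D s (Z : set 'rV[R]_n) := [set v | Hs D s v /\
  forall eps : R, 0 < eps -> exists phi,
    [/\ smooth phi, (forall x, Z x -> phi x = 0), Hs D s phi &
        Hs_norm D s (v - phi) < eps]].

Definition Gamma (z : R) : R :=
  \int[@lebesgue_measure R]_(t in `]0, +oo[) (t `^ (z - 1) * expR (- t)).

Definition c_ns (s : R) : R :=
  2 `^ (2 * s) * s * Gamma ((n%:R + 2 * s) / 2) /
  (pi `^ (n%:R / 2) * Gamma (1 - s)).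

Definition nonlocal_form D (s : R) v1 v2 : \bar R :=
  let e1 := v1 \_ D in let e2 := v2 \_ D in
  ((c_ns s / 2)%:E *
   \int[(@lebesgue_rV R n \x @lebesgue_rV R n)%E]_(p in
       (D `*` setT) `|` (setT `*` D))
     ((e1 p.1 - e1 p.2) * (e2 p.1 - e2 p.2) /
      enorm (p.1 - p.2) `^ (n%:R + 2 * s))%:E)%E.

End sobolev.

(* A normed space is given by a subset X of an ambient vector space together
   with a function N; members at N-distance 0 are identified. *)
Section bochner.
Context (R : realType) (V : zmodType) (X : set V) (N : V -> R) (T : R).
Implicit Type u : R -> V.

Definition simple_in u :=
  [/\ finite_set (range u), (forall z, measurable (u @^-1` [set z])) &
      forall t, X (u t)].

Definition strongly_measurable u := exists2 u_ : nat -> R -> V,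
  (forall k, simple_in (u_ k)) &
  \forall t \ae @lebesgue_measure R, 0 < t < T ->
    X (u t) /\ (N (u_ k t - u t) @[k --> \oo] --> (0 : R)).

Definition L2T_sq u : \bar R :=
  \int[@lebesgue_measure R]_(t in `]0, T[) (N (u t) ^+ 2)%:E.

Definition L2T := [set u | strongly_measurable u /\ (L2T_sq u < +oo)%E].

End bochner.

Section dual.
Context (R : realType) (V : lmodType R) (X : set V) (N : V -> R).

Definition dual : set (V -> R) := [set l |
  (forall (c : R) v1 v2, X v1 -> X v2 -> l (c *: v1 + v2) = c * l v1 + l v2) /\
  exists C : R, forall v, X v -> `|l v| <= C * N v].

Definition dual_norm (l : V -> R) : R :=
  sup [set `|l v| | v in [set v | X v /\ N v <= 1]].

End dual.

Section time.
Context (R : realType) (T : R).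

Definition smooth_time (phi : R -> R) := forall k t, derivable (derive1n k phi) t 1.

Definition test_function (phi : R -> R) := smooth_time phi /\
  exists a b, [/\ 0 < a, b < T & forall t, phi t != 0 -> a <= t <= b].

End time.

(* The space W(0,T) of the triple H, L^2(D), H*.  Its elements are the
   representatives that are continuous with values in L^2(D), so that v(0) and
   v(T) are meaningful. *)
Section parabolic.
Context (R : realType) (n : nat) (D : set 'rV[R]_n) (T : R).
Context (H : set ('rV[R]_n -> R)) (N : ('rV[R]_n -> R) -> R).
Implicit Types (v : R -> 'rV[R]_n -> R) (g : R -> ('rV[R]_n -> R) -> R).

Let leb := @lebesgue_measure R.
Let lebn := @lebesgue_rV R n.

Definition L2_dual := L2T (dual H N) (dual_norm H N) T.

Definition is_dt v g := L2_dual g /\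
  forall eta phi, H eta -> test_function T phi ->
    \int[leb]_(t in `]0, T[) (derive1 phi t * l2dot lebn D (v t) eta) =
    - \int[leb]_(t in `]0, T[) (phi t * g t eta).

Definition dt v := xget 0 [set g | is_dt v g].

Definition continuous_L2 v :=
  (forall t, 0 <= t <= T -> L2 lebn D (v t)) /\
  forall t, 0 <= t <= T -> forall eps : R, 0 < eps -> exists2 delta : R,
    0 < delta & forall r, 0 <= r <= T -> `|r - t| < delta ->
      l2norm lebn D (v r - v t) < eps.

Definition W := [set v |
  [/\ continuous_L2 v, L2T H N T v & exists g, is_dt v g]].

Definition W_norm v : R := Num.sqrt
  (fine (\int[leb]_(t in `]0, T[)
     (dual_norm H N (dt v t) ^+ 2 + N (v t) ^+ 2)%:E) +
   l2norm lebn D (v T) ^+ 2).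

Definition Wh (Vh : set ('rV[R]_n -> R)) := [set v |
  W v /\ \forall t \ae leb, 0 < t < T -> Vh (v t)].

End parabolic.

Variant contact := Obstacle | Signorini | InteriorFriction | Friction.

(* facets triangulates the codimension-one set, and tr is v |-> v restricted
   to it; both are used only in the two boundary cases. *)
Record setting (R : realType) (n : nat) := Setting {
  ckind : contact;
  sorder : R;
  Om : set 'rV[R]_n;
  Tend : R;
  facets : seq 'M[R]_(n.-1.+1, n);
  tr : ('rV[R]_n -> R) -> 'rV[R]_n -> R }.

Section problem.
Context (R : realType) (n : nat) (P : setting R n).
Local Notation E := ('rV[R]_n).
Local Notation s := (sorder P).
Local Notation T := (Tend P).
Local Notation Omega := (Om P).

Let leb := @lebesgue_measure R.

Definition thin := if ckind P is (Signorini | Friction) then true else false.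

Definition thin_set : set E := \bigcup_(V in [set` facets P]) hull V.

Definition Hsp : set (E -> R) :=
  Hs_vanishing Omega s
    (if thin then bnd Omega `\` thin_set else bnd Omega).
Definition Hnorm : (E -> R) -> R := Hs_norm Omega s.

Definition aform : (E -> R) -> (E -> R) -> \bar R := nonlocal_form Omega s.

Definition Wsp := W Omega T Hsp Hnorm.
Definition dtW := dt Omega T Hsp Hnorm.

(* H^(s - 1/2) of the codimension-one set. *)
Definition Xsp : set (E -> R) :=
  slobodeckij (surface (facets P)) thin_set n.-1 (s - 2^-1).
Definition Xnorm : (E -> R) -> R :=
  slobodeckij_norm (surface (facets P)) thin_set n.-1 (s - 2^-1).

Definition is_trace_operator :=
  [/\ (forall v, Hsp v -> Xsp (tr P v)),
      (forall (c : R) v1 v2, Hsp v1 -> Hsp v2 ->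
         \forall x \ae surface (facets P), thin_set x ->
           tr P (c *: v1 + v2) x = c * tr P v1 x + tr P v2 x),
      (exists C : R, forall v, Hsp v -> Xnorm (tr P v) <= C * Hnorm v) &
      (forall phi, smooth phi -> Hsp phi ->
         \forall x \ae surface (facets P), thin_set x ->
           tr P phi x = phi x)].

Definition admissible :=
  [/\ (0 < n)%N, 0 < s < 1, 0 < T, bounded_polygonal_lipschitz_domain Omega &
      thin -> [/\ 2^-1 < s, triangulation thin_set (facets P),
                  thin_set `<=` closure Omega & is_trace_operator]].

Definition continuous_coercive (C alpha : R) :=
  [/\ 0 < alpha,
      (forall u v, Hsp u -> Hsp v ->
         (aform u v <= (C * Hnorm u * Hnorm v)%:E)%E) &
      (forall u, Hsp u -> ((alpha * Hnorm u ^+ 2)%:E <= aform u u)%E)].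

Definition carrier : set E := if thin then thin_set else Omega.
Definition carrier_measure : {sigma_finite_measure set E -> \bar R} :=
  if thin then (surface (facets P) : {sigma_finite_measure set E -> \bar R})
  else @lebesgue_rV R n.

Definition nonpositive (z : R -> E -> R) := \forall t \ae leb, 0 < t < T ->
  \forall x \ae carrier_measure, carrier x -> z t x <= 0.

(* A multiplier mu is represented by z |-> int_0^T <mu, z> dt, where z is a
   function of time with values in the functions on the carrier.  Functionals in
   the dual of W(0,T) need not have values at almost every t. *)
Definition multiplier := (R -> E -> R) -> R.

Definition of_density (q : R -> E -> R) : multiplier := fun z =>
  \int[leb]_(t in `]0, T[) l2dot carrier_measure carrier (q t) (z t).

Definition of_functional (m : R -> (E -> R) -> R) : multiplier := fun z =>
  \int[leb]_(t in `]0, T[) m t (z t).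

(* int_0^T b(mu, v) dt and int_0^T <mu, w> dt *)
Definition int_b (mu : multiplier) (v : R -> E -> R) : R :=
  mu (if thin then fun t => tr P (v t) else v).
Definition int_pair (mu : multiplier) (w : E -> R) : R := mu (fun=> w).

(* For mu in the dual of W(0,T), t |-> <mu, v> is the distribution
   phi |-> mu(phi v), and an inequality for a.e. t is tested against the
   nonnegative smooth phi on [0,T]. *)
Definition Lam (F : E -> R) : set multiplier :=
  match ckind P with
  | Obstacle => [set mu | dual Wsp (W_norm Omega T Hsp Hnorm) mu /\
      forall v phi, Wsp v -> nonpositive v ->
        smooth_time phi -> (forall t, 0 <= phi t) ->
        0 <= mu (fun t => phi t *: v t)]
  | Signorini => of_functional @` [set m | L2_dual T Xsp Xnorm m /\
      forall z, L2T Xsp Xnorm T z -> nonpositive z ->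
        \forall t \ae leb, 0 < t < T -> 0 <= m t (z t)]
  | InteriorFriction => [set mu | dual Wsp (W_norm Omega T Hsp Hnorm) mu /\
      forall v phi, Wsp v -> smooth_time phi -> (forall t, 0 <= phi t) ->
        mu (fun t => phi t *: v t) <=
        \int[leb]_(t in `]0, T[)
          (phi t * l2dot carrier_measure carrier F (fun x => `|v t x|))]
  | Friction => of_functional @` [set m | L2_dual T Xsp Xnorm m /\
      forall z, L2T Xsp Xnorm T z ->
        \forall t \ae leb, 0 < t < T ->
          m t (z t) <= l2dot carrier_measure carrier F (fun x => `|z t x|)]
  end.

Definition piecewise_constant (cells : seq (set E)) := [set q : E -> R |
  L2 carrier_measure carrier q /\
  forall K, K \in cells ->
    exists c : R, \forall x \ae carrier_measure, K x -> q x = c].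

(* TH is the multiplier mesh of Omega, GH that of the codimension-one set. *)
Definition LamH (F : E -> R)
    (TH : seq 'M[R]_(n.+1, n)) (GH : seq 'M[R]_(n.-1.+1, n)) : set multiplier :=
  let cells := if thin then map (@hull R n.-1 n) GH else map (@hull R n n) TH in
  of_density @` [set q |
    L2T (piecewise_constant cells) (l2norm carrier_measure carrier) T q /\
    match ckind P with
    | Obstacle | Signorini => nonpositive q
    | InteriorFriction | Friction => nonpositive (fun t x => `|q t x| - F x)
    end].

Definition Vh (Th : seq 'M[R]_(n.+1, n)) := [set v | Hsp v /\
  exists phi : E -> R,
    [/\ {within closure Omega, continuous phi},
        (forall K, K \in Th -> exists (l : 'rV[R]_n) (c : R),
           forall x, hull K x -> phi x = dotp l x + c) &
        \forall x \ae @lebesgue_rV R n, Omega x -> v x = phi x]].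

Definition Whsp (Th : seq 'M[R]_(n.+1, n)) := Wh Omega T Hsp Hnorm (Vh Th).

Definition mesh_ok (kappa : R) (Th TH : seq 'M[R]_(n.+1, n))
    (GH : seq 'M[R]_(n.-1.+1, n)) :=
  [/\ triangulation (closure Omega) Th, shape_regular kappa Th &
      if thin then triangulation thin_set GH
      else triangulation (closure Omega) TH].

Definition data_ok (F : E -> R) (f : R -> (E -> R) -> R) (u0 w : E -> R) :=
  [/\ L2_dual T Hsp Hnorm f, L2 (@lebesgue_rV R n) Omega u0,
      match ckind P with
      | Obstacle => Hsp w
      | Signorini => Xsp w
      | InteriorFriction | Friction => w = 0
      end &
      match ckind P with
      | Obstacle | Signorini => True
      | InteriorFriction | Friction =>
          measurable_fun carrier F /\
          exists M : R, \forall x \ae carrier_measure,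
            carrier x -> 0 <= F x <= M
      end].

(* The mixed variational inequality with trial and test space Y and multiplier
   set L. *)
Definition mixed_solution (Y : set (R -> E -> R)) (L : set multiplier)
    (f : R -> (E -> R) -> R) (w : E -> R) (u : R -> E -> R) (la : multiplier) :=
  [/\ Y u, L la,
      (forall v, Y v ->
         \int[leb]_(t in `]0, T[) (dtW u t (v t) + fine (aform (u t) (v t))) +
         int_b la v = \int[leb]_(t in `]0, T[) f t (v t)) &
      (forall mu, L mu -> int_b (mu - la) u <= int_pair (mu - la) w)].

(* Squared norm of v |-> b(mu, v) in L^2(0,T;H* ); it is +oo if no element of
   that space represents the functional. *)
Definition mult_normsq (mu : multiplier) : \bar R :=
  ereal_inf [set L2T_sq (dual_norm Hsp Hnorm) T g | g in [set g |
    L2_dual T Hsp Hnorm g /\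
    forall v, Wsp v -> int_b mu v = \int[leb]_(t in `]0, T[) g t (v t)]].

End problem.

(* Main.v *)
Require Import Defs.
From mathcomp Require Import all_boot all_order all_algebra.
From mathcomp Require Import all_classical all_reals all_analysis.
From mathcomp Require Import measurable_realfun.
From mathcomp Require Import ring lra.

Set Implicit Arguments.
Unset Strict Implicit.
Unset Printing Implicit Defensive.
Import Order.TTheory GRing.Theory Num.Theory.
Import numFieldNormedType.Exports.

Local Open Scope classical_set_scope.
Local Open Scope ring_scope.

(** Write [xi = vh - uh] and [eta = u - vh], so that the error [u - uh] is
    [eta + xi]. Discrete test functions are continuous ones, hence both
    equations may be tested with [xi]; if [g1] represents [la - laH] in the
    dual of L^2(0,T;H), their difference is
<<
  int (<dt xi, xi> + a(xi, xi)) = - int (<dt eta, xi> + a(eta, xi) + <g1, xi>)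
>>
    The energy identity [2 int <dt v, v> = |v(T)|^2 - |v(0)|^2], coercivity and
    Young's inequality bound [|xi(T)|^2 + ||xi||^2] by the squared norms of [eta],
    [dt eta] and [g1], up to [|xi(0)|^2]. Since [uh(0) - u0] is orthogonal to the
    discrete space and [xi] is continuous at 0 with values in L^2,
    [uh(0) - u0] is orthogonal to [xi(0)], so that [|xi(0)| <= |eta(0)|]; this
    value, like [|eta(T)|], is controlled by the norms of [eta] and [dt eta]
    through the trace bound [T |v(t)|^2 <= ||v||^2 + 2 T ||dt v|| ||v||].

    The two residual terms on the right of the estimate may be negative. Let [S]
    be their sum and let [g2] represent [la - muH]. Adding the continuous
    inequality for [mu] and the discrete one for [muH] gives
    [S >= int <g2 - g1, u - uh> >= - (||g1|| + ||g2||) ||u - uh||], so that [S] can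
    be added to the previous bound with factor one, at the price of another use
    of Young's inequality. The resulting estimate holds for all representatives
    [g1] and [g2], hence for the infima that define the multiplier norms, which
    are [+oo] when there is none.

    The analytic core is the energy identity [lions_magenes]: [dt v] is only a
    weak derivative, tested against [phi(t) psi] with [psi] in H. First, for fixed
    [z] in H, the function [(v(t), z)] is a primitive of [<dt v, z>]
    ([weak_derivative_primitive]); this needs the smooth cutoffs built from
    [exp(-1/x)]. Then [(2h)^-1 int_a^b (v(t+h) - v(t-h), v(t)) dt] is computed in
    two ways. The integrand has the form [A(t) - A(t-h)] with
    [A(t) = (v(t+h), v(t))], which gives the limit [(|v(b)|^2 - |v(a)|^2) / 2]; and
    approximating [v] by simple functions gives the limit
    [int_a^b <dt v, v>], because symmetric difference quotients of a primitive
    converge in L^1 to the integrand ([sym_quotient_cvg]). The polarized identity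
    also shows that any two time derivatives of a function have the same integral
    against members of W(0,T), so that nothing depends on which one is chosen
    ([W_energy_polar]). *)

(** * Integrals up to null sets *)

Lemma ae_imp d (X : measurableType d) (R : realType) (mu : {measure set X -> \bar R})
    (P Q : X -> Prop) : (forall x, P x -> Q x) ->
  (\forall x \ae mu, P x) -> \forall x \ae mu, Q x.
Proof. by move=> PQ; apply: filterS. Qed.

Lemma ae_imp2 d (X : measurableType d) (R : realType) (mu : {measure set X -> \bar R})
    (P1 P2 Q : X -> Prop) : (forall x, P1 x -> P2 x -> Q x) ->
  (\forall x \ae mu, P1 x) -> (\forall x \ae mu, P2 x) -> \forall x \ae mu, Q x.
Proof. by move=> PQ; apply: filterS2. Qed.

Section ae_integral.
Context d (X : measurableType d) (R : realType) (mu : {measure set X -> \bar R}).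
Import HBNNSimple.

Let ge0_ae_le_integral D (f g : X -> \bar R) :
  (forall x, D x -> 0 <= f x)%E -> (forall x, D x -> 0 <= g x)%E ->
  (\forall x \ae mu, D x -> f x = g x) ->
  (\int[mu]_(x in D) f x <= \int[mu]_(x in D) g x)%E.
Proof.
move=> f0 g0 [N [mN N0 fgN]].
rewrite [leLHS]ge0_integralE// [leRHS]ge0_integralE//.
apply: ge_ereal_sup => _ [h /= hf <-].
have mN' : measurable (~` N) by exact: measurableC.
apply: le_ereal_sup_tmp; exists (sintegral mu (proj_nnsfun h mN')).
  exists (proj_nnsfun h mN') => //= x; rewrite /= /proj_nnsfun /= mindicE.
  have [xN|xN] := boolP (x \in ~` N); last first.
    by rewrite mulr0 /patch; case: ifPn => // /set_mem Dx; exact: g0.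
  rewrite mulr1; have := hf x; rewrite /patch.
  case: ifPn => // /set_mem Dx.
  suff -> : f x = g x by [].
  apply: contrapT => fgx; move/set_mem : xN; apply; apply: fgN => /=.
  by move/(_ Dx).
rewrite -!integralT_nnsfun le_eqVlt; apply/orP; left; apply/eqP.
apply: ae_eq_integral => //.
- exact/measurable_EFinP.
- exact/measurable_EFinP.
exists N; split => // x /=; apply: contra_notP => xN _.
by rewrite mindicE mem_set//= mulr1.
Qed.

(** The integral of each sign part is a supremum over simple functions below it,
    and restricting a simple function to the complement of a null set keeps its
    integral: hence null sets are ignored even if neither function is
    measurable. *)
Lemma integral_ae D (f g : X -> \bar R) :
  (\forall x \ae mu, D x -> f x = g x) ->
  (\int[mu]_(x in D) f x = \int[mu]_(x in D) g x)%E.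
Proof.
move=> fg; have gf : \forall x \ae mu, D x -> g x = f x.
  by apply: filterS fg => x fgx /fgx.
rewrite integralE [RHS]integralE; congr (_ - _)%E; apply/eqP; rewrite eq_le.
  apply/andP; split; apply: ge0_ae_le_integral => //;
    [apply: filterS fg|apply: filterS gf] => x fgx Dx;
    by rewrite !funeposE fgx.
apply/andP; split; apply: ge0_ae_le_integral => //;
  [apply: filterS fg|apply: filterS gf] => x fgx Dx;
  by rewrite !funenegE fgx.
Qed.

Lemma Rintegral_ae D (f g : X -> R) :
  (\forall x \ae mu, D x -> f x = g x) ->
  \int[mu]_(x in D) f x = \int[mu]_(x in D) g x.
Proof.
move=> fg; rewrite /Rintegral; congr fine; apply: integral_ae.
by apply: filterS fg => x fgx /fgx ->.
Qed.

(** Bochner functions are given by arbitrary representatives, whose pairings need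
    not be measurable; they only agree almost everywhere with an integrable
    function. *)
Definition aeint D (f : X -> R) :=
  exists2 g, mu.-integrable D (EFin \o g) & \forall x \ae mu, D x -> f x = g x.

Lemma aeint_ext D (f g : X -> R) :
  (\forall x \ae mu, D x -> f x = g x) -> aeint D g -> aeint D f.
Proof.
move=> fg [h ih gh]; exists h => //.
by apply: filterS2 fg gh => x fg gh Dx; rewrite fg// gh.
Qed.

Lemma aeintW D f : mu.-integrable D (EFin \o f) -> aeint D f.
Proof. by move=> fi; exists f => //; apply: aeW. Qed.

Context (D : set X) (mD : measurable D).

Lemma aeint_lin c f g : aeint D f -> aeint D g -> aeint D (fun x => c * f x + g x).
Proof.
move=> [f' if' ff'] [g' ig' gg']; exists (fun x => c * f' x + g' x).
  rewrite (_ : _ \o _ = (fun x => c%:E * (EFin \o f') x) \+ (EFin \o g'))%E//.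
  by apply: integrableD => //; exact: integrableZl.
by apply: filterS2 ff' gg' => x ff' gg' Dx; rewrite ff'// gg'.
Qed.

Lemma Rintegral_lin c f g : aeint D f -> aeint D g ->
  \int[mu]_(x in D) (c * f x + g x) =
  c * \int[mu]_(x in D) f x + \int[mu]_(x in D) g x.
Proof.
move=> [f' if' ff'] [g' ig' gg'].
rewrite (Rintegral_ae ff') (Rintegral_ae gg') -RintegralZl// -RintegralD//.
  by apply: Rintegral_ae; apply: filterS2 ff' gg' => x ff' gg' Dx; rewrite ff'// gg'.
by exact: (integrableZl mD c if').
Qed.

Lemma aeint0 : aeint D (cst 0).
Proof. by apply: aeintW; exact: integrable0. Qed.

Lemma aeintZ c f : aeint D f -> aeint D (fun x => c * f x).
Proof.
move=> fi; have := aeint_lin c fi aeint0.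
by apply: aeint_ext; apply: aeW => x _ /=; rewrite addr0.
Qed.

Lemma aeintD f g : aeint D f -> aeint D g -> aeint D (fun x => f x + g x).
Proof.
move=> fi gi; have := aeint_lin 1 fi gi.
by apply: aeint_ext; apply: aeW => x _ /=; rewrite mul1r.
Qed.

Lemma aeintB f g : aeint D f -> aeint D g -> aeint D (fun x => f x - g x).
Proof.
move=> fi gi; have := aeint_lin (-1) gi fi.
by apply: aeint_ext; apply: aeW => x _ /=; rewrite mulN1r addrC.
Qed.

Lemma aeint_RintegralZ c f : aeint D f ->
  \int[mu]_(x in D) (c * f x) = c * \int[mu]_(x in D) f x.
Proof.
move=> fi; rewrite -[RHS]addr0 -[X in _ = _ + X](_ : \int[mu]_(x in D) (cst 0) x = 0).
  rewrite -Rintegral_lin//; last exact: aeint0.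
  by apply: eq_Rintegral => x _; rewrite addr0.
by rewrite /Rintegral integral0.
Qed.

Lemma aeint_RintegralD f g : aeint D f -> aeint D g ->
  \int[mu]_(x in D) (f x + g x) = \int[mu]_(x in D) f x + \int[mu]_(x in D) g x.
Proof.
move=> fi gi; rewrite -[X in _ = X + _]mul1r -Rintegral_lin//.
by apply: eq_Rintegral => x _; rewrite mul1r.
Qed.

Lemma aeint_RintegralB f g : aeint D f -> aeint D g ->
  \int[mu]_(x in D) (f x - g x) = \int[mu]_(x in D) f x - \int[mu]_(x in D) g x.
Proof.
move=> fi gi; rewrite addrC -mulN1r -Rintegral_lin//.
by apply: eq_Rintegral => x _; rewrite mulN1r addrC.
Qed.

Lemma aeint_norm f : aeint D f -> aeint D (fun x => `|f x|).
Proof.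
move=> [f' if' ff']; exists (fun x => `|f' x|); first exact: integrable_norm.
by apply: filterS ff' => x ff' Dx; rewrite ff'.
Qed.

Lemma aeint_le_Rintegral f g : aeint D f -> aeint D g ->
  (\forall x \ae mu, D x -> f x <= g x) ->
  \int[mu]_(x in D) f x <= \int[mu]_(x in D) g x.
Proof.
move=> fi gi fg; rewrite -subr_ge0 -aeint_RintegralB//.
rewrite (@Rintegral_ae _ _ (fun x => `|g x - f x|)); first exact: Rintegral_ge0.
by apply: filterS fg => x fg Dx; rewrite ger0_norm// subr_ge0 fg.
Qed.

Lemma aeint_normr_le f g : aeint D f -> aeint D g ->
  (\forall x \ae mu, D x -> `|f x| <= g x) ->
  `|\int[mu]_(x in D) f x| <= \int[mu]_(x in D) g x.
Proof.
move=> fi gi fg; rewrite ler_norml; apply/andP; split; last first.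
  by apply: aeint_le_Rintegral => //; apply: filterS fg => x /[apply];
     apply/le_trans/ler_norm.
rewrite lerNl -mulN1r -aeint_RintegralZ//.
apply: aeint_le_Rintegral => //; first exact: aeintZ.
by apply: filterS fg => x /[apply]; apply/le_trans; rewrite mulN1r -normrN ler_norm.
Qed.

Lemma aeint_integral f : aeint D f ->
  (\int[mu]_(x in D) (f x)%:E = (\int[mu]_(x in D) f x)%:E)%E.
Proof.
move=> [f' if' ff'].
rewrite (Rintegral_ae ff') /Rintegral fineK; last exact: integrable_fin_num.
by apply: integral_ae; apply: filterS ff' => x /[apply] ->.
Qed.

Lemma integrable_EFinZ c f : mu.-integrable D (EFin \o f) ->
  mu.-integrable D (EFin \o (fun x => c * f x)).
Proof. exact: (integrableZl mD c). Qed.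

Lemma Rintegral_dominated (f_ : nat -> X -> R) (f g : X -> R) :
  (forall n, measurable_fun D (f_ n)) ->
  (forall x, D x -> f_ n x @[n --> \oo] --> f x) ->
  mu.-integrable D (EFin \o g) ->
  (forall n x, D x -> `|f_ n x| <= g x) ->
  mu.-integrable D (EFin \o f) /\
  (\int[mu]_(x in D) f_ n x @[n --> \oo] --> \int[mu]_(x in D) f x).
Proof.
move=> mf_ f_f ig fg.
have mf : measurable_fun D f by exact: measurable_fun_cvg f_f.
have f_fE x : D x -> (f_ n x)%:E @[n --> \oo] --> (f x)%:E.
  by move=> Dx; apply/fine_cvgP; split; [exact: nearW|exact: f_f].
have [fi _ h] := @dominated_convergence _ _ _ mu D mD (fun n x => (f_ n x)%:E)
  (EFin \o f) (EFin \o g) (fun n => (measurable_EFinP _ _).2 (mf_ n))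
  ((measurable_EFinP _ _).2 mf)
  (aeW mu f_fE)
  ig (aeW mu (fun x n Dx => fg n x Dx)).
split=> //; apply: fine_cvg => /=.
rewrite fineK; last exact: integrable_fin_num.
exact: h.
Qed.

End ae_integral.

(** * Square-integrable functions *)

Lemma quad_ge0_le (R : realFieldType) (a b c : R) : 0 <= c ->
  (forall t, 0 <= a + 2 * t * b + t ^+ 2 * c) -> b ^+ 2 <= a * c.
Proof.
rewrite le_eqVlt => /predU1P[<-|c0] h; last first.
  have := h (- b / c).
  rewrite (_ : a + _ + _ = (a * c - b ^+ 2) / c); last by field; lra.
  by rewrite pmulr_lge0 ?invr_gt0// subr_ge0.
have [->|b0] := eqVneq b 0; first by rewrite expr0n/= mulr0.
(* An affine function of slope 2b != 0 takes the value -1. *)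
have := h (- (a + 1) / (2 * b)).
rewrite (_ : a + _ + _ = -1); first by lra.
by field.
Qed.

Section L2_generic.
Context d (X : measurableType d) (R : realType) (mu : {measure set X -> \bar R}).
Context (D : set X) (mD : measurable D).
Implicit Types f g h : X -> R.

Definition L2in : set (X -> R) :=
  [set f : X -> R | measurable_fun D f /\ (\int[mu]_(x in D) (f x ^+ 2)%:E < +oo)%E].
Definition L2in_dot f g := \int[mu]_(x in D) (f x * g x).
Definition L2in_norm f := Num.sqrt (fine (\int[mu]_(x in D) (f x ^+ 2)%:E)).

Lemma L2in_sq_int f : L2in f -> mu.-integrable D (EFin \o (fun x => f x ^+ 2)).
Proof.
move=> [mf foo]; apply/integrableP; split.
  by apply/measurable_EFinP; exact: measurable_funX.
apply: le_lt_trans foo; rewrite le_eqVlt; apply/orP; left; apply/eqP.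
by apply: eq_integral => x _; rewrite gee0_abs// lee_fin sqr_ge0.
Qed.

Lemma L2in_prod_int f g : L2in f -> L2in g ->
  mu.-integrable D (EFin \o (fun x => f x * g x)).
Proof.
move=> Lf Lg; apply: (@le_integrable _ _ _ _ _ _ _
  ((EFin \o (fun x => f x ^+ 2)%R) \+ (EFin \o (fun x => g x ^+ 2)%R))%E) => //.
- apply/measurable_EFinP; apply: measurable_funM; [exact: Lf.1|exact: Lg.1].
- move=> x Dx /=; rewrite lee_fin [leRHS]ger0_norm ?addr_ge0 ?sqr_ge0//.
  rewrite normrM; have := normr_ge0 (f x); have := normr_ge0 (g x).
  rewrite -(real_normK (num_real (f x))) -(real_normK (num_real (g x))); nra.
- by apply: integrableD => //; exact: L2in_sq_int.
Qed.

Lemma L2in_lin c f g : L2in f -> L2in g -> L2in (fun x => c * f x + g x).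
Proof.
move=> Lf Lg.
have mh : measurable_fun D (fun x => c * f x + g x).
  apply: measurable_funD Lg.1; apply: measurable_funM Lf.1; exact: measurable_cst.
split=> //.
have : mu.-integrable D (EFin \o (fun x => (c * f x + g x) ^+ 2)).
  rewrite (_ : EFin \o _ = ((fun x => (c ^+ 2)%:E * (EFin \o (fun x => f x ^+ 2)%R) x) \+
     ((fun x => (2 * c)%:E * (EFin \o (fun x => f x * g x)%R) x) \+
      (EFin \o (fun x => g x ^+ 2)%R)))%E); last first.
    by apply/funext => x /=; rewrite -!EFinM -!EFinD; congr EFin; ring.
  apply: integrableD => //; first by apply: integrableZl => //; exact: L2in_sq_int.
  apply: integrableD => //; last exact: L2in_sq_int.
  by apply: integrableZl => //; exact: L2in_prod_int.
move=> /integrableP[_]; apply: le_lt_trans.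
rewrite le_eqVlt; apply/orP; left; apply/eqP.
by apply: eq_integral => x _ /=; rewrite ger0_norm// sqr_ge0.
Qed.

Lemma L2in0 : L2in (fun=> 0).
Proof.
split; first exact: measurable_cst.
by rewrite integral0_eq// => x _; rewrite expr0n.
Qed.

Lemma L2in_dotC f g : L2in_dot f g = L2in_dot g f.
Proof. by apply: eq_Rintegral => x _; rewrite mulrC. Qed.

Lemma L2in_dot_linl c f g h : L2in f -> L2in g -> L2in h ->
  L2in_dot (fun x => c * f x + g x) h = c * L2in_dot f h + L2in_dot g h.
Proof.
move=> Lf Lg Lh; rewrite /L2in_dot -Rintegral_lin//.
- by apply: eq_Rintegral => x _; ring.
- by apply: aeintW; exact: L2in_prod_int.
- by apply: aeintW; exact: L2in_prod_int.
Qed.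

Lemma L2in_dot_linr c f g h : L2in f -> L2in g -> L2in h ->
  L2in_dot h (fun x => c * f x + g x) = c * L2in_dot h f + L2in_dot h g.
Proof.
by move=> *; rewrite L2in_dotC L2in_dot_linl// ![L2in_dot _ h]L2in_dotC.
Qed.

Lemma L2in_dot_ge0 f : 0 <= L2in_dot f f.
Proof. by apply: Rintegral_ge0 => x _; rewrite -expr2 sqr_ge0. Qed.

Lemma L2in_dotE f : fine (\int[mu]_(x in D) (f x ^+ 2)%:E) = L2in_dot f f.
Proof. by rewrite /L2in_dot /Rintegral; congr fine; apply: eq_integral. Qed.

Lemma L2in_norm_ge0 f : 0 <= L2in_norm f.
Proof. exact: sqrtr_ge0. Qed.

Lemma L2in_normK f : L2in_norm f ^+ 2 = L2in_dot f f.
Proof. by rewrite /L2in_norm L2in_dotE sqr_sqrtr// L2in_dot_ge0. Qed.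

Lemma L2in_CS f g : L2in f -> L2in g ->
  `|L2in_dot f g| <= L2in_norm f * L2in_norm g.
Proof.
move=> Lf Lg; rewrite -(@ler_pXn2r _ 2)// ?nnegrE ?mulr_ge0 ?L2in_norm_ge0//.
rewrite real_normK ?num_real// exprMn !L2in_normK.
apply: quad_ge0_le => [|t]; first exact: L2in_dot_ge0.
have := L2in_dot_ge0 (fun x => t * g x + f x).
rewrite L2in_dot_linl//; last exact: L2in_lin.
rewrite !L2in_dot_linr// (L2in_dotC g f); lra.
Qed.

Lemma L2in_normZ c f : L2in f -> L2in_norm (fun x => c * f x) = `|c| * L2in_norm f.
Proof.
move=> Lf; apply/eqP; rewrite -(@eqrXn2 _ 2)// ?mulr_ge0 ?L2in_norm_ge0//.
rewrite exprMn !L2in_normK real_normK ?num_real//; apply/eqP.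
rewrite /L2in_dot -RintegralZl//; first by apply: eq_Rintegral => x _; ring.
exact: L2in_prod_int.
Qed.

Lemma L2in_normD f g : L2in f -> L2in g ->
  L2in_norm (fun x => f x + g x) <= L2in_norm f + L2in_norm g.
Proof.
move=> Lf Lg; rewrite -(@ler_pXn2r _ 2)// ?nnegrE ?addr_ge0 ?L2in_norm_ge0//.
have -> : (fun x => f x + g x) = (fun x => 1 * f x + g x).
  by apply/funext => x; rewrite mul1r.
rewrite L2in_normK L2in_dot_linl//; last exact: L2in_lin.
rewrite !L2in_dot_linr// (L2in_dotC g f) sqrrD !L2in_normK.
have := L2in_CS Lf Lg; have := ler_norm (L2in_dot f g); lra.
Qed.

Lemma L2in_le f g : measurable_fun D f ->
  L2in g -> (forall t, D t -> `|f t| <= `|g t|) -> L2in f.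
Proof.
move=> mf [mg goo] fg; split => //; apply: le_lt_trans goo.
apply: ge0_le_integral => //.
- by move=> t _; rewrite lee_fin sqr_ge0.
- by apply/measurable_EFinP; exact: measurable_funX.
- by apply/measurable_EFinP; exact: measurable_funX.
- move=> t Dt; rewrite lee_fin -(real_normK (num_real (f t))) -(real_normK (num_real (g t))).
  by rewrite ler_pXn2r ?nnegrE//; exact: fg.
Qed.

Lemma L2in_norm_le f g :
  L2in f -> L2in g -> (forall t, D t -> `|f t| <= `|g t|) ->
  L2in_norm f <= L2in_norm g.
Proof.
move=> Lf Lg fg.
rewrite -(@ler_pXn2r _ 2)// ?nnegrE ?L2in_norm_ge0// !L2in_normK.
apply: le_Rintegral => //; [exact: L2in_prod_int|exact: L2in_prod_int|].
move=> t Dt; rewrite -!expr2 -(real_normK (num_real (f t))) -(real_normK (num_real (g t))).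
by rewrite ler_pXn2r ?nnegrE//; exact: fg.
Qed.

End L2_generic.

Lemma L2in_sub d (X : measurableType d) (R : realType) (mu : {measure set X -> \bar R})
    (D E : set X) (f : X -> R) : measurable D -> measurable E -> E `<=` D ->
  L2in mu D f -> L2in mu E f /\ L2in_norm mu E f <= L2in_norm mu D f.
Proof.
move=> mD mE ED [mf foo].
have le : (\int[mu]_(x in E) (f x ^+ 2)%:E <= \int[mu]_(x in D) (f x ^+ 2)%:E)%E.
  apply: ge0_subset_integral => //.
  - by apply/measurable_EFinP; exact: measurable_funX.
  - by move=> x _; rewrite lee_fin sqr_ge0.
have ge0 (F : set X) : (0 <= \int[mu]_(x in F) (f x ^+ 2)%:E)%E.
  by apply: integral_ge0 => x _; rewrite lee_fin sqr_ge0.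
have Eoo : (\int[mu]_(x in E) (f x ^+ 2)%:E < +oo)%E by exact: le_lt_trans foo.
split; first by split => //; exact: measurable_funS mf.
by rewrite ler_sqrt ?fine_ge0// fine_le// ge0_fin_numE.
Qed.

Lemma le_sum_mem (R : realType) (I : eqType) (s : seq I) (F : I -> R) x :
  (forall y, 0 <= F y) -> x \in s -> F x <= \sum_(y <- s) F y.
Proof.
move=> F0; elim: s => // y s IH; rewrite inE big_cons => /orP[/eqP ->|xs].
  by rewrite lerDl sumr_ge0.
by apply: le_trans (IH xs) _; rewrite lerDr.
Qed.

(** * Seminormed subspaces and their duals *)

Section seminormed.
Context (R : realType).

(** The spaces H, H' and L^2 are subsets of modules of functions, on which the
    norm is only a seminorm, since functions are not identified almost
    everywhere. *)
Record seminormed (V : lmodType R) (X : set V) (N : V -> R) : Prop := Seminormed {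
  sn_mem0 : X 0;
  sn_lin : forall c x y, X x -> X y -> X (c *: x + y);
  sn_normZ : forall c x, X x -> N (c *: x) = `|c| * N x;
  sn_normD : forall x y, X x -> X y -> N (x + y) <= N x + N y }.

Context (V : lmodType R) (X : set V) (N : V -> R) (XN : seminormed X N).

Lemma sn_memD x y : X x -> X y -> X (x + y).
Proof. by move=> Xx Xy; rewrite -[x]scale1r; apply: (sn_lin XN). Qed.

Lemma sn_memZ c x : X x -> X (c *: x).
Proof. by move=> Xx; rewrite -[_ *: _]addr0; apply: (sn_lin XN) => //; exact: (sn_mem0 XN). Qed.

Lemma sn_memB x y : X x -> X y -> X (x - y).
Proof. by move=> Xx Xy; rewrite addrC -scaleN1r; apply: (sn_lin XN). Qed.

Lemma sn_normN x : X x -> N (- x) = N x.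
Proof. by move=> Xx; rewrite -scaleN1r (sn_normZ XN)// normrN1 mul1r. Qed.

Lemma sn_norm0 : N 0 = 0.
Proof. by rewrite -(scale0r 0) (sn_normZ XN) ?normr0 ?mul0r//; exact: (sn_mem0 XN). Qed.

(** [0 = N (x - x) <= 2 N x]. *)
Lemma sn_norm_ge0 x : X x -> 0 <= N x.
Proof.
move=> Xx; have := sn_normD XN Xx (sn_memZ (-1) Xx).
rewrite scaleN1r subrr sn_norm0 sn_normN//; lra.
Qed.

Lemma sn_normB x y : X x -> X y -> N (x - y) <= N x + N y.
Proof. by move=> Xx Xy; rewrite -(sn_normN Xy) (sn_normD XN)// -scaleN1r; exact: sn_memZ. Qed.

Lemma sn_distC x y : X x -> X y -> N (x - y) = N (y - x).
Proof. by move=> Xx Xy; rewrite -sn_normN ?opprB//; exact: sn_memB. Qed.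

Lemma sn_dist_norm x y : X x -> X y -> `|N x - N y| <= N (x - y).
Proof.
move=> Xx Xy; rewrite ler_norml; apply/andP; split.
  have := sn_normD XN (sn_memB Xy Xx) Xx.
  by rewrite subrK sn_distC//; lra.
by have := sn_normD XN (sn_memB Xx Xy) Xy; rewrite subrK; lra.
Qed.

End seminormed.

Section dual_seminormed.
Context (R : realType) (V : lmodType R) (X : set V) (N : V -> R).
Hypothesis XN : seminormed X N.
Implicit Types l : V -> R.

Let has_sup_dual l : dual X N l -> has_sup [set `|l v| | v in [set v | X v /\ N v <= 1]].
Proof.
move=> [_ [C lC]]; split.
  by exists `|l 0|, 0 => //; split; [exact: (sn_mem0 XN)|rewrite (sn_norm0 XN)].
exists `|C| => _ [v [Xv Nv] <-]; apply: le_trans (lC _ Xv) _.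
have := sn_norm_ge0 XN Xv; have := ler_norm C; have := normr_ge0 C; nra.
Qed.

Let dual_le1 l v : dual X N l -> X v -> N v <= 1 -> `|l v| <= dual_norm X N l.
Proof.
by move=> dl Xv Nv; apply: (sup_upper_bound (has_sup_dual dl)); exists v.
Qed.

Lemma dual_norm_le l v : dual X N l -> X v -> `|l v| <= dual_norm X N l * N v.
Proof.
move=> dl Xv; have [Nv0|Nv0] := eqVneq (N v) 0.
  by case: dl => _ [C /(_ v Xv)]; rewrite Nv0 !mulr0.
have Nvp : 0 < N v by rewrite lt_def Nv0 (sn_norm_ge0 XN).
have Xv' : X ((N v)^-1 *: v) by exact: (sn_memZ XN).
rewrite -ler_pdivrMr//.
rewrite (_ : _ / _ = `|l ((N v)^-1 *: v)|).
  apply: dual_le1 => //.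
  by rewrite (sn_normZ XN)// gtr0_norm ?invr_gt0// mulVf.
have := dl.1 (N v)^-1 v 0 Xv (sn_mem0 XN); rewrite addr0 => ->.
have -> : l 0 = 0.
  have := dl.1 1 0 0 (sn_mem0 XN) (sn_mem0 XN).
  by rewrite scaler0 addr0 mul1r => h; apply: (@addrI _ (l 0)); rewrite addr0 -h.
by rewrite addr0 normrM gtr0_norm ?invr_gt0// mulrC.
Qed.

Lemma dual_norm_ub l K : dual X N l ->
  (forall v, X v -> N v <= 1 -> `|l v| <= K) -> dual_norm X N l <= K.
Proof.
move=> dl h; apply: ge_sup; first exact: (has_sup_dual dl).1.
by move=> _ [v [Xv Nv] <-]; exact: h.
Qed.

Lemma dual_norm_ge0 l : dual X N l -> 0 <= dual_norm X N l.
Proof.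
move=> dl; apply: le_trans (normr_ge0 (l 0)) _.
by apply: dual_le1 => //; [exact: (sn_mem0 XN)|rewrite (sn_norm0 XN)].
Qed.

Lemma dual_seminormed : seminormed (dual X N) (dual_norm X N).
Proof.
have linE c (l1 l2 : V -> R) v : (c *: l1 + l2) v = c * l1 v + l2 v by [].
have dlin c (l1 l2 : V -> R) : dual X N l1 -> dual X N l2 -> dual X N (c *: l1 + l2).
  move=> dl1 dl2; split.
    move=> k x y Xx Xy; by rewrite !linE dl1.1// dl2.1//; ring.
  exists (`|c| * dual_norm X N l1 + dual_norm X N l2) => v Xv.
  rewrite linE; apply: le_trans (ler_normD _ _) _; rewrite normrM mulrDl -mulrA.
  by apply: lerD; rewrite ?ler_wpM2l// dual_norm_le.
have d0 : dual X N (0 : V -> R).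
  split; first by move=> *; rewrite /= mulr0 addr0.
  by exists 0 => v _; rewrite /= normr0 mul0r.
have dZ c (l : V -> R) : dual X N l -> dual X N (c *: l).
  by move=> dl; rewrite -[_ *: _]addr0; exact: dlin.
have leZ c (l : V -> R) : dual X N l -> dual_norm X N (c *: l) <= `|c| * dual_norm X N l.
  move=> dl; apply: dual_norm_ub; first exact: dZ.
  by move=> v Xv Nv; rewrite [_ v](_ : _ = c * l v)// normrM ler_wpM2l// dual_le1.
split => //.
- move=> c l dl; apply/eqP; rewrite eq_le leZ//=.
  have [->|c0] := eqVneq c 0; first by rewrite normr0 mul0r dual_norm_ge0//; exact: dZ.
  have := leZ c^-1 (c *: l) (dZ c l dl).
  rewrite scalerA mulVf// scale1r normrV ?unitfE//.
  by rewrite ler_pdivlMl ?normr_gt0.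
- move=> l1 l2 dl1 dl2; apply: dual_norm_ub.
    by rewrite -[l1]scale1r; exact: dlin.
  move=> v Xv Nv; apply: le_trans (ler_normD _ _) _.
  by apply: lerD; exact: dual_le1.
Qed.

End dual_seminormed.

(** * Square-integrable vector-valued functions and bilinear pairings *)

Section bochner_theory.
Context (R : realType).
Notation leb := (@lebesgue_measure R).

(** Strong measurability without the exceptional null set: the approximation
    holds, and the values lie in [X], at every time. Replacing a function by such
    a representative leaves plain pointwise limits of simple functions. *)
Definition simple_limit (V : lmodType R) (X : set V) (N : V -> R) (u : R -> V) :=
  exists u_ : nat -> R -> V, (forall k, simple_in X (u_ k)) /\
    (forall t, X (u t) /\ (N (u_ k t - u t) @[k --> \oo] --> (0 : R))).

Section one_space.
Context (V : lmodType R) (X : set V) (N : V -> R) (XN : seminormed X N) (T : R).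

Lemma simple_limit_cst z : X z -> simple_limit X N (fun=> z).
Proof.
move=> Xz; exists (fun _ _ => z); split => [k|t].
  split => //.
  - by apply: (@sub_finite_set _ _ [set z]) => // _ [? _ <-].
  - move=> y; have [<-|zy] := pselect (z = y).
      by rewrite (_ : _ @^-1` _ = setT)//; apply/seteqP; split.
    by rewrite (_ : _ @^-1` _ = set0)//; apply/seteqP; split.
by split => //; under eq_fun do rewrite subrr (sn_norm0 XN); exact: cvg_cst.
Qed.

Lemma simple_if (A : set R) (u : R -> V) : measurable A -> simple_in X u ->
  simple_in X (fun t => if t \in A then u t else 0).
Proof.
move=> mA [fu mu Xu]; split.
- apply: (@sub_finite_set _ _ (range u `|` [set 0])).
    by move=> _ [t _ <-]; case: ifP => _; [left; exists t|right].
  by rewrite finite_setU; split.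
- move=> z; rewrite (_ : _ @^-1` _ =
    (A `&` u @^-1` [set z]) `|` (if z == 0 then ~` A else set0)).
    apply: measurableU; first exact: measurableI.
    by case: ifP => _ //; exact: measurableC.
  apply/seteqP; split=> t /=.
    case: ifPn => [/set_mem At <-|/negP nA <-]; first by left.
    by right; rewrite eqxx => At; apply: nA; exact: mem_set.
  case=> [[At <-]|]; first by rewrite mem_set.
  case: ifPn => // /eqP -> nA; case: ifPn => // /set_mem //.
- by move=> t; case: ifP => _ //; exact: (sn_mem0 XN).
Qed.

Lemma strongly_measurable_simple_limit u : strongly_measurable X N T u ->
  exists2 u', simple_limit X N u' & \forall t \ae leb, 0 < t < T -> u t = u' t.
Proof.
move=> [u_ su_ [A [mA A0 hA]]].
pose B := (`]0, T[%classic : set R) `&` ~` A.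
have mB : measurable B by apply: measurableI => //; exact: measurableC.
exists (fun t => if t \in B then u t else 0).
  exists (fun k t => if t \in B then u_ k t else 0); split.
    by move=> k; exact: simple_if.
  move=> t; case: ifPn => [/set_mem [/=]|_].
    rewrite in_itv/= => tT nA.
    have : 0 < t < T -> X (u t) /\ (N (u_ k t - u t) @[k --> \oo] --> (0 : R)).
      by apply: contrapT => h; apply: nA; exact: hA.
    exact.
  split; first exact: (sn_mem0 XN).
  under eq_fun do rewrite subr0 (sn_norm0 XN).
  exact: cvg_cst.
exists A; split => // t /= h; apply: contrapT => nA; apply: h => tT.
by rewrite mem_set//; split => //=; rewrite in_itv.
Qed.

Lemma simple_limit_strongly_measurable u u' : simple_limit X N u' ->
  (\forall t \ae leb, 0 < t < T -> u t = u' t) -> strongly_measurable X N T u.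
Proof.
move=> [u_ [su_ uu_]] uu'; exists u_ => //.
by apply: ae_imp uu' => t uu't tT; rewrite uu't//; exact: uu_.
Qed.

Lemma simple_measurable (u : R -> V) (phi : V -> R) : simple_in X u ->
  measurable_fun setT (phi \o u).
Proof.
move=> [fu mu _] _ Y mY; rewrite setTI.
rewrite (_ : _ @^-1` _ = \bigcup_(z in range u `&` phi @^-1` Y) u @^-1` [set z]).
  by apply: fin_bigcup_measurable => //; exact: finite_setIl.
apply/seteqP; split=> [t /= Yt|t [z [_ Yz] /= utz]]; last by rewrite /= utz.
by exists (u t) => //; split => //; exists t.
Qed.

Lemma cvg0_dist (x_ : nat -> R) (x : R) (e_ : nat -> R) :
  (forall k, `|x_ k - x| <= e_ k) -> e_ k @[k --> \oo] --> (0 : R) ->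
  x_ k @[k --> \oo] --> x.
Proof.
move=> xe e0; apply/subr_cvg0/norm_cvg0P.
apply: (@squeeze_cvgr _ _ _ _ (fun=> 0) e_) => //; last exact: cvg_cst.
by apply: nearW => k; rewrite normr_ge0 xe.
Qed.

Lemma simple_limit_norm u : simple_limit X N u ->
  measurable_fun setT (fun t => N (u t)).
Proof.
move=> [u_ [su_ uu_]].
apply: (@measurable_fun_cvg _ _ _ _ (fun k t => N (u_ k t))).
  by move=> k; exact: (simple_measurable N (su_ k)).
move=> t _; apply: cvg0_dist (uu_ t).2 => k.
by apply: (sn_dist_norm XN); [case: (su_ k)|exact: (uu_ t).1].
Qed.

End one_space.
End bochner_theory.

Section pairing.
Context (R : realType).
Notation leb := (@lebesgue_measure R).

Lemma simple2_measurable (V1 V2 : lmodType R) (X1 : set V1) (X2 : set V2)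
    (u : R -> V1) (v : R -> V2) (S : set (V1 * V2)) :
  simple_in X1 u -> simple_in X2 v -> measurable [set t | S (u t, v t)].
Proof.
move=> [fu mu _] [fv mv _].
rewrite (_ : mkset _ = \bigcup_(p in (range u `*` range v) `&` S)
    ((u @^-1` [set p.1]) `&` (v @^-1` [set p.2]))).
  apply: fin_bigcup_measurable; first by apply: finite_setIl; exact: finite_setX.
  by move=> p _; exact: measurableI.
apply/seteqP; split=> [t /= St|t [[x y]/= [[_ _] Sp] [utx vty]]]; last by rewrite /= utx vty.
by exists (u t, v t) => //=; split => //; split; exists t.
Qed.

Lemma simple2_map (V1 V2 V3 : lmodType R) (X1 : set V1) (X2 : set V2) (X3 : set V3)
    (f : V1 -> V2 -> V3) (u : R -> V1) (v : R -> V2) :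
  (forall x y, X1 x -> X2 y -> X3 (f x y)) ->
  simple_in X1 u -> simple_in X2 v -> simple_in X3 (fun t => f (u t) (v t)).
Proof.
move=> fX su sv; split.
- apply: (@sub_finite_set _ _ ((fun p => f p.1 p.2) @` (range u `*` range v))).
    by move=> _ [t _ <-]; exists (u t, v t) => //; split; exists t.
  by apply: finite_image; apply: finite_setX; [case: su|case: sv].
- by move=> z; exact: (simple2_measurable [set p | f p.1 p.2 = z] su sv).
- by move=> t; apply: fX; [case: su|case: sv].
Qed.

Lemma simple2_fun_measurable (V1 V2 : lmodType R) (X1 : set V1) (X2 : set V2)
    (f : V1 -> V2 -> R) (u : R -> V1) (v : R -> V2) :
  simple_in X1 u -> simple_in X2 v -> measurable_fun setT (fun t => f (u t) (v t)).
Proof.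
move=> su sv _ Y mY; rewrite setTI.
exact: (simple2_measurable [set p | Y (f p.1 p.2)] su sv).
Qed.

(** Covers the duality pairing, the L^2 product and the form [a] at once, so that
    measurability, integrability and the Cauchy-Schwarz bound of
    [t |-> beta (u t) (v t)] are proved only once. *)
Record bounded_bilinear (V1 V2 : lmodType R) (X1 : set V1) (N1 : V1 -> R)
    (X2 : set V2) (N2 : V2 -> R) (beta : V1 -> V2 -> R) (C : R) : Prop := {
  bb_linl : forall c x x' y, X1 x -> X1 x' -> X2 y ->
    beta (c *: x + x') y = c * beta x y + beta x' y;
  bb_linr : forall c x y y', X1 x -> X2 y -> X2 y' ->
    beta x (c *: y + y') = c * beta x y + beta x y';
  bb_le : forall x y, X1 x -> X2 y -> `|beta x y| <= C * N1 x * N2 y }.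

Lemma dual_pairing (V : lmodType R) (X : set V) (N : V -> R) :
  seminormed X N ->
  bounded_bilinear (dual X N) (dual_norm X N) X N (fun l v => l v) 1.
Proof.
move=> XN; split => //.
- by move=> c x y y' dx Xy Xy'; rewrite dx.1.
- by move=> l v dl Xv; rewrite mul1r; exact: dual_norm_le.
Qed.

Section one_space.
Context (V : lmodType R) (X : set V) (N : V -> R) (XN : seminormed X N) (T : R).
Let J : set R := `]0, T[%classic.

Definition bnorm (u : R -> V) : R := L2in_norm leb J (fun t => N (u t)).

Lemma L2T_rep u : L2T X N T u -> exists u', [/\ simple_limit X N u',
  (\forall t \ae leb, J t -> u t = u' t) & L2in leb J (fun t => N (u' t))].
Proof.
move=> [/(strongly_measurable_simple_limit XN)[u' lu' uu'] uoo].
exists u'; split => //.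
split; first by apply: measurable_funTS; exact: simple_limit_norm lu'.
move: uoo; rewrite /L2T_sq; apply: le_lt_trans; rewrite le_eqVlt; apply/orP; left; apply/eqP.
by apply: integral_ae; apply: ae_imp uu' => t h /h ->.
Qed.

Lemma rep_L2T u u' : simple_limit X N u' ->
  (\forall t \ae leb, J t -> u t = u' t) -> L2in leb J (fun t => N (u' t)) ->
  L2T X N T u.
Proof.
move=> lu' uu' Lu'; split.
  exact: simple_limit_strongly_measurable lu' _.
rewrite /L2T_sq; case: Lu' => _; apply: le_lt_trans.
rewrite le_eqVlt; apply/orP; left; apply/eqP.
by apply: integral_ae; apply: ae_imp uu' => t h /h ->.
Qed.

Lemma simple_limit_mem u : simple_limit X N u -> forall t, X (u t).
Proof. by move=> [u_ [_ h]] t; case: (h t). Qed.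

Lemma simple_limit_lin c u v : simple_limit X N u -> simple_limit X N v ->
  simple_limit X N (fun t => c *: u t + v t).
Proof.
move=> [u_ [su uu]] [v_ [sv vv]]; exists (fun k t => c *: u_ k t + v_ k t); split.
  move=> k; apply: (@simple2_map _ _ _ X X X (fun x y => c *: x + y)) => //.
  by move=> x y; exact: (sn_lin XN).
move=> t; have [[Xu cu] [Xv cv]] := (uu t, vv t); split; first exact: (sn_lin XN).
apply: (@cvg0_dist _ _ _ (fun k => `|c| * N (u_ k t - u t) + N (v_ k t - v t))).
  move=> k; rewrite subr0.
  have Xuk : X (u_ k t - u t) by apply: (sn_memB XN) => //; case: (su k).
  have Xvk : X (v_ k t - v t) by apply: (sn_memB XN) => //; case: (sv k).
  rewrite opprD addrACA -scalerBr.
  rewrite ger0_norm; last by apply: (sn_norm_ge0 XN); exact: (sn_lin XN).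
  by rewrite -(sn_normZ XN)//; apply: (sn_normD XN) => //; exact: (sn_memZ XN).
have h := cvgD (cvgM (cvg_cst `|c|) cu) cv.
rewrite mulr0 addr0 in h; exact: h.
Qed.

Let mJ : measurable J. Proof. exact: measurable_itv. Qed.

Lemma bnorm_ae u u' : (\forall t \ae leb, J t -> u t = u' t) -> bnorm u = bnorm u'.
Proof.
move=> uu'; rewrite /bnorm /L2in_norm; congr (Num.sqrt (fine _)).
by apply: integral_ae; apply: ae_imp uu' => t h /h ->.
Qed.

Lemma L2T_sqE u : L2T X N T u -> L2T_sq N T u = ((bnorm u) ^+ 2)%:E.
Proof.
move=> [_ uoo]; rewrite /bnorm /L2in_norm sqr_sqrtr; last first.
  by apply: fine_ge0; apply: integral_ge0 => t _; rewrite lee_fin sqr_ge0.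
rewrite fineK// ge0_fin_numE//.
by apply: integral_ge0 => t _; rewrite lee_fin sqr_ge0.
Qed.

(** Linearity and the triangle inequality are inherited from L^2(0,T) applied to
    the scalar functions [t |-> N (u t)], after passing to representatives. *)
Lemma L2T_seminormed : seminormed (L2T X N T) bnorm.
Proof.
have lin0 := simple_limit_cst XN (sn_mem0 XN).
have Lin c (u' v' : R -> V) : simple_limit X N u' -> simple_limit X N v' ->
    L2in leb J (fun t => N (u' t)) -> L2in leb J (fun t => N (v' t)) ->
    L2in leb J (fun t => N (c *: u' t + v' t)).
  move=> lu lv Lu Lv.
  apply: (@L2in_le _ _ _ leb J mJ _ (fun t => `|c| * N (u' t) + N (v' t))) => //.
  - by apply: measurable_funTS; apply: simple_limit_norm XN _ _; exact: simple_limit_lin.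
  - exact: L2in_lin.
  move=> t _; have Xu := simple_limit_mem lu t; have Xv := simple_limit_mem lv t.
  have nu := sn_norm_ge0 XN Xu; have nv := sn_norm_ge0 XN Xv.
  rewrite [X in _ <= X]ger0_norm; last by rewrite addr_ge0// mulr_ge0.
  rewrite ger0_norm; last by apply: (sn_norm_ge0 XN); exact: (sn_lin XN).
  by rewrite -(sn_normZ XN)//; apply: (sn_normD XN) => //; exact: (sn_memZ XN).
split.
- apply: (@rep_L2T _ (fun=> 0)) => //; first by apply: aeW.
  by under eq_fun do rewrite (sn_norm0 XN); exact: L2in0.
- move=> c u v /L2T_rep[u' [lu uu' Lu]] /L2T_rep[v' [lv vv' Lv]].
  apply: (@rep_L2T _ (fun t => c *: u' t + v' t)).
  + exact: simple_limit_lin.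
  + by apply: ae_imp2 uu' vv' => t hu hv Jt; rewrite -hu// -hv.
  + exact: Lin.
- move=> c u /L2T_rep[u' [lu uu' Lu]].
  rewrite (@bnorm_ae (c *: u) (fun t => c *: u' t)); last first.
    by apply: ae_imp uu' => t h Jt; rewrite -h.
  rewrite (bnorm_ae uu') /bnorm -[in RHS](normr_id c) -L2in_normZ//.
  congr L2in_norm; apply/funext => t; rewrite (sn_normZ XN)//.
  exact: simple_limit_mem lu t.
- move=> u v /L2T_rep[u' [lu uu' Lu]] /L2T_rep[v' [lv vv' Lv]].
  rewrite (@bnorm_ae (u + v) (fun t => 1 *: u' t + v' t)); last first.
    by apply: ae_imp2 uu' vv' => t hu hv Jt; rewrite scale1r -hu// -hv.
  rewrite (bnorm_ae uu') (bnorm_ae vv') /bnorm.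
  apply: le_trans (L2in_normD _ Lu Lv) => //.
  apply: L2in_norm_le => //; first exact: Lin.
    have := @L2in_lin _ _ _ leb J mJ 1 _ _ Lu Lv.
    by under eq_fun do rewrite mul1r.
  move=> t _; have Xu := simple_limit_mem lu t; have Xv := simple_limit_mem lv t.
  have nu := sn_norm_ge0 XN Xu; have nv := sn_norm_ge0 XN Xv.
  rewrite scale1r [X in _ <= X]ger0_norm; last by rewrite addr_ge0.
  rewrite ger0_norm; last by apply: (sn_norm_ge0 XN); exact: (sn_memD XN).
  exact: (sn_normD XN).
Qed.

(** Density of simple functions: cutting off the approximants where their norm
    exceeds twice that of [v] gives a dominated sequence that is still
    pointwise convergent. *)
Lemma simple_limit_approx v : simple_limit X N v -> L2in leb J (fun t => N (v t)) ->
  forall e : R, 0 < e -> exists w, [/\ simple_in X w,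
    L2in leb J (fun t => N (v t - w t)) &
    L2in_norm leb J (fun t => N (v t - w t)) < e].
Proof.
move=> lv Lv e e0; have [v_ [sv vv]] := lv.
have XV t : X (v t) by exact: (vv t).1.
have XVk k t : X (v_ k t) by case: (sv k).
pose A k := [set t | N (v_ k t) <= 2 * N (v t)].
pose w k t := if t \in A k then v_ k t else 0.
have mNv : measurable_fun setT (fun t => N (v t)) by exact: simple_limit_norm lv.
have mA k : measurable (A k).
  have mh : measurable_fun setT (fun t => 2 * N (v t) - N (v_ k t)).
    apply: measurable_funB; last exact: (simple_measurable N (sv k)).
    by apply: measurable_funM => //; exact: measurable_cst.
  have := mh measurableT `[0, +oo[%classic (measurable_itv _).
  rewrite setTI; congr measurable; apply/seteqP; split=> t /=;
    by rewrite /A/= in_itv/= andbT subr_ge0.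
have sw k : simple_in X (w k) by exact: (simple_if XN (mA k) (sv k)).
have Xw k t : X (w k t) by case: (sw k).
have wbound k t : N (v t - w k t) <= 3 * N (v t).
  have nv := sn_norm_ge0 XN (XV t).
  rewrite /w; case: ifPn => [/set_mem/= Akt|_]; last by rewrite subr0; lra.
  by apply: le_trans (sn_normB XN (XV t) (XVk k t)) _; move: Akt; rewrite /A/=; lra.
have Ld k : L2in leb J (fun t => N (v t - w k t)).
  apply: (@L2in_le _ _ _ leb J mJ _ (fun t => 3 * N (v t) + 0)) => //.
  - apply: measurable_funTS; apply: (@simple_limit_norm _ _ _ N XN).
    have -> : (fun t => v t - w k t) = (fun t => (-1) *: w k t + v t).
      by apply/funext => t; rewrite scaleN1r addrC.
    apply: simple_limit_lin => //; exists (fun=> w k); split => // t; split => //.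
    by under eq_fun do rewrite subrr (sn_norm0 XN); exact: cvg_cst.
  - by apply: L2in_lin => //; exact: L2in0.
  - move=> t _; rewrite addr0 !ger0_norm ?mulr_ge0//.
    + exact: (sn_norm_ge0 XN (XV t)).
    + by apply: (sn_norm_ge0 XN); exact: (sn_memB XN).
have wv t : N (v t - w k t) @[k --> \oo] --> (0 : R).
  (* If [N (v t) = 0] the cutoff condition may fail for every k, but then
     the bound by [3 * N (v t)] settles the claim. *)
  have [Nv0|Nv0] := eqVneq (N (v t)) 0.
    have : (fun k => N (v t - w k t)) = cst 0.
      apply/funext => k; apply/eqP; rewrite eq_le (sn_norm_ge0 XN)//; last exact: (sn_memB XN).
      by rewrite andbT; apply: le_trans (wbound k t) _; rewrite Nv0 mulr0.
    by move=> ->; exact: cvg_cst.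
  have Nvp : 0 < N (v t) by rewrite lt_def Nv0 (sn_norm_ge0 XN).
  have vvt := (vv t).2.
  apply: cvg_trans vvt; apply: near_eq_cvg.
  near=> k; rewrite (sn_distC XN)//; congr (N (_ - _)).
  rewrite /w mem_set// /A/=.
  have h : N (v_ k t - v t) < N (v t).
    by near: k; exact: (cvgr_lt _ (vv t).2).
  have := sn_normD XN (sn_memB XN (XVk k t) (XV t)) (XV t).
  by rewrite subrK; lra.
have sqw t : N (v t - w k t) ^+ 2 @[k --> \oo] --> (0 : R).
  rewrite -[X in _ --> X](_ : 0 * 0 = 0 :> R); last by rewrite mulr0.
  exact: cvgM.
have [_] : leb.-integrable J (EFin \o cst 0) /\
    (\int[leb]_(t in J) (N (v t - w k t) ^+ 2) @[k --> \oo] -->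
     \int[leb]_(t in J) (cst 0 t : R)).
  apply: (@Rintegral_dominated _ _ _ leb J mJ _ _ (fun t => 9 * N (v t) ^+ 2)).
  - by move=> k; apply: measurable_funX; case: (Ld k).
  - by move=> t _; exact: sqw.
  - apply: (@integrable_EFinZ _ _ _ leb J mJ); exact: (@L2in_sq_int _ _ _ leb J).
  - move=> n x _; rewrite normrX ger0_norm; last by apply: (sn_norm_ge0 XN); exact: (sn_memB XN).
    have nn := sn_norm_ge0 XN (sn_memB XN (XV x) (Xw n x)).
    by have := wbound n x; have := sn_norm_ge0 XN (XV x); nra.
rewrite [X in _ --> X](_ : _ = 0) => [cvg|]; last by rewrite /Rintegral integral0.
have e20 : 0 < e ^+ 2 by rewrite exprn_gt0.
have /= [k _ /(_ k (leqnn k))/= ltk] := cvgr_lt _ cvg _ e20.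
exists (w k); split => //.
rewrite -(@ltr_pXn2r _ 2)// ?nnegrE ?L2in_norm_ge0 ?(ltW e0)// L2in_normK.
by rewrite /L2in_dot; under eq_Rintegral do rewrite -expr2.
Unshelve. all: by end_near. Qed.

End one_space.

Section pairing_integral.
Context (V1 V2 : lmodType R) (X1 : set V1) (N1 : V1 -> R) (X2 : set V2) (N2 : V2 -> R).
Context (XN1 : seminormed X1 N1) (XN2 : seminormed X2 N2).
Context (beta : V1 -> V2 -> R) (C : R) (bC : bounded_bilinear X1 N1 X2 N2 beta C).
Context (T : R).
Let J : set R := `]0, T[%classic.
Let mJ : measurable J. Proof. exact: measurable_itv. Qed.

Lemma bb_Bl x x' y : X1 x -> X1 x' -> X2 y -> beta (x - x') y = beta x y - beta x' y.
Proof.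
move=> Xx Xx' Xy; rewrite addrC -scaleN1r (bb_linl bC)//.
by rewrite mulN1r addrC.
Qed.

Lemma bb_Br x y y' : X1 x -> X2 y -> X2 y' -> beta x (y - y') = beta x y - beta x y'.
Proof.
move=> Xx Xy Xy'; rewrite addrC -scaleN1r (bb_linr bC)//.
by rewrite mulN1r addrC.
Qed.

(** [beta u_k v_k - beta u v = beta (u_k - u) v_k + beta u (v_k - v)], and the
    pairings of simple functions are measurable. *)
Lemma simple_limit_pairing u v : simple_limit X1 N1 u -> simple_limit X2 N2 v ->
  measurable_fun setT (fun t => beta (u t) (v t)).
Proof.
move=> lu lv; have Xu := simple_limit_mem lu; have Xv := simple_limit_mem lv.
have [u_ [su uu]] := lu; have [v_ [sv vv]] := lv.
apply: (@measurable_fun_cvg _ _ _ _ (fun k t => beta (u_ k t) (v_ k t))).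
  by move=> k; exact: (simple2_fun_measurable beta (su k) (sv k)).
move=> t _.
have Xuk k : X1 (u_ k t) by case: (su k).
have Xvk k : X2 (v_ k t) by case: (sv k).
pose e k := `|C| * N1 (u_ k t - u t) * (N2 (v_ k t - v t) + N2 (v t)) +
            `|C| * N1 (u t) * N2 (v_ k t - v t).
have CE x y : X1 x -> X2 y -> `|beta x y| <= `|C| * N1 x * N2 y.
  move=> Xx Xy; apply: le_trans (bb_le bC Xx Xy) _.
  rewrite -!mulrA ler_wpM2r ?ler_norm//.
  by apply: mulr_ge0; [exact: (sn_norm_ge0 XN1)|exact: (sn_norm_ge0 XN2)].
apply: (@cvg0_dist _ _ _ e) => [k|].
  rewrite (_ : _ - _ = beta (u_ k t - u t) (v_ k t) + beta (u t) (v_ k t - v t)).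
    apply: le_trans (ler_normD _ _) _; apply: lerD.
      apply: le_trans (CE _ _ (sn_memB XN1 (Xuk k) (Xu t)) (Xvk k)) _.
      apply: ler_wpM2l.
        by rewrite mulr_ge0//; apply: (sn_norm_ge0 XN1); exact: (sn_memB XN1).
      rewrite -[v_ k t in leLHS](subrK (v t)).
      by apply: (sn_normD XN2) => //; exact: (sn_memB XN2).
    by apply: CE => //; exact: (sn_memB XN2).
  by rewrite bb_Bl// bb_Br//; ring.
rewrite -[X in _ --> X](_ : `|C| * 0 * (0 + N2 (v t)) + `|C| * N1 (u t) * 0 = 0); last by ring.
apply: cvgD; apply: cvgM.
- by apply: cvgM; [exact: cvg_cst|exact: (uu t).2].
- by apply: cvgD; [exact: (vv t).2|exact: cvg_cst].
- exact: cvg_cst.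
- exact: (vv t).2.
Qed.

Lemma pairing_rep_int u v : simple_limit X1 N1 u -> simple_limit X2 N2 v ->
  L2in leb J (fun t => N1 (u t)) -> L2in leb J (fun t => N2 (v t)) ->
  leb.-integrable J (EFin \o (fun t => beta (u t) (v t))).
Proof.
move=> lu lv Lu Lv; have Xu := simple_limit_mem lu; have Xv := simple_limit_mem lv.
apply: (@le_integrable _ _ _ leb J mJ _ (EFin \o (fun t => C * (N1 (u t) * N2 (v t)))%R)).
- apply/measurable_EFinP; apply: measurable_funTS; exact: simple_limit_pairing.
- move=> t _ /=; rewrite lee_fin; apply: le_trans (bb_le bC (Xu t) (Xv t)) _.
  by rewrite -mulrA ler_norm.
- apply: (@integrable_EFinZ _ _ _ leb J mJ); exact: (@L2in_prod_int _ _ _ leb J mJ).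
Qed.

Lemma pairing_aeint u v : L2T X1 N1 T u -> L2T X2 N2 T v ->
  aeint leb J (fun t => beta (u t) (v t)).
Proof.
move=> /(L2T_rep XN1)[u' [lu uu Lu]] /(L2T_rep XN2)[v' [lv vv Lv]].
exists (fun t => beta (u' t) (v' t)); first exact: pairing_rep_int.
by apply: ae_imp2 uu vv => t hu hv Jt; rewrite hu// hv.
Qed.

Lemma pairing_le u v : L2T X1 N1 T u -> L2T X2 N2 T v ->
  `|\int[leb]_(t in J) beta (u t) (v t)| <= `|C| * bnorm N1 T u * bnorm N2 T v.
Proof.
move=> /(L2T_rep XN1)[u' [lu uu Lu]] /(L2T_rep XN2)[v' [lv vv Lv]].
rewrite (bnorm_ae N1 uu) (bnorm_ae N2 vv).
rewrite (@Rintegral_ae _ _ _ leb J _ (fun t => beta (u' t) (v' t))); last first.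
  by apply: ae_imp2 uu vv => t hu hv Jt; rewrite hu// hv.
have Xu := simple_limit_mem lu; have Xv := simple_limit_mem lv.
apply: (@le_trans _ _ (\int[leb]_(t in J) (`|C| * (N1 (u' t) * N2 (v' t))))).
  apply: aeint_normr_le => //.
  - by apply: aeintW; exact: pairing_rep_int.
  - apply: aeintW; apply: (@integrable_EFinZ _ _ _ leb J mJ); exact: (@L2in_prod_int _ _ _ leb J mJ).
  - apply: aeW => t _; apply: le_trans (bb_le bC (Xu t) (Xv t)) _.
    rewrite -!mulrA ler_wpM2r ?ler_norm//.
    by apply: mulr_ge0; [exact: (sn_norm_ge0 XN1)|exact: (sn_norm_ge0 XN2)].
rewrite RintegralZl//; last exact: (@L2in_prod_int _ _ _ leb J mJ).
rewrite -mulrA ler_wpM2l//; apply: le_trans (ler_norm _) _.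
exact: (@L2in_CS _ _ _ leb J mJ).
Qed.

Lemma pairing_Rintegral_linl c u1 u2 v :
  L2T X1 N1 T u1 -> L2T X1 N1 T u2 -> L2T X2 N2 T v ->
  \int[leb]_(t in J) beta ((c *: u1 + u2) t) (v t) =
  c * \int[leb]_(t in J) beta (u1 t) (v t) + \int[leb]_(t in J) beta (u2 t) (v t).
Proof.
move=> L1 L2 Lv.
rewrite -(@Rintegral_lin _ _ _ leb J mJ); [|exact: pairing_aeint|exact: pairing_aeint].
have [u1' [l1 e1 _]] := L2T_rep XN1 L1; have [u2' [l2 e2 _]] := L2T_rep XN1 L2.
have [v' [lv ev _]] := L2T_rep XN2 Lv.
apply: (@Rintegral_ae _ _ _ leb).
have e12 : \forall t \ae leb, J t -> X1 (u1 t) /\ X1 (u2 t).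
  apply: ae_imp2 e1 e2 => t h1 h2 Jt; rewrite h1// h2//.
  by split; [exact: (simple_limit_mem l1)|exact: (simple_limit_mem l2)].
apply: ae_imp2 e12 ev => t h1 h2 Jt; have [Xu1 Xu2] := h1 Jt.
by apply: (bb_linl bC) => //; rewrite h2//; exact: (simple_limit_mem lv).
Qed.

Lemma pairing_Rintegral_linr c u v1 v2 :
  L2T X1 N1 T u -> L2T X2 N2 T v1 -> L2T X2 N2 T v2 ->
  \int[leb]_(t in J) beta (u t) ((c *: v1 + v2) t) =
  c * \int[leb]_(t in J) beta (u t) (v1 t) + \int[leb]_(t in J) beta (u t) (v2 t).
Proof.
move=> Lu L1 L2.
rewrite -(@Rintegral_lin _ _ _ leb J mJ); [|exact: pairing_aeint|exact: pairing_aeint].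
have [v1' [l1 e1 _]] := L2T_rep XN2 L1; have [v2' [l2 e2 _]] := L2T_rep XN2 L2.
have [u' [lu eu _]] := L2T_rep XN1 Lu.
apply: (@Rintegral_ae _ _ _ leb).
have e12 : \forall t \ae leb, J t -> X2 (v1 t) /\ X2 (v2 t).
  apply: ae_imp2 e1 e2 => t h1 h2 Jt; rewrite h1// h2//.
  by split; [exact: (simple_limit_mem l1)|exact: (simple_limit_mem l2)].
apply: ae_imp2 e12 eu => t h1 h2 Jt; have [Xv1 Xv2] := h1 Jt.
by apply: (bb_linr bC) => //; rewrite h2//; exact: (simple_limit_mem lu).
Qed.

End pairing_integral.
End pairing.

(** * A smooth step function *)

Section smooth_step.
Context (R : realType).
Implicit Types (f g : R -> R) (p : {poly R}).

(** Recursion on the derivative, rather than on the order of the iterated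
    derivative, makes the closure properties provable by induction. *)
Fixpoint differentiable_times (k : nat) f : Prop :=
  (forall t, derivable f t 1) /\
  if k is j.+1 then differentiable_times j (derive1 f) else True.

Lemma differentiable_times_smooth f :
  (forall k, differentiable_times k f) -> smooth_time f.
Proof.
move=> sf k; elim: k f sf => [|k IH] f sf t; first by have [] := sf 0%N.
rewrite derive1Sn; apply: IH => j; by have [] := sf j.+1.
Qed.

Lemma differentiable_timesW k f : differentiable_times k.+1 f -> differentiable_times k f.
Proof.
elim: k f => [|k IH] f [df sf]; first by split.
by split => //; exact: IH.
Qed.

Lemma differentiable_times_cst k (c : R) : differentiable_times k (cst c).
Proof.
elim: k c => [|k IH] c; split => //; rewrite (_ : derive1 _ = cst 0)//.
by apply/funext => t; exact: derive1_cst.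
Qed.

Lemma differentiable_timesD k f g : differentiable_times k f ->
  differentiable_times k g -> differentiable_times k (f \+ g).
Proof.
elim: k f g => [|k IH] f g [df sf] [dg sg]; split => //.
- by move=> t; apply: derivableD.
- by move=> t; apply: derivableD.
- rewrite (_ : derive1 _ = (derive1 f) \+ (derive1 g)); first exact: IH.
  by apply/funext => t; rewrite derive1E deriveD// -!derive1E.
Qed.

Lemma differentiable_timesM k f g : differentiable_times k f ->
  differentiable_times k g -> differentiable_times k (f \* g).
Proof.
elim: k f g => [|k IH] f g /[dup] sfk [df sf] /[dup] sgk [dg sg]; split => //.
- by move=> t; apply: derivableM.
- by move=> t; apply: derivableM.
- rewrite (_ : derive1 _ = (f \* (derive1 g)) \+ (g \* (derive1 f))).
    by apply: differentiable_timesD; apply: IH => //; exact: differentiable_timesW.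
  by apply/funext => t; rewrite derive1E deriveM// -!derive1E.
Qed.

Lemma differentiable_timesV k f : (forall t, f t != 0) -> differentiable_times k f ->
  differentiable_times k (fun t => (f t)^-1).
Proof.
move=> f0; elim: k => [|k IH] /[dup] sfk [df sf]; split => //.
- by move=> t; apply: derivableV.
- by move=> t; apply: derivableV.
- rewrite (_ : derive1 _ = (cst (-1) \* (derive1 f)) \* ((fun t => (f t)^-1) \* (fun t => (f t)^-1))).
    have := IH (differentiable_timesW sfk).
    by move=> h; apply: differentiable_timesM; apply: differentiable_timesM => //;
      exact: differentiable_times_cst.
  apply/funext => t; rewrite derive1E deriveV// -!derive1E /GRing.scale/=.
  by rewrite -invfM expr2; ring.
Qed.

Lemma is_derive_affine f (c e t : R) : derivable f (c * t + e) 1 ->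
  is_derive t 1 (fun x => f (c * x + e)) (c * (derive1 f) (c * t + e)).
Proof.
move=> df.
have h : is_derive t 1 (fun x : R => c * x + e) c.
  have := @is_deriveD _ _ _ (fun x : R => c * x) (cst e) t 1 c 0 _ _.
  rewrite addr0; apply.
  have -> : (fun x : R => c * x) = c *: id by [].
  by apply: is_derive_eq; rewrite /GRing.scale/= mulr1.
have df' : is_derive (c * t + e) 1 f ((derive1 f) (c * t + e)).
  by apply: DeriveDef => //; rewrite derive1E.
have := @is_derive1_comp R f (fun x => c * x + e) t _ _ df' h.
by rewrite mulrC.
Qed.

Lemma differentiable_times_affine k f (c e : R) : differentiable_times k f ->
  differentiable_times k (fun t => f (c * t + e)).
Proof.
elim: k f => [|k IH] f [df sf]; split => //.
- by move=> t; have [] := is_derive_affine (df (c * t + e)).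
- by move=> t; have [] := is_derive_affine (df (c * t + e)).
- rewrite (_ : derive1 _ = cst c \* (fun t => (derive1 f) (c * t + e))).
    by apply: differentiable_timesM; [exact: differentiable_times_cst|exact: IH].
  by apply/funext => t; rewrite derive1E; have [_ ->] := is_derive_affine (df (c * t + e)).
Qed.

(** The functions [p(1/x) exp(-1/x)], extended by 0 to [x <= 0], are closed
    under differentiation, whence the smoothness of [exp(-1/x)]. *)
Definition exp_inv p (x : R) : R :=
  if 0 < x then p.[x^-1] * expR (- x^-1) else 0.

(** [(y/n)^n <= exp (y/n) ^ n = exp y], from [1 + x <= exp x]. *)
Lemma exprn_le_expR n (y : R) : 0 <= y -> y ^+ n <= n%:R ^+ n * expR y.
Proof.
case: n => [|n] y0; first by rewrite !expr0 mul1r -{1}expR0 ler_expR.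
have n0 : 0 < n.+1%:R :> R by rewrite ltr0n.
have -> : expR y = expR (y / n.+1%:R) ^+ n.+1.
  by rewrite -expRM_natl; congr expR; field; lra.
rewrite -exprMn ler_pXn2r ?nnegrE ?mulr_ge0 ?expR_ge0 ?ler0n//.
apply: (@le_trans _ _ (n.+1%:R * (1 + y / n.+1%:R))).
  by rewrite mulrDr mulr1 mulrC mulfVK ?lerDr ?ltW// gt_eqF.
by rewrite ler_pM2l// expR_ge1Dx.
Qed.

Lemma horner_le_expR p : exists C : R, forall y, 0 <= y -> `|p.[y]| <= C * expR y.
Proof.
exists (\sum_(i < size p) `|p`_i| * i%:R ^+ i) => y y0.
rewrite horner_coef; apply: le_trans (ler_norm_sum _ _ _) _.
rewrite mulr_suml; apply: ler_sum => i _; rewrite normrM -mulrA ler_wpM2l//.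
by rewrite ger0_norm ?exprn_ge0// exprn_le_expR.
Qed.

(** A quadratic bound at 0 is what makes [exp_inv p] differentiable there with
    derivative 0. *)
Lemma exp_inv_le_sqr p : exists C : R, forall x, `|exp_inv p x| <= C * x ^+ 2.
Proof.
have [C hC] := horner_le_expR (p * 'X^2); exists `|C| => x.
rewrite /exp_inv; case: ifPn => x0; last by rewrite normr0 mulr_ge0 ?sqr_ge0.
have y0 : 0 <= x^-1 by rewrite invr_ge0 ltW.
have := hC _ y0; rewrite hornerM hornerXn normrM (ger0_norm (exprn_ge0 _ y0)).
rewrite -ler_pdivrMr ?expR_gt0// => h.
rewrite normrM expRN [X in _ * X]ger0_norm ?invr_ge0 ?expR_ge0//.
have {}h : `|p.[x^-1]| * x^-1 ^+ 2 / expR x^-1 <= `|C|.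
  by apply: le_trans h _; rewrite ler_norm.
rewrite -ler_pdivrMr ?exprn_gt0//; apply: le_trans h.
by rewrite exprVn mulrAC.
Qed.

(** With [y = 1/x] one has [dy/dx = - y^2], so that the derivative of
    [p(y) exp(-y)] is [y^2 (p(y) - p'(y)) exp(-y)]. *)
Lemma is_derive_exp_inv p (x : R) :
  is_derive x 1 (exp_inv p) (exp_inv ('X^2 * (p - p^`())) x).
Proof.
have [x0|x0|->] := ltgtP x 0.
- have -> : exp_inv ('X^2 * (p - p^`())) x = 0 by rewrite /exp_inv ltNge ltW.
  apply: (@near_eq_is_derive _ _ _ (cst 0)).
  + near=> y; rewrite /exp_inv/=; case: ifPn => // y0.
    have : y < 0 by near: y; exact: lt_nbhsl.
    by rewrite ltNge ltW.
- have xn0 : x != 0 by rewrite gt_eqF.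
  have fE : \near x, (p.[x^-1] * expR (- x^-1)) = exp_inv p x.
    near=> y; rewrite /exp_inv ifT//.
    by near: y; exact: lt_nbhsr.
  apply: (near_eq_is_derive fE).
    have dV : is_derive x 1 (fun y : R => y^-1) (- x ^- 2).
      have := @is_deriveV R id x 1 1 xn0 (is_derive_id x 1).
      by rewrite /GRing.scale/= mulr1.
    have dp : is_derive x 1 (fun y : R => p.[y^-1]) (p^`().[x^-1] * (- x ^- 2)).
      exact: (@is_derive1_comp R (horner p) (fun y => y^-1) _ _ _ (is_derive_poly p _) dV).
    have de : is_derive x 1 (fun y : R => expR (- y^-1)) (expR (- x^-1) * (x ^- 2)).
      have h : is_derive x 1 (fun y : R => - y^-1) (x ^- 2).
        by have := is_deriveN dV; rewrite opprK.
      exact: (@is_derive1_comp R expR (fun y => - y^-1) _ _ _ (is_derive_expR _) h).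
    have -> : exp_inv ('X^2 * (p - p^`())) x =
        p.[x^-1] *: (expR (- x^-1) * x ^- 2) + expR (- x^-1) *: (p^`().[x^-1] * - x ^- 2).
      by rewrite /exp_inv x0 !hornerE /GRing.scale/= exprVn; ring.
    exact: (is_deriveM dp de).
- have -> : exp_inv ('X^2 * (p - p^`())) 0 = 0 by rewrite /exp_inv ltxx.
  have [C hC] := exp_inv_le_sqr p.
  have h : (fun h : R => h^-1 *: ((exp_inv p \o shift 0) (h *: 1) - exp_inv p 0)) @ 0^' --> (0 : R).
    apply/norm_cvg0P.
    apply: (@squeeze_cvgr _ _ _ _ (fun=> 0) (fun h => `|C| * `|h|)).
    + near=> h; rewrite normr_ge0/= /GRing.scale/= mulr1 addr0.
      rewrite {2}/exp_inv ltxx subr0 normrM normfV.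
      have hn0 : h != 0 by near: h; exact: nbhs_dnbhs_neq.
      have hp : 0 < `|h| by rewrite normr_gt0.
      rewrite ler_pdivrMl//; apply: le_trans (hC h) _.
      rewrite -(real_normK (num_real h)).
      by have := ler_norm C; nra.
    + exact: cvg_cst.
    + rewrite -[X in _ --> X](mulr0 `|C|); apply: cvgM; first exact: cvg_cst.
      by apply: cvg_within_filter; apply/(norm_cvg0P id); exact: cvg_id.
  apply: DeriveDef; first by apply/cvg_ex; exists 0.
  exact: cvg_lim h.
Unshelve. all: by end_near. Qed.

Lemma differentiable_times_exp_inv k p : differentiable_times k (exp_inv p).
Proof.
elim: k p => [|k IH] p; split => //.
- by move=> t; have [] := is_derive_exp_inv p t.
- by move=> t; have [] := is_derive_exp_inv p t.
- rewrite (_ : derive1 _ = exp_inv ('X^2 * (p - p^`()))); first exact: IH.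
  by apply/funext => t; rewrite derive1E; have [_ ->] := is_derive_exp_inv p t.
Qed.

(** The denominator is positive because one of [x] and [1 - x] is. The affine
    argument [-1 * x + 1] has the form required by
    [differentiable_times_affine]. *)
Definition smooth_step (x : R) : R :=
  exp_inv 1 x * (exp_inv 1 x + exp_inv 1 (-1 * x + 1))^-1.

Let ei_ge0 x : 0 <= exp_inv 1 x.
Proof. by rewrite /exp_inv; case: ifP => // _; rewrite hornerC mul1r expR_ge0. Qed.

Let ei_gt0 x : 0 < x -> 0 < exp_inv 1 x.
Proof. by move=> x0; rewrite /exp_inv x0 hornerC mul1r expR_gt0. Qed.

Let den_gt0 x : 0 < exp_inv 1 x + exp_inv 1 (-1 * x + 1).
Proof.
have [x0|x0] := ltP 0 x; first by apply: ltr_pwDl => //; exact: ei_gt0.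
by apply: ltr_wpDl => //; apply: ei_gt0; lra.
Qed.

Lemma differentiable_times_smooth_step k : differentiable_times k smooth_step.
Proof.
apply: differentiable_timesM; first exact: differentiable_times_exp_inv.
apply: differentiable_timesV; first by move=> t; rewrite gt_eqF.
apply: differentiable_timesD; first exact: differentiable_times_exp_inv.
by apply: differentiable_times_affine; exact: differentiable_times_exp_inv.
Qed.

Lemma smooth_step_le0 x : x <= 0 -> smooth_step x = 0.
Proof. by move=> x0; rewrite /smooth_step {1}/exp_inv ltNge x0/= mul0r. Qed.

Lemma smooth_step_ge1 x : 1 <= x -> smooth_step x = 1.
Proof.
move=> x1; rewrite /smooth_step (_ : exp_inv 1 (-1 * x + 1) = 0).
  by rewrite addr0 divff// gt_eqF// ei_gt0; lra.
by rewrite /exp_inv ltNge (_ : -1 * x + 1 <= 0)//; lra.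
Qed.

Lemma smooth_step_ge0 x : 0 <= smooth_step x.
Proof. by rewrite mulr_ge0// invr_ge0 ltW. Qed.

Lemma smooth_step_le1 x : smooth_step x <= 1.
Proof. by rewrite /smooth_step ler_pdivrMr// mul1r lerDl. Qed.

End smooth_step.

(** * Weak derivatives on an interval *)

Section du_bois_reymond.
Context (R : realType).
Notation leb := (@lebesgue_measure R).
Implicit Types (n : nat) (c t : R).

(** Rises from 0 at [c] to 1 at [c + 1/(n+1)], so that its derivative is an
    approximate identity at [c]. *)
Definition scaled_step n c t : R := smooth_step (n.+1%:R * t + - (n.+1%:R * c)).

Lemma differentiable_times_scaled_step j n c : differentiable_times j (scaled_step n c).
Proof. by apply: differentiable_times_affine; exact: differentiable_times_smooth_step. Qed.

Lemma derive1_scaled_step n c t : derive1 (scaled_step n c) t =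
  n.+1%:R * derive1 (@smooth_step R) (n.+1%:R * t + - (n.+1%:R * c)).
Proof.
have [h _] := differentiable_times_smooth_step R 0%N.
by rewrite derive1E; have [_ ->] := is_derive_affine (h (n.+1%:R * t + - (n.+1%:R * c))).
Qed.

Lemma scaled_step_le n c t : t <= c -> scaled_step n c t = 0.
Proof.
move=> tc; apply: smooth_step_le0; rewrite -mulrBr.
have n0 : 0 < n.+1%:R :> R by rewrite ltr0n.
by rewrite pmulr_rle0//; lra.
Qed.

Lemma scaled_step_ge n c t : c + n.+1%:R^-1 <= t -> scaled_step n c t = 1.
Proof.
move=> tc; apply: smooth_step_ge1; rewrite -mulrBr.
have n0 : 0 < n.+1%:R :> R by rewrite ltr0n.
rewrite -ler_pdivrMl// mulr1 lerBrDl; exact: tc.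
Qed.

Lemma differentiable_times_continuous f : differentiable_times 0 f -> continuous (f : R -> R).
Proof. by move=> [df _] t; apply/differentiable_continuous/derivable1_diffP. Qed.

Lemma derive1_scaled_step_continuous n c : continuous (derive1 (scaled_step n c)).
Proof.
apply: differentiable_times_continuous.
by have [] := differentiable_times_scaled_step 1 n c.
Qed.

Lemma derive1B (f g : R -> R) t : derivable f t 1 -> derivable g t 1 ->
  derive1 (fun x => f x - g x) t = derive1 f t - derive1 g t.
Proof. by move=> df dg; rewrite !derive1E -deriveB. Qed.

Lemma dist_sub_half (x y p q e : R) : `|x - p| <= e / 2 -> `|y - q| <= e / 2 ->
  `|p - q - (x - y)| <= e.
Proof.
rewrite !ler_norml => /andP[? ?] /andP[? ?]; apply/andP; split; lra.
Qed.

Lemma derive1_near_cst (f : R -> R) (c e : R) : (\forall t \near c, f t = e) -> derive1 f c = 0.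
Proof.
move=> fe; rewrite derive1E (@near_eq_derive _ _ _ f (cst e))//.
  by rewrite -derive1E derive1_cst.
Qed.

Lemma derive1_scaled_step_out n c t :
  (t < c) || (c + n.+1%:R^-1 < t) -> derive1 (scaled_step n c) t = 0.
Proof.
case/orP => tc.
- apply: (@derive1_near_cst _ _ 0); near=> x; apply: scaled_step_le.
  by apply: ltW; near: x; exact: lt_nbhsl.
- apply: (@derive1_near_cst _ _ 1); near=> x; apply: scaled_step_ge.
  by apply: ltW; near: x; exact: lt_nbhsr.
Unshelve. all: by end_near. Qed.

Lemma integral_support (J E : set R) (f : R -> R) : E `<=` J ->
  (forall t, J t -> ~ E t -> f t = 0) -> f \_ J = f \_ E.
Proof.
move=> EJ f0; apply/funext => t; rewrite /patch.
case: ifPn => [/set_mem Jt|/negP nJ].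
  case: ifPn => // /negP nE; apply: f0 => // Et; apply: nE; exact: mem_set.
by case: ifPn => // /set_mem Et; exfalso; apply: nJ; apply: mem_set; exact: EJ.
Qed.

Variable T : R.
Let J : set R := `]0, T[%classic.
Let mJ : measurable J. Proof. exact: measurable_itv. Qed.

Lemma bounded_step_derivative : exists M : R, forall x, `|derive1 (@smooth_step R) x| <= M.
Proof.
have cS : continuous (derive1 (@smooth_step R)).
  by apply: differentiable_times_continuous; have [] := differentiable_times_smooth_step R 1.
have cN : {within `[0, 1], continuous (fun x => `|derive1 (@smooth_step R) x|)}.
  apply: continuous_subspaceT => x; apply: continuous_comp; first exact: cS.
  exact: norm_continuous.
have [x _ hx] := EVT_max ler01 cN.
exists `|derive1 (@smooth_step R) x| => y.
have [y0|y0] := ltP y 0.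
  rewrite (@derive1_near_cst _ _ 0) ?normr0//; near=> z; apply: smooth_step_le0.
  by apply: ltW; near: z; exact: lt_nbhsl.
have [y1|y1] := ltP 1 y.
  rewrite (@derive1_near_cst _ _ 1) ?normr0//; near=> z; apply: smooth_step_ge1.
  by apply: ltW; near: z; exact: lt_nbhsr.
by apply: hx; rewrite in_itv/= y0.
Unshelve. all: by end_near. Qed.

(** The derivative of the step has integral 1 and lives in [[c, c + 1/(n+1)]],
    an interval on which [k] is close to [k c]. *)
Lemma scaled_step_identity (k : R -> R) c : {in `]0, T[, continuous k} -> 0 < c < T ->
  forall e : R, 0 < e -> \forall n \near \oo,
    leb.-integrable J (EFin \o (fun t => derive1 (scaled_step n c) t * k t)) /\
    `|\int[leb]_(t in J) (derive1 (scaled_step n c) t * k t) - k c| <= e.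
Proof.
move=> ck /andP[c0 cT] e e0; have [M hM] := bounded_step_derivative.
have M0 : 0 <= M by apply: le_trans (hM 0); exact: normr_ge0.
have e'0 : 0 < e / (M + 1) by apply: divr_gt0 => //; lra.
have /(cvgrPdist_le _) /(_ _ e'0) [dl /= dl0 kdl] : k x @[x --> c] --> k c.
  by apply: ck; rewrite in_itv/= c0.
have min0 : 0 < Num.min dl (T - c) by rewrite lt_min dl0 subr_gt0.
near=> n.
have n0 : 0 < n.+1%:R :> R by rewrite ltr0n.
have ni0 : 0 < n.+1%:R^-1 :> R by rewrite invr_gt0.
have nmin : n.+1%:R^-1 < Num.min dl (T - c).
  by near: n; exact: near_infty_natSinv_lt (PosNum min0).
move: nmin; rewrite lt_min => /andP[ndl nT].
set d := c + n.+1%:R^-1.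
have cd : c < d by rewrite ltrDl.
have EJ : `[c, d]%classic `<=` J.
  move=> t; rewrite /J/= !in_itv/= => /andP[ct td].
  by rewrite (lt_le_trans c0 ct) (le_lt_trans td)// /d -ltrBrDl.
pose f t := derive1 (scaled_step n c) t * k t.
have f0 t : J t -> ~ `[c, d]%classic t -> f t = 0.
  move=> _; rewrite /= in_itv/= => /negP; rewrite negb_and -!ltNge => h.
  by rewrite /f derive1_scaled_step_out ?mul0r.
have kcE : {within `[c, d], continuous k}.
  apply: continuous_in_subspaceT => t /set_mem /EJ tJ.
  by apply: ck; exact: tJ.
have sE : {within `[c, d], continuous (derive1 (scaled_step n c))}.
  by apply: continuous_subspaceT; exact: derive1_scaled_step_continuous.
have iE (g : R -> R) : {within `[c, d], continuous g} ->
    leb.-integrable `[c, d] (EFin \o g).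
  by move=> cg; apply: continuous_compact_integrable => //; exact: segment_compact.
have fE : {within `[c, d], continuous f}.
  by move=> t; apply: cvgM; [exact: sE|exact: kcE].
have ifE := iE _ fE.
split.
  apply/(@integrable_mkcond _ _ _ leb J _ mJ).
  rewrite restrict_EFin (integral_support EJ f0) -restrict_EFin.
  by apply/(@integrable_mkcond _ _ _ leb `[c, d] _ (measurable_itv _)).
rewrite Rintegral_mkcond (integral_support EJ f0) -Rintegral_mkcond.
have intS : \int[leb]_(t in `[c, d]) (derive1 (scaled_step n c) t) = 1.
  rewrite /Rintegral (@continuous_FTC2 _ _ (scaled_step n c))//.
  - by rewrite /= scaled_step_ge// scaled_step_le// subr0.
  - have [df _] := differentiable_times_scaled_step 0 n c.
    have cs := differentiable_times_continuous (differentiable_times_scaled_step 0 n c).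
    split; first by move=> t _; exact: df.
      by apply: cvg_at_right_filter; exact: cs.
    by apply: cvg_at_left_filter; exact: cs.
have iS := iE _ sE.
have -> : k c = \int[leb]_(t in `[c, d]) (k c * derive1 (scaled_step n c) t).
  by rewrite RintegralZl// intS mulr1.
have iZ : leb.-integrable `[c, d] (EFin \o (fun t => k c * derive1 (scaled_step n c) t)).
  by apply: integrable_EFinZ => //; exact: measurable_itv.
rewrite -RintegralB//.
(* The derivative of the scaled step is at most [(n+1) M]; the length
   [1/(n+1)] of the interval will absorb the first factor. *)
apply: (@le_trans _ _ (\int[leb]_(t in `[c, d]) (n.+1%:R * (M * (e / (M + 1)))))).
  apply: (@aeint_normr_le _ _ _ leb `[c, d]) => //.
  - by apply: aeintB => //; exact: aeintW.
  - by apply: aeintW; apply: iE; move=> t; exact: cvg_cst.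
  - apply: aeW => t /=; rewrite in_itv/= => /andP[ct td].
    rewrite [X in _ - X]mulrC -mulrBr normrM.
    rewrite derive1_scaled_step normrM (ger0_norm (ltW n0)) -mulrA ler_wpM2l ?(ltW n0)//.
    apply: ler_pM => //; rewrite distrC; apply: kdl => /=.
    rewrite ler0_norm; last by rewrite subr_le0.
    by move: td ndl; rewrite /d; move: (n.+1%:R^-1) => r; lra.
rewrite Rintegral_cst; last exact: measurable_itv.
rewrite [X in _ * fine X](lebesgue_measure_itv `[c, d])/= lte_fin cd -EFinB/=.
have -> : d - c = n.+1%:R^-1 by rewrite /d; move: (n.+1%:R^-1) => r; lra.
rewrite mulrAC mulfV ?gt_eqF// mul1r mulrA ler_pdivrMr; last lra.
by rewrite mulrC ler_wpM2l ?(ltW e0)//; lra.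
Unshelve. all: by end_near. Qed.

Lemma scaled_step_cvg a t : scaled_step n a t @[n --> \oo] --> (if a < t then 1 else 0 : R).
Proof.
case: ifPn => at_; last first.
  rewrite (_ : (fun n => _) = cst 0); first exact: cvg_cst.
  by apply/funext => n; rewrite scaled_step_le// leNgt.
have ta : 0 < t - a by rewrite subr_gt0.
apply: cvg_near_cst; near=> n; apply: scaled_step_ge.
rewrite -lerBrDl; apply: ltW.
by near: n; exact: near_infty_natSinv_lt (PosNum ta).
Unshelve. all: by end_near. Qed.

Lemma scaled_step_measurable n a (D : set R) : measurable_fun D (scaled_step n a).
Proof.
apply: measurable_funTS; apply: continuous_measurable_fun.
exact: differentiable_times_continuous (differentiable_times_scaled_step 0 n a).
Qed.

(** The lemma of du Bois-Reymond: test with the difference of two scaled steps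
    at [a] and [b]. As the steps sharpen, its derivative concentrates to
    evaluation at [a] minus evaluation at [b], and the function itself converges
    boundedly to the indicator of the interval between them. *)
Lemma weak_derivative_primitive (k m : R -> R) : {in `]0, T[, continuous k} ->
  aeint leb J m ->
  (forall phi, test_function T phi ->
     \int[leb]_(t in J) (derive1 phi t * k t) = - \int[leb]_(t in J) (phi t * m t)) ->
  forall a b, 0 < a -> a <= b -> b < T ->
  k b - k a = \int[leb]_(t in `]a, b]) m t.
Proof.
move=> ck [m' im mm'] weak a b a0; rewrite le_eqVlt => /predU1P[<- _|ab bT].
  by rewrite subrr set_itv_ge ?bnd_simp// Rintegral_set0.
pose phi n t := scaled_step n a t - scaled_step n b t.
have Tb : 0 < T - b by rewrite subr_gt0.
have phi' n t : derive1 (phi n) t = derive1 (scaled_step n a) t - derive1 (scaled_step n b) t.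
  by apply: derive1B; apply: (differentiable_times_scaled_step 0 n _).1.
have phi_test : \forall n \near \oo, test_function T (phi n).
  near=> n; split.
    apply: differentiable_times_smooth => j.
    rewrite (_ : phi n = scaled_step n a \+ (cst (-1) \* scaled_step n b)); last first.
      by apply/funext => t; rewrite /phi /= mulN1r.
    apply: differentiable_timesD; first exact: differentiable_times_scaled_step.
    apply: differentiable_timesM; first exact: differentiable_times_cst.
    exact: differentiable_times_scaled_step.
  exists a, (b + n.+1%:R^-1); split => //.
    rewrite -ltrBrDl.
    by near: n; exact: near_infty_natSinv_lt (PosNum Tb).
  have ni0 : 0 < n.+1%:R^-1 :> R by rewrite invr_gt0.
  move=> t; apply: contraNT; rewrite negb_and -!ltNge => /orP[ta|tb].
    by rewrite /phi !scaled_step_le ?subrr//; lra.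
  rewrite /phi !scaled_step_ge ?subrr// ltW//; apply: lt_trans tb.
  by rewrite ltrD2r.
have lim1 : \int[leb]_(t in J) (derive1 (phi n) t * k t) @[n --> \oo] --> k a - k b.
  apply/cvgrPdist_le => e e0; have e20 : 0 < e / 2 by lra.
  near=> n.
  have [ia ha] : leb.-integrable J (EFin \o (fun t => derive1 (scaled_step n a) t * k t)) /\
    `|\int[leb]_(t in J) (derive1 (scaled_step n a) t * k t) - k a| <= e / 2.
    by near: n; apply: scaled_step_identity => //; apply/andP; split; lra.
  have [ib hb] : leb.-integrable J (EFin \o (fun t => derive1 (scaled_step n b) t * k t)) /\
    `|\int[leb]_(t in J) (derive1 (scaled_step n b) t * k t) - k b| <= e / 2.
    by near: n; apply: scaled_step_identity => //; apply/andP; split; lra.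
  have -> : \int[leb]_(t in J) (derive1 (phi n) t * k t) =
      \int[leb]_(t in J) (derive1 (scaled_step n a) t * k t -
                         derive1 (scaled_step n b) t * k t).
    by apply: eq_Rintegral => t _; rewrite phi' -mulrBl.
  rewrite (@RintegralB _ _ _ leb J _ _ mJ ia ib).
  exact: (dist_sub_half ha hb).
have phi_cvg t : phi n t @[n --> \oo] --> (if a < t <= b then 1 else 0 : R).
  rewrite (_ : (if _ then _ else _) = (if a < t then 1 else 0) - (if b < t then 1 else 0)).
    by apply: cvgB; exact: scaled_step_cvg.
  case: (ltP a t) => /=; case: (ltP b t) => /=; lra.
have lim2 : \int[leb]_(t in J) (phi n t * m t) @[n --> \oo] --> \int[leb]_(t in `]a, b]) m t.
  have E n : \int[leb]_(t in J) (phi n t * m t) = \int[leb]_(t in J) (phi n t * m' t).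
    by apply: Rintegral_ae; apply: ae_imp mm' => t h /h ->.
  under eq_fun do rewrite E.
  have abJ : `]a, b]%classic `<=` J.
    move=> t; rewrite /J/= !in_itv/= => /andP[ta tb].
    by rewrite (lt_trans a0 ta) (le_lt_trans tb).
  have -> : \int[leb]_(t in `]a, b]) m t =
      \int[leb]_(t in J) ((if a < t <= b then 1 else 0) * m' t).
    rewrite (@Rintegral_ae _ _ _ leb _ m m'); last first.
      by apply: ae_imp mm' => t h /abJ /h.
    rewrite Rintegral_mkcond [RHS]Rintegral_mkcond; congr Rintegral.
    apply/funext => t; rewrite /patch.
    have [tab|tab] := boolP (a < t <= b).
      have tE : `]a, b]%classic t by rewrite /= in_itv.
      by rewrite mul1r (mem_set tE) (mem_set (abJ _ tE)).
    rewrite mul0r if_same; case: ifPn => // /set_mem/=; rewrite in_itv/= => h.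
    by rewrite h in tab.
  have /integrableP[mm'' _] := im.
  have mm1 : measurable_fun J m' by apply/measurable_EFinP.
  have [] := @Rintegral_dominated _ _ _ leb J mJ (fun n t => phi n t * m' t)
    (fun t => (if a < t <= b then 1 else 0) * m' t) (fun t => `|m' t|).
  - move=> n; apply: measurable_funM => //.
    by apply: measurable_funB; exact: scaled_step_measurable.
  - by move=> t _; apply: cvgM; [exact: phi_cvg|exact: cvg_cst].
  - exact: integrable_norm.
  - move=> n t _; rewrite normrM ler_piMl// /phi /scaled_step ler_norml.
    have := smooth_step_ge0 (n.+1%:R * t + - (n.+1%:R * a)).
    have := smooth_step_le1 (n.+1%:R * t + - (n.+1%:R * a)).
    have := smooth_step_ge0 (n.+1%:R * t + - (n.+1%:R * b)).
    have := smooth_step_le1 (n.+1%:R * t + - (n.+1%:R * b)).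
    by move=> *; apply/andP; split; lra.
  - by [].
have lim2' : (- \int[leb]_(t in J) (phi n t * m t)) @[n --> \oo] --> - \int[leb]_(t in `]a, b]) m t.
  exact: cvgN.
have lim1' : (- \int[leb]_(t in J) (phi n t * m t)) @[n --> \oo] --> k a - k b.
  apply: cvg_trans lim1; apply: near_eq_cvg.
  by near=> n; rewrite weak//; near: n.
have := cvg_unique _ lim1' lim2' => h.
have {}h := h (@Rhausdorff R).
by rewrite -[LHS]opprB h opprK.
Unshelve. all: by end_near. Qed.

End du_bois_reymond.

(** * Symmetric difference quotients *)

Section difference_quotients.
Context (R : realType).
Notation leb := (@lebesgue_measure R).
Implicit Types (A f g : R -> R) (a b h t : R).

Lemma continuous_in_within A p q a b : {in `]p, q[, continuous A} -> p < a -> b < q ->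
  {within `[a, b], continuous A}.
Proof.
move=> cA pa bq; apply: continuous_in_subspaceT => t /set_mem/=.
rewrite in_itv/= => /andP[at_ tb]; apply: cA.
by rewrite in_itv/= (lt_le_trans pa at_) (le_lt_trans tb bq).
Qed.

Lemma continuous_itv_integrable A a b : {within `[a, b], continuous A} ->
  leb.-integrable `[a, b] (EFin \o A).
Proof.
by move=> cA; apply: continuous_compact_integrable => //; exact: segment_compact.
Qed.

(** The base point is taken strictly between [p] and [r]: [A] is only controlled
    inside the open interval. *)
Lemma antiderivative A p q r : {in `]p, q[, continuous A} -> p < r ->
  exists P : R -> R, forall x, r <= x -> x < q -> is_derive x 1 P (A x).
Proof.
move=> cA pr; pose r' := (p + r) / 2.
have pr' : p < r' by rewrite /r'; lra.
have rr' : r' < r by rewrite /r'; lra.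
exists (fun x => \int[leb]_(t in `[r', x]) A t) => x rx xq.
pose u := (x + q) / 2.
have xu : x < u by rewrite /u; lra.
have uq : u < q by rewrite /u; lra.
have iA : leb.-integrable `[r', u] (EFin \o A).
  by apply: continuous_itv_integrable; exact: (continuous_in_within cA).
have r'x : r' < x by lra.
have xpq : x \in `]p, q[ by rewrite in_itv/=; apply/andP; split; lra.
have [dP dPE] := continuous_FTC1_closed xu iA r'x (cA x xpq).
by apply: DeriveDef => //; rewrite -derive1E.
Qed.

Lemma is_derive_continuous (P : R -> R) (dP : R) (x : R) : is_derive x 1 P dP ->
  {for x, continuous P}.
Proof. by case=> dPx _; apply/differentiable_continuous/derivable1_diffP. Qed.

(** Both sides are differences of an antiderivative [P] of [A]: the integral
    telescopes to [(P b - P (b - h)) - (P a - P (a - h))], and the mean value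
    theorem applies to each bracket. *)
Lemma shift_mean A p q a b h : {in `]p, q[, continuous A} ->
  p < a - h -> b < q -> 0 < h -> a < b ->
  exists c c', [/\ b - h <= c <= b, a - h <= c' <= a &
    \int[leb]_(t in `[a, b]) (A t - A (t - h)) = h * (A c - A c')].
Proof.
move=> cA pa bq h0 ab; have [P dP] := antiderivative cA pa.
have dQ x : a <= x -> x <= b -> is_derive x 1 (fun t => P t - P (t - h)) (A x - A (x - h)).
  move=> ax xb.
  have d1 : is_derive x 1 P (A x) by apply: dP; lra.
  have d2 : is_derive (x - h) 1 P (A (x - h)) by apply: dP; lra.
  have d3 : is_derive x 1 (fun t : R => t - h) 1.
    have := is_deriveB (is_derive_id x 1) (is_derive_cst h x 1).
    by rewrite subr0.
  have d4 := @is_derive1_comp R P (fun t => t - h) x _ _ d2 d3; rewrite mulr1 in d4.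
  exact: is_deriveB d1 d4.
have cA' : {within `[a, b], continuous (fun t => A t - A (t - h))}.
  apply: continuous_in_subspaceT => t /set_mem/=.
  rewrite in_itv/= => /andP[at_ tb].
  apply: cvgB; first by apply: cA; rewrite in_itv/=; apply/andP; split; lra.
  apply: continuous_comp; last by apply: cA; rewrite in_itv/=; apply/andP; split; lra.
  by apply: cvgB; [exact: cvg_id|exact: cvg_cst].
have mvt x : p < x - h -> a - h <= x - h -> x <= b ->
    exists2 c, x - h <= c <= x & P x - P (x - h) = h * A c.
  move=> px ax xb; have xhx : x - h <= x by lra.
  have [||c cI ->] := @MVT_segment _ P A (x - h) x xhx.
  - by move=> y; rewrite in_itv/= => /andP[? ?]; apply: dP; lra.
  - apply: continuous_in_subspaceT => t /set_mem/=.
    rewrite in_itv/= => /andP[at_ tb]; apply: is_derive_continuous.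
    by apply: dP; lra.
  by exists c; [move: cI; rewrite in_itv/=|ring].
have [c cI hc] : exists2 c, b - h <= c <= b & P b - P (b - h) = h * A c by apply: mvt; lra.
have [c' cI' hc'] : exists2 c, a - h <= c <= a & P a - P (a - h) = h * A c by apply: mvt; lra.
exists c, c'; split => //.
rewrite /Rintegral (@continuous_FTC2 _ _ (fun t => P t - P (t - h)))//.
- by rewrite /= hc hc'; ring.
- split.
  + by move=> x; rewrite in_itv/= => /andP[ax xb]; have [] := dQ x (ltW ax) (ltW xb).
  + apply: cvg_at_right_filter; apply: (is_derive_continuous (dQ a _ _)) => //; exact: ltW.
  + apply: cvg_at_left_filter; apply: (is_derive_continuous (dQ b _ _)) => //; exact: ltW.
- move=> x; rewrite in_itv/= => /andP[ax xb]; rewrite derive1E.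
  by have [_ ->] := dQ x (ltW ax) (ltW xb).
Qed.

Definition primitive f t := \int[leb]_(x in `[0, t]) f x.
Definition sym_quotient (F : R -> R) h t := (F (t + h) - F (t - h)) / (2 * h).

Context (T : R) (T0 : 0 < T).
Notation integrable0T f := (leb.-integrable `[0, T] (EFin \o f)).

Lemma primitiveB f a b : integrable0T f -> 0 <= a -> a <= b -> b <= T ->
  primitive f b - primitive f a = \int[leb]_(x in `]a, b]) f x.
Proof.
move=> fi a0 ab bT; rewrite /primitive Rintegral_itvB//.
apply: integrableS fi => //.
by apply: subset_itvl; rewrite bnd_simp.
Qed.

Lemma primitive_within f : integrable0T f -> {within `[0, T], continuous (primitive f)}.
Proof. by move=> fi; apply: parameterized_integral_continuous => //; exact: ltW. Qed.

Lemma primitive_continuous f : integrable0T f -> {in `]0, T[, continuous (primitive f)}.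
Proof.
move=> fi t tT; have := primitive_within fi.
by move=> /(continuous_within_itvP _ T0)[h _ _]; exact: h.
Qed.

Lemma itv_sub a b (b0 b1 : bool) : 0 <= a -> b <= T ->
  [set` Interval (BSide b0 a) (BSide b1 b)] `<=` `[0, T]%classic.
Proof.
by move=> a0 bT; apply: subset_itv; [case: b0|case: b1]; rewrite bnd_simp.
Qed.

Lemma integrable_sub f a b (b0 b1 : bool) : integrable0T f -> 0 <= a -> b <= T ->
  leb.-integrable [set` Interval (BSide b0 a) (BSide b1 b)] (EFin \o f).
Proof.
move=> fi a0 bT; apply: integrableS fi => //.
exact: itv_sub.
Qed.

Lemma primitive_le f a b : integrable0T f -> (forall t, 0 <= f t) ->
  0 <= a -> a <= b -> b <= T -> primitive f a <= primitive f b.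
Proof.
move=> fi f0 a0 ab bT; rewrite -subr_ge0 primitiveB//; exact: Rintegral_ge0.
Qed.

Lemma sym_quotient_continuous F h a b : {in `]0, T[, continuous F} ->
  0 < a - h -> b + h < T -> 0 < h -> {within `[a, b], continuous (sym_quotient F h)}.
Proof.
move=> cF ah bh h0; apply: continuous_in_subspaceT => t /set_mem/=.
rewrite in_itv/= => /andP[at_ tb].
apply: cvgM; last exact: cvg_cst.
apply: cvgB; apply: continuous_comp.
- by apply: cvgD; [exact: cvg_id|exact: cvg_cst].
- by apply: cF; rewrite in_itv/=; apply/andP; split; lra.
- by apply: cvgB; [exact: cvg_id|exact: cvg_cst].
- by apply: cF; rewrite in_itv/=; apply/andP; split; lra.
Qed.

(** By [shift_mean] with step [2h] the integral is the difference of two values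
    of the monotone function [primitive f]. This makes the quotient a bounded
    operation on L^1, which reduces convergence to a dense class. *)
Lemma sym_quotient_integral_le f h a b : integrable0T f -> (forall t, 0 <= f t) ->
  0 < a - h -> b + h < T -> 0 < h -> a < b ->
  \int[leb]_(t in `[a, b]) sym_quotient (primitive f) h t <= primitive f T.
Proof.
move=> fi f0 ah bh h0 ab.
have cP := primitive_continuous fi.
have [c [c' [cI c'I E]]] : exists c c', [/\ b - 2 * h <= c <= b, a - 2 * h <= c' <= a &
    \int[leb]_(t in `[a, b]) (primitive f (t + h) - primitive f (t - 2 * h + h)) =
    2 * h * (primitive f (c + h) - primitive f (c' + h))].
  apply: (@shift_mean (fun t => primitive f (t + h)) (- h) (T - h)) => //; try lra.
  move=> x; rewrite in_itv/= => /andP[? ?].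
  apply: (@continuous_comp _ _ _ (fun t => t + h) (primitive f)); last first.
    by apply: cP; rewrite in_itv/=; apply/andP; split; lra.
  by apply: cvgD; [exact: cvg_id|exact: cvg_cst].
move: cI c'I => /andP[? ?] /andP[? ?].
have iq : leb.-integrable `[a, b] (EFin \o (fun t => primitive f (t + h) - primitive f (t - h))).
  rewrite (_ : (fun t => _) = (fun t => 2 * h * sym_quotient (primitive f) h t)).
    apply: (@integrable_EFinZ _ _ _ leb); first exact: measurable_itv.
    by apply: continuous_itv_integrable; exact: sym_quotient_continuous.
  by apply/funext => t; rewrite /sym_quotient; field; lra.
rewrite (_ : \int[leb]_(t in _) _ = (2 * h)^-1 *
   \int[leb]_(t in `[a, b]) (primitive f (t + h) - primitive f (t - h))); last first.
  by rewrite -RintegralZl//; apply: eq_Rintegral => t _; rewrite /sym_quotient mulrC.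
rewrite (_ : \int[leb]_(t in _) _ =
  \int[leb]_(t in `[a, b]) (primitive f (t + h) - primitive f (t - 2 * h + h))); last first.
  by apply: eq_Rintegral => t _; congr (_ - primitive f _); ring.
rewrite E mulrA mulVf ?mul1r; last by rewrite gt_eqF//; lra.
have : primitive f (c + h) <= primitive f T by apply: primitive_le => //; lra.
have : 0 <= primitive f (c' + h) by exact: Rintegral_ge0.
lra.
Qed.

Lemma sym_quotientD F G h t :
  sym_quotient (fun x => F x + G x) h t = sym_quotient F h t + sym_quotient G h t.
Proof. by rewrite /sym_quotient -mulrDl; congr (_ / _); ring. Qed.

Lemma primitiveD f g t : integrable0T f -> integrable0T g -> t <= T ->
  primitive (fun x => f x + g x) t = primitive f t + primitive g t.
Proof.
move=> fi gi tT; rewrite /primitive RintegralD//; exact: integrable_sub.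
Qed.

Lemma sym_quotient_norm f h t : integrable0T f -> 0 < t - h -> t + h < T -> 0 < h ->
  `|sym_quotient (primitive f) h t| <= sym_quotient (primitive (fun x => `|f x|)) h t.
Proof.
move=> fi th Th h0; have h20 : 0 < 2 * h by lra.
have nfi : integrable0T (fun x => `|f x|) by exact: integrable_norm.
rewrite /sym_quotient normrM normfV (gtr0_norm h20) ler_pM2r ?invr_gt0//.
rewrite !primitiveB//; try lra.
apply: le_normr_Rintegral; first exact: measurable_itv.
by apply: integrable_sub => //; lra.
Qed.

(** The quotient is a value of [g] near [t], by the mean value theorem, and is
    thus bounded by the maximum of [|g|]. *)
Lemma sym_quotient_cvg_continuous g (a b : R) (h_ : nat -> R) : continuous g ->
  (forall n, 0 < h_ n) -> h_ n @[n --> \oo] --> (0 : R) ->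
  (forall n, 0 < a - h_ n) -> (forall n, b + h_ n < T) -> a < b ->
  \int[leb]_(t in `[a, b]) `|sym_quotient (primitive g) (h_ n) t - g t| @[n --> \oo] --> (0 : R).
Proof.
move=> cg h0 hcvg ah bh ab.
have gi : integrable0T g.
  by apply: continuous_itv_integrable; exact: continuous_subspaceT.
have cP := primitive_continuous gi.
have dP x : 0 < x -> x < T -> is_derive x 1 (primitive g) (g x).
  move=> x0 xT; have [dP dPE] := continuous_FTC1_closed xT gi x0 (cg x).
  by apply: DeriveDef => //; rewrite -derive1E.
have mean n t : a <= t -> t <= b -> exists2 c, t - h_ n <= c <= t + h_ n &
    sym_quotient (primitive g) (h_ n) t = g c.
  move=> at_ tb; have hn := h0 n; have an := ah n; have bn := bh n.
  have tt : t - h_ n <= t + h_ n by lra.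
  have [||c cI E] := @MVT_segment _ (primitive g) g _ _ tt.
  - by move=> y; rewrite in_itv/= => /andP[? ?]; apply: dP; lra.
  - by apply: continuous_in_within cP _ _; lra.
  exists c; first by move: cI; rewrite in_itv.
  rewrite /sym_quotient E (_ : t + h_ n - (t - h_ n) = 2 * h_ n); last by ring.
  by rewrite mulfK// gt_eqF//; lra.
have [x _ hx] : exists2 x, x \in `[0, T]%R & forall t, t \in `[0, T]%R -> `|g t| <= `|g x|.
  apply: (@EVT_max _ (fun x => `|g x|)); first exact: ltW.
  apply: continuous_subspaceT => x; apply: continuous_comp; first exact: cg.
  exact: norm_continuous.
have mI : measurable `[a, b]%classic by exact: measurable_itv.
have [_] : leb.-integrable `[a, b] (EFin \o (cst 0 : R -> R)) /\
   (\int[leb]_(t in `[a, b]) `|sym_quotient (primitive g) (h_ n) t - g t| @[n --> \oo]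
    --> \int[leb]_(t in `[a, b]) (cst 0 : R -> R) t).
  apply: (@Rintegral_dominated _ _ _ leb _ mI _ _ (fun t => 2 * `|g x|)).
  - move=> n; apply: measurableT_comp => //; apply: measurable_funB.
      apply: subspace_continuous_measurable_fun => //.
      exact: sym_quotient_continuous.
    by apply: measurable_funTS; exact: continuous_measurable_fun.
  - move=> t; rewrite /= in_itv/= => /andP[at_ tb].
    apply/norm_cvg0P/subr_cvg0/cvgrPdist_le => /= e e0.
    have /(cvgrPdist_le _) /(_ _ e0) [dl /= dl0 gdl] := cg t.
    have /(cvgr0_norm_lt _) /(_ _ dl0) := hcvg.
    apply: filterS => n; rewrite gtr0_norm// => hn.
    have [c /andP[c1 c2] ->] := mean n t at_ tb.
    by apply: gdl => /=; rewrite ltr_norml; apply/andP; split; lra.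
  - by apply: continuous_itv_integrable; move=> ?; exact: cvg_cst.
  - move=> n t; rewrite /= in_itv/= => /andP[at_ tb]; rewrite normr_id.
    have [c /andP[c1 c2] ->] := mean n t at_ tb.
    have an := ah n; have bn := bh n; have hn := h0 n.
    apply: le_trans (ler_normB _ _) _; rewrite mulr_natl mulr2n.
    by apply: lerD; apply: hx; rewrite in_itv/=; apply/andP; split; lra.
by rewrite [X in _ --> X](_ : _ = 0) // /Rintegral integral0.
Qed.

(** Approximate [f] in L^1 by a continuous [g]: the contribution of [f - g] to
    the quotient is bounded by [sym_quotient_integral_le], that of [g] converges
    by [sym_quotient_cvg_continuous]. *)
Lemma sym_quotient_cvg f (a b : R) (h_ : nat -> R) : integrable0T f ->
  (forall n, 0 < h_ n) -> h_ n @[n --> \oo] --> (0 : R) ->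
  (forall n, 0 < a - h_ n) -> (forall n, b + h_ n < T) -> a < b ->
  \int[leb]_(t in `[a, b]) `|sym_quotient (primitive f) (h_ n) t - f t| @[n --> \oo] --> (0 : R).
Proof.
move=> fi h0 hcvg ah bh ab.
have mI : measurable `[a, b]%classic by exact: measurable_itv.
have a0 : 0 < a by have := ah 0%N; have := h0 0%N; lra.
have bT : b < T by have := bh 0%N; have := h0 0%N; lra.
have iSub (k : R -> R) : integrable0T k -> leb.-integrable `[a, b] (EFin \o k).
  by move=> ki; apply: integrable_sub => //; exact: ltW.
have iq (k : R -> R) n : integrable0T k ->
    leb.-integrable `[a, b] (EFin \o sym_quotient (primitive k) (h_ n)).
  move=> ki; apply: continuous_itv_integrable.
  by apply: sym_quotient_continuous => //; exact: primitive_continuous.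
apply/cvgrPdist_le => /= e e0; have e3 : 0 < e / 3 by lra.
have [g [cg fg]] : exists g : R -> R, continuous g /\
    \int[leb]_(t in `[0, T]) `|f t - g t| < e / 3.
  have m0T : measurable `[0, T]%classic by exact: measurable_itv.
  have [|g_ [cg_ ig_ gf]] := @approximation_continuous_integrable R `[0, T]%classic f m0T _ fi.
    by rewrite [X in (X < _)%E](lebesgue_measure_itv `[0, T])/= lte_fin T0 ltry.
  have /fine_cvgP[_] := gf.
  move=> /cvgr_lt /(_ _ e3) [n _ /(_ n (leqnn n)) /= hn].
  by exists (g_ n); split; [exact: cg_|exact: hn].
have gi : integrable0T g.
  by apply: continuous_itv_integrable; exact: continuous_subspaceT.
have ri : integrable0T (fun t => f t - g t).
  by rewrite (_ : EFin \o _ = (EFin \o f) \- (EFin \o g))%E//; exact: integrableB.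
have nri : integrable0T (fun t => `|f t - g t|) by exact: integrable_norm.
have := sym_quotient_cvg_continuous cg h0 hcvg ah bh ab.
move=> /cvgr_lt /(_ _ e3); apply: filterS => n hn.
rewrite sub0r normrN ger0_norm ?Rintegral_ge0//.
have ah' := ah n; have bh' := bh n; have h0' := h0 n.
apply: (@le_trans _ _ (\int[leb]_(t in `[a, b])
   (sym_quotient (primitive (fun x => `|f x - g x|)) (h_ n) t +
    (`|sym_quotient (primitive g) (h_ n) t - g t| + `|f t - g t|)))).
  have iB (k l : R -> R) : leb.-integrable `[a, b] (EFin \o k) ->
      leb.-integrable `[a, b] (EFin \o l) ->
      leb.-integrable `[a, b] (EFin \o (fun t => k t - l t)).
    move=> ki li.
    by rewrite (_ : EFin \o _ = (EFin \o k) \- (EFin \o l))%E//; exact: integrableB.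
  have iN (k : R -> R) : leb.-integrable `[a, b] (EFin \o k) ->
      leb.-integrable `[a, b] (EFin \o (fun t => `|k t|)).
    by move=> ki; exact: integrable_norm.
  apply: le_Rintegral => //.
  - by apply: iN; apply: iB; [exact: iq|exact: iSub].
  - apply: (@integrableD _ _ _ leb _ mI (EFin \o _) (EFin \o _)); first exact: iq.
    apply: (@integrableD _ _ _ leb _ mI (EFin \o _) (EFin \o _)).
      by apply: iN; apply: iB; [exact: iq|exact: iSub].
    exact: iSub.
  - move=> t; rewrite /= in_itv/= => /andP[at_ tb].
    have E x : x <= T -> primitive f x = primitive (fun y => f y - g y) x + primitive g x.
      move=> xT; rewrite -primitiveD//; apply: eq_Rintegral => y _.
      by rewrite subrK.
    have -> : sym_quotient (primitive f) (h_ n) t =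
      sym_quotient (primitive (fun y => f y - g y)) (h_ n) t + sym_quotient (primitive g) (h_ n) t.
      rewrite -sym_quotientD /sym_quotient !E//; lra.
    have := @sym_quotient_norm (fun y => f y - g y) (h_ n) t ri _ _ _.
    set q := sym_quotient _ _ _; set q' := sym_quotient _ _ _; set q'' := sym_quotient _ _ _.
    have -> : q + q'' - f t = q + (q'' - g t) + (g t - f t) by ring.
    move=> qq'; apply: le_trans (ler_normD _ _) _; rewrite (distrC (g t)) [leRHS]addrA.
    rewrite lerD2r; apply: le_trans (ler_normD _ _) _; rewrite lerD2r.
    by apply: qq'; lra.
have i1 := iq _ n nri.
have i2 : aeint leb `[a, b] (fun t => `|sym_quotient (primitive g) (h_ n) t - g t|).
  apply: (@aeint_norm _ _ _ leb); apply: (@aeintB _ _ _ leb _ mI).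
    by apply: aeintW; exact: iq.
  by apply: aeintW; exact: iSub.
have i3 : aeint leb `[a, b] (fun t => `|f t - g t|) by apply: aeintW; exact: iSub.
rewrite (@aeint_RintegralD _ _ _ leb _ mI)//; [|exact: aeintW|exact: (@aeintD _ _ _ leb _ mI)].
rewrite (@aeint_RintegralD _ _ _ leb _ mI)//.
have l1 : \int[leb]_(t in `[a, b]) sym_quotient (primitive (fun x => `|f x - g x|)) (h_ n) t
    <= \int[leb]_(t in `[0, T]) `|f t - g t|.
  exact: sym_quotient_integral_le.
have l3 : \int[leb]_(t in `[a, b]) `|f t - g t| <= \int[leb]_(t in `[0, T]) `|f t - g t|.
  rewrite /Rintegral fine_le//.
  - by apply: integrable_fin_num => //; exact: iSub.
  - exact: integrable_fin_num.
  - apply: (@ge0_subset_integral _ _ _ leb).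
    + exact: measurable_itv.
    + exact: measurable_itv.
    + by case/integrableP: nri.
    + by move=> t _; rewrite lee_fin.
    + by apply: itv_sub; exact: ltW.
move: fg hn l1 l3; lra.
Qed.

End difference_quotients.

(** * The energy identity *)

Section L2_space.
Context d (Y : measurableType d) (R : realType) (mu : {measure set Y -> \bar R}).
Context (D : set Y) (mD : measurable D).

Lemma L2in_seminormed : seminormed (L2in mu D) (L2in_norm mu D).
Proof.
split.
- exact: L2in0.
- by move=> c x y Lx Ly; exact: (L2in_lin mD c Lx Ly).
- by move=> c x Lx; exact: (L2in_normZ mD c Lx).
- by move=> x y Lx Ly; exact: (L2in_normD mD Lx Ly).
Qed.

Lemma L2in_bilinear : bounded_bilinear (L2in mu D) (L2in_norm mu D)
  (L2in mu D) (L2in_norm mu D) (L2in_dot mu D) 1.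
Proof.
split.
- by move=> c x x' y Lx Lx' Ly; exact: (L2in_dot_linl mD c Lx Lx' Ly).
- by move=> c x y y' Lx Ly Ly'; exact: (L2in_dot_linr mD c Ly Ly' Lx).
- by move=> x y Lx Ly; rewrite mul1r; exact: (L2in_CS mD Lx Ly).
Qed.

Lemma L2in_dot_cvg (I : Type) (F : set_system I) (FF : Filter F)
    (x y : I -> Y -> R) (x0 y0 : Y -> R) :
  (\forall i \near F, L2in mu D (x i)) -> (\forall i \near F, L2in mu D (y i)) ->
  L2in mu D x0 -> L2in mu D y0 ->
  L2in_norm mu D (x i - x0) @[i --> F] --> (0 : R) ->
  L2in_norm mu D (y i - y0) @[i --> F] --> (0 : R) ->
  L2in_dot mu D (x i) (y i) @[i --> F] --> L2in_dot mu D x0 y0.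
Proof.
move=> Lx Ly Lx0 Ly0 cx cy; have S := L2in_seminormed; have B := L2in_bilinear.
apply/subr_cvg0/norm_cvg0P.
pose e i := L2in_norm mu D (x i - x0) * (L2in_norm mu D (y i - y0) + L2in_norm mu D y0) +
  L2in_norm mu D x0 * L2in_norm mu D (y i - y0).
apply: (@squeeze_cvgr _ _ _ _ (fun=> 0) e).
- near=> i; have Lxi : L2in mu D (x i) by near: i.
  have Lyi : L2in mu D (y i) by near: i.
  rewrite normr_ge0/= (_ : _ - _ = L2in_dot mu D (x i - x0) (y i) + L2in_dot mu D x0 (y i - y0)).
    have Lxx := sn_memB S Lxi Lx0; have Lyy := sn_memB S Lyi Ly0.
    apply: le_trans (ler_normD _ _) _; apply: lerD; last exact: (L2in_CS mD Lx0 Lyy).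
    apply: le_trans (L2in_CS mD Lxx Lyi) _; apply: ler_wpM2l; first exact: L2in_norm_ge0.
    by rewrite -[y i in leLHS](subrK y0); exact: (sn_normD S).
  by rewrite (bb_Bl B)// (bb_Br B)//; ring.
- exact: cvg_cst.
- have h := cvgD (cvgM cx (cvgD cy (cvg_cst (L2in_norm mu D y0))))
    (cvgM (cvg_cst (L2in_norm mu D x0)) cy).
  rewrite mul0r mulr0 addr0 in h; exact: h.
Unshelve. all: by end_near. Qed.

End L2_space.

Section lions_magenes.
Context d (Y : measurableType d) (R : realType) (mu : {measure set Y -> \bar R}).
Context (D : set Y) (mD : measurable D).
Notation L := (L2in mu D).
Notation dot := (L2in_dot mu D).
Notation nrm := (L2in_norm mu D).
Notation leb := (@lebesgue_measure R).
Context (H : set (Y -> R)) (N : (Y -> R) -> R) (HN : seminormed H N).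
Hypothesis HL : H `<=` L.
Hypothesis nrm_le : forall z, H z -> nrm z <= N z.
Context (T : R) (T0 : 0 < T).
Let J : set R := `]0, T[%classic.
Let mJ : measurable J. Proof. exact: measurable_itv. Qed.

Context (v : R -> Y -> R) (g : R -> (Y -> R) -> R).
Hypothesis vL : forall t, 0 <= t <= T -> L (v t).
Hypothesis vC : forall t, 0 <= t <= T -> forall eps : R, 0 < eps -> exists2 delta : R,
    0 < delta & forall r, 0 <= r <= T -> `|r - t| < delta -> nrm (v r - v t) < eps.
Hypothesis vH : L2T H N T v.
Hypothesis gD : L2T (dual H N) (dual_norm H N) T g.
Hypothesis vg : forall eta phi, H eta -> test_function T phi ->
  \int[leb]_(t in J) (derive1 phi t * dot (v t) eta) =
  - \int[leb]_(t in J) (phi t * g t eta).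

Let LS := L2in_seminormed mu mD.
Let LB := L2in_bilinear mu mD.
Let HB := dual_pairing HN.
Let HD := dual_seminormed HN.

Let v_cvg (I : Type) (F : set_system I) (FF : Filter F) (r : I -> R) t :
  0 <= t <= T -> (\forall i \near F, 0 <= r i <= T) -> r i @[i --> F] --> t ->
  nrm (v (r i) - v t) @[i --> F] --> (0 : R).
Proof.
move=> tT rT rt; apply/norm_cvg0P/cvgr0Pnorm_lt => /= e e0.
have [dl dl0 hdl] := vC tT e0.
have /cvgrPdist_lt /(_ _ dl0) rdl := rt.
near=> i; rewrite normr_id ger0_norm; last exact: L2in_norm_ge0.
by apply: hdl; [near: i|rewrite distrC; near: i].
Unshelve. all: by end_near. Qed.

Let interior_bounds t : 0 < t < T -> 0 <= t <= T.
Proof. by move=> /andP[/ltW -> /ltW ->]. Qed.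

Let near_shift (s t : R) : 0 < t + s < T -> \forall r \near t, 0 <= r + s <= T.
Proof.
move=> /andP[t0 tT].
have h1 : - s < t by lra.
have h2 : t < T - s by lra.
have := lt_nbhsl h2; have := lt_nbhsr h1; apply: filterS2 => r r1 r2.
by apply/andP; split; lra.
Qed.

Let dot_shift_continuous (s t : R) : 0 < t < T -> 0 < t + s < T ->
  {for t, continuous (fun r => dot (v (r + s)) (v r))}.
Proof.
move=> tT tsT; have nt : \forall r \near t, 0 <= r <= T.
  have := @near_shift 0 t; rewrite addr0 => /(_ tT).
  by apply: filterS => r; rewrite addr0.
have ns := near_shift tsT.
apply: L2in_dot_cvg => //.
- by near=> r; apply: vL; near: r.
- by near=> r; apply: vL; near: r.
- by apply: vL; exact: interior_bounds.
- by apply: vL; exact: interior_bounds.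
- apply: v_cvg => //; first exact: interior_bounds.
  exact: (cvgD (@cvg_id _ (nbhs t)) (cvg_cst s)).
- by apply: v_cvg => //; exact: interior_bounds.
Unshelve. all: by end_near. Qed.

Let dot_continuous z : L z -> {in `]0, T[, continuous (fun t => dot (v t) z)}.
Proof.
move=> Lz t; rewrite in_itv/= => tT.
have nt : \forall r \near t, 0 <= r <= T.
  have := @near_shift 0 t; rewrite addr0 => /(_ tT).
  by apply: filterS => r; rewrite addr0.
apply: L2in_dot_cvg => //.
- by near=> r; apply: vL; near: r.
- by apply: nearW.
- by apply: vL; exact: interior_bounds.
- by apply: v_cvg => //; exact: interior_bounds.
- by under eq_fun do rewrite subrr (sn_norm0 LS); exact: cvg_cst.
Unshelve. all: by end_near. Qed.

Section representatives.
Context (v' : R -> Y -> R) (lv : simple_limit H N v')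
  (vv' : \forall t \ae leb, J t -> v t = v' t) (Lv : L2in leb J (fun t => N (v' t))).
Context (g' : R -> (Y -> R) -> R) (lg : simple_limit (dual H N) (dual_norm H N) g')
  (gg' : \forall t \ae leb, J t -> g t = g' t)
  (Lg : L2in leb J (fun t => dual_norm H N (g' t))).
Let gam t := dual_norm H N (g' t).
Let Hv' t : H (v' t). Proof. exact: (simple_limit_mem lv). Qed.
Let Dg' t : dual H N (g' t). Proof. exact: (simple_limit_mem lg). Qed.
Let gam0 t : 0 <= gam t. Proof. by apply: (sn_norm_ge0 HD). Qed.

Let integrable_restrict0T (f : R -> R) : leb.-integrable J (EFin \o f) ->
  leb.-integrable `[0, T] (EFin \o (f \_ J)).
Proof.
move=> fi; rewrite -restrict_EFin; apply: (@integrableS _ _ _ leb setT) => //.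
exact/(@integrable_mkcond _ _ _ leb J _ mJ).
Qed.

(** Extended by 0 outside of ]0, T[, where nothing is known of [g'], in order
   to be integrable on the closed interval on which primitives are taken. *)
Let gz (z : Y -> R) : R -> R := (fun t => g' t z) \_ J.
Let gamJ : R -> R := gam \_ J.

Let muJ : (leb J < +oo)%E.
Proof. by rewrite [X in (X < _)%E](lebesgue_measure_itv `]0, T[)/= lte_fin T0 -EFinB ltry. Qed.

Let L2_cst (c : R) : L2in leb J (fun=> c).
Proof.
split; first exact: measurable_cst.
by rewrite (@integral_cst _ _ _ leb)// lte_mul_pinfty ?lee_fin ?sqr_ge0.
Qed.

Let gz_J z : H z -> leb.-integrable J (EFin \o (fun t => g' t z)).
Proof.
move=> Hz; apply: (@pairing_rep_int _ _ _ _ _ _ _ HD HN _ _ HB T g' (fun=> z)) => //.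
exact: simple_limit_cst.
Qed.

Let gz_int z : H z -> leb.-integrable `[0, T] (EFin \o gz z).
Proof. by move=> Hz; apply: integrable_restrict0T; exact: gz_J. Qed.

Let gam_J : leb.-integrable J (EFin \o gam).
Proof.
have := @L2in_prod_int _ _ _ leb J mJ _ _ Lg (L2_cst 1).
by under [X in EFin \o X]eq_fun do rewrite mulr1.
Qed.

Let gamJ_int : leb.-integrable `[0, T] (EFin \o gamJ).
Proof. by apply: integrable_restrict0T; exact: gam_J. Qed.

Let gamJ2_int : leb.-integrable `[0, T] (EFin \o (fun t => gamJ t ^+ 2)).
Proof.
have -> : (fun t => gamJ t ^+ 2) = (fun t => gam t ^+ 2) \_ J.
  by apply/funext => t; rewrite /gamJ /patch; case: ifP => // _; rewrite expr0n.
by apply: integrable_restrict0T; exact: (@L2in_sq_int _ _ _ leb J).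
Qed.

Let gamJ0 t : 0 <= gamJ t.
Proof. by rewrite /gamJ /patch; case: ifP. Qed.

Let gz_le z t : H z -> `|gz z t| <= gamJ t * N z.
Proof.
move=> Hz; rewrite /gz /gamJ /patch; case: ifP => _; last by rewrite normr0 mul0r.
exact: (dual_norm_le HN (Dg' t) Hz).
Qed.

(** The definition of the time derivative and the lemma of du Bois-Reymond for
    [t |-> (v(t), z)]. *)
Let weak_primitive z a b : H z -> 0 < a -> a <= b -> b < T ->
  dot (v b) z - dot (v a) z = primitive (gz z) b - primitive (gz z) a.
Proof.
move=> Hz a0 ab bT.
rewrite (@weak_derivative_primitive _ T (fun t => dot (v t) z) (fun t => g t z))//.
- rewrite (@primitiveB _ T)//; [|exact: gz_int|exact: ltW|exact: ltW].
  apply: (@Rintegral_ae _ _ _ leb); apply: ae_imp gg' => t gg /=.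
  rewrite in_itv/= => /andP[at_ tb].
  have Jt : J t by rewrite /J/= in_itv/= (lt_trans a0 at_) (le_lt_trans tb bT).
  by rewrite gg// /gz patchE mem_set.
- by apply: dot_continuous; exact: HL.
- apply: (@aeint_ext _ _ _ leb _ _ (fun t => g' t z)); last first.
    by apply: aeintW; exact: gz_J.
  by apply: ae_imp gg' => t h /h ->.
- by move=> phi tphi; exact: vg.
Qed.

Let quotient_dot h t z : H z -> 0 < t - h -> t + h < T -> 0 < h ->
  (2 * h)^-1 * dot (v (t + h) - v (t - h)) z = sym_quotient (primitive (gz z)) h t.
Proof.
move=> Hz th tT h0; rewrite /sym_quotient -weak_primitive//; last lra.
rewrite (bb_Bl LB); [by rewrite mulrC| | |exact: HL].
- by apply: vL; apply/andP; split; lra.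
- by apply: vL; apply/andP; split; lra.
Qed.

(** The bound that handles the part of [v] left over by a simple approximation:
    the L^2 difference quotient is bounded as a functional on H. *)
Let quotient_le h t z : H z -> 0 < t - h -> t + h < T -> 0 < h ->
  `|sym_quotient (primitive (gz z)) h t| <= sym_quotient (primitive gamJ) h t * N z.
Proof.
move=> Hz th tT h0; apply: le_trans (sym_quotient_norm (gz_int Hz) th tT h0) _.
have h2 : 0 < 2 * h by lra.
have th0 : 0 <= t - h by lra.
have tT' : t + h <= T by lra.
have thh : t - h <= t + h by lra.
have ni : leb.-integrable `[0, T] (EFin \o (fun x => `|gz z x|)).
  by apply: integrable_norm; exact: gz_int.
rewrite /sym_quotient mulrAC ler_pM2r ?invr_gt0//.
rewrite !(@primitiveB _ T)// -RintegralZr//; last exact: (@integrable_sub _ T).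
apply: le_Rintegral => //; first exact: (@integrable_sub _ T).
  have := @integrable_EFinZ _ _ _ leb _ (measurable_itv `]t - h, t + h]) (N z) _
     (integrable_sub false false gamJ_int th0 tT').
  by under [X in EFin \o X]eq_fun do rewrite mulrC.
by move=> x _; exact: gz_le.
Qed.

(** Jensen's inequality, as Cauchy-Schwarz against the constant 1. *)
Let quotient_sq h t : 0 < t - h -> t + h < T -> 0 < h ->
  sym_quotient (primitive gamJ) h t ^+ 2 <=
  sym_quotient (primitive (fun x => gamJ x ^+ 2)) h t.
Proof.
move=> th tT h0.
have h2 : 0 < 2 * h by lra.
have th0 : 0 <= t - h by lra.
have tT' : t + h <= T by lra.
have thh : t - h <= t + h by lra.
rewrite /sym_quotient !(@primitiveB _ T)//.
set I := `]t - h, t + h]%classic.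
have mI : measurable I by exact: measurable_itv.
have muI : leb I = (2 * h)%:E.
  rewrite [LHS](lebesgue_measure_itv `]t - h, t + h])/= lte_fin ifT; last lra.
  by rewrite -EFinB; congr EFin; ring.
have L1 : L2in leb I gamJ.
  split.
    by have /integrableP[/measurable_EFinP] := integrable_sub false false gamJ_int th0 tT'.
  have /integrableP[_] := integrable_sub false false gamJ2_int th0 tT'.
  apply: le_lt_trans; rewrite le_eqVlt; apply/orP; left; apply/eqP.
  by apply: eq_integral => x _ /=; rewrite ger0_norm ?sqr_ge0.
have L2 : L2in leb I (fun=> 1).
  split; first exact: measurable_cst.
  by rewrite (@integral_cst _ _ _ leb)// [X in (_ * X)%E]muI -EFinM ltry.
have := @L2in_CS _ _ _ leb I mI _ _ L1 L2.
rewrite -(@ler_pXn2r _ 2)// ?nnegrE ?mulr_ge0 ?L2in_norm_ge0//.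
rewrite real_normK ?num_real// exprMn !L2in_normK /L2in_dot.
under eq_Rintegral do rewrite mulr1.
under [X in _ <= X * _ -> _]eq_Rintegral do rewrite -expr2.
under [X in _ <= _ * X -> _]eq_Rintegral do rewrite mulr1.
rewrite (@Rintegral_cst _ _ _ leb)// [X in fine X]muI mul1r/= => CS.
rewrite exprMn exprVn ler_pdivrMr ?exprn_gt0//.
apply: le_trans CS _; rewrite le_eqVlt; apply/orP; left; apply/eqP.
by move: h2; move: (2 * h) => k k0; field; rewrite gt_eqF.
Qed.

Section interior.
Context (a b : R) (a0 : 0 < a) (ab : a < b) (bT : b < T).
Let I := `[a, b]%classic.
Let mI : measurable I. Proof. exact: measurable_itv. Qed.
(** Steps for which [t - h] and [t + h] stay inside ]0, T[ for t in [a, b]. *)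
Let h0 := Num.min a (T - b) / 2.
Let h_ n := h0 * n.+1%:R^-1.

Let h0_gt0 : 0 < h0.
Proof. by rewrite divr_gt0// lt_min a0 subr_gt0. Qed.

Let h_gt0 n : 0 < h_ n.
Proof. by rewrite mulr_gt0// invr_gt0. Qed.

Let h_le n : h_ n <= h0.
Proof. by rewrite ler_piMr ?(ltW h0_gt0)// invf_le1// ler1n. Qed.

Let ah n : 0 < a - h_ n.
Proof.
have : h0 <= a / 2 by rewrite /h0 ler_pM2r// ge_min lexx.
move: (h_le n); move: (h_ n) h0 => x y xy ya; move: a0; lra.
Qed.

Let bh n : b + h_ n < T.
Proof.
have : h0 <= (T - b) / 2 by rewrite /h0 ler_pM2r// ge_min lexx orbT.
move: (h_le n); move: (h_ n) h0 => x y xy yb; move: bT; lra.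
Qed.

Let h_cvg : h_ n @[n --> \oo] --> (0 : R).
Proof. by rewrite -[X in _ --> X](mulr0 h0); apply: cvgM; [exact: cvg_cst|exact: cvg_harmonic]. Qed.

Let S_ n := \int[leb]_(t in I) ((2 * h_ n)^-1 * dot (v (t + h_ n) - v (t - h_ n)) (v t)).

(** Symmetry of the product turns the integrand into [A(t) - A(t-h)] with
    [A(t) = (v(t+h), v(t))], so that [shift_mean] leaves half the difference of
    values of [A] near [b] and near [a]. *)
Let S_lim1 : S_ n @[n --> \oo] --> (dot (v b) (v b) - dot (v a) (v a)) / 2.
Proof.
have [a1 b1 c1] : [/\ 0 < a, a < b & b < T] by [].
have bT' : 0 <= b <= T by apply/andP; split; lra.
have aT' : 0 <= a <= T by apply/andP; split; lra.
have cc n : exists cc : R * R, [/\ b - h_ n <= cc.1 <= b, a - h_ n <= cc.2 <= a &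
    S_ n = (dot (v (cc.1 + h_ n)) (v cc.1) - dot (v (cc.2 + h_ n)) (v cc.2)) / 2].
  have hn := h_gt0 n; have an := ah n; have bn := bh n.
  have [c [c' [cI cI' E]]] : exists c c', [/\ b - h_ n <= c <= b, a - h_ n <= c' <= a &
      \int[leb]_(t in `[a, b]) (dot (v (t + h_ n)) (v t) - dot (v (t - h_ n + h_ n)) (v (t - h_ n))) =
      h_ n * (dot (v (c + h_ n)) (v c) - dot (v (c' + h_ n)) (v c'))].
    apply: (@shift_mean _ (fun t => dot (v (t + h_ n)) (v t)) 0 (T - h_ n)) => //; last lra.
    by move=> t; rewrite in_itv/= => /andP[? ?]; apply: dot_shift_continuous; apply/andP; split; lra.
  exists (c, c'); split => //=.
  have -> : S_ n = \int[leb]_(t in `[a, b]) ((2 * h_ n)^-1 *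
     (dot (v (t + h_ n)) (v t) - dot (v (t - h_ n + h_ n)) (v (t - h_ n)))).
    apply: eq_Rintegral => t /set_mem; rewrite /I/= in_itv/= => /andP[? ?].
    rewrite subrK (bb_Bl LB).
    + by rewrite (L2in_dotC _ _ (v t) (v (t - h_ n))).
    + by apply: vL; apply/andP; split; lra.
    + by apply: vL; apply/andP; split; lra.
    + by apply: vL; apply/andP; split; lra.
  rewrite RintegralZl//.
    rewrite E; field; lra.
  apply: continuous_itv_integrable; apply: continuous_in_subspaceT => t /set_mem.
  rewrite /= in_itv/= => /andP[? ?]; apply: cvgB.
    by apply: dot_shift_continuous; apply/andP; split; lra.
  have := @continuous_comp _ _ _ (fun r => r - h_ n) (fun r => dot (v (r + h_ n)) (v r)) t.
  apply; first exact: (cvgB (@cvg_id _ (nbhs t)) (cvg_cst (h_ n))).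
  by apply: dot_shift_continuous; apply/andP; split; lra.
have [cc_ hcc] := choice cc.
have lim (c : R) (c_ : nat -> R) : 0 <= c <= T -> (forall n, c - h_ n <= c_ n <= c) ->
    (forall n, 0 <= c_ n <= T) -> (forall n, 0 <= c_ n + h_ n <= T) ->
    dot (v (c_ n + h_ n)) (v (c_ n)) @[n --> \oo] --> dot (v c) (v c).
  move=> cT cc_n cnT cnhT.
  have c_lim : c_ n @[n --> \oo] --> c.
    apply: (@squeeze_cvgr _ _ _ _ (fun n => c - h_ n) (fun=> c)).
    - by apply: nearW => n; exact: cc_n.
    - have := cvgB (cvg_cst c) h_cvg; rewrite subr0; exact.
    - exact: cvg_cst.
  have ch_lim : c_ n + h_ n @[n --> \oo] --> c.
    have := cvgD c_lim h_cvg; rewrite addr0; exact.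
  apply: L2in_dot_cvg => //.
  - by apply: nearW => n; exact: vL.
  - by apply: nearW => n; exact: vL.
  - exact: vL.
  - exact: vL.
  - by apply: v_cvg => //; apply: nearW.
  - by apply: v_cvg => //; apply: nearW.
have S_E n : S_ n = (dot (v ((cc_ n).1 + h_ n)) (v (cc_ n).1) -
    dot (v ((cc_ n).2 + h_ n)) (v (cc_ n).2)) / 2 by have [] := hcc n.
rewrite (funext S_E).
apply: cvgM; last exact: cvg_cst.
have hb n : [/\ b - h_ n <= (cc_ n).1, (cc_ n).1 <= b, a - h_ n <= (cc_ n).2, (cc_ n).2 <= a &
   [/\ 0 < h_ n, 0 < a - h_ n & b + h_ n < T]].
  have [/andP[? ?] /andP[? ?] _] := hcc n.
  by split.
apply: cvgB; apply: lim => // n; have [? ? ? ? [? ? ?]] := hb n; apply/andP; split; lra.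
Qed.

Let f0 t := g' t (v' t).

Let f0_J : leb.-integrable J (EFin \o f0).
Proof. exact: (pairing_rep_int HD HN HB lg lv Lg Lv). Qed.

Let IJ : I `<=` J.
Proof.
move=> t; rewrite /I/J/= !in_itv/= => /andP[at_ tb].
by rewrite (lt_le_trans a0 at_) (le_lt_trans tb bT).
Qed.

Let in_I t : I t -> a <= t <= b.
Proof. by rewrite /I/= in_itv. Qed.

Let in_range n t : I t -> [/\ 0 < t - h_ n, t + h_ n < T & 0 < h_ n].
Proof.
move=> /in_I/andP[at_ tb]; move: (ah n) (bh n) (h_gt0 n) => ? ? ?.
by split => //; lra.
Qed.

Let quot n t := (2 * h_ n)^-1 * dot (v (t + h_ n) - v (t - h_ n)) (v t).

Let quot_int n : leb.-integrable I (EFin \o quot n).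
Proof.
have ci : leb.-integrable I (EFin \o (fun t => (2 * h_ n)^-1 *
    (dot (v (t + h_ n)) (v t) - dot (v (t + - h_ n)) (v t)))).
  apply: (@integrable_EFinZ _ _ _ leb _ mI).
  apply: continuous_itv_integrable; apply: continuous_in_subspaceT => t /set_mem It.
  have [? ? ?] := in_range n It.
  by apply: cvgB; apply: dot_shift_continuous; apply/andP; split; lra.
apply: (@eq_integrable _ _ _ leb _ mI _ _ _ ci) => t /set_mem It /=.
have [? ? ?] := in_range n It.
by rewrite /quot (bb_Bl LB)//; apply: vL; apply/andP; split; lra.
Qed.

(** The defect of the difference quotient against a fixed [z]; a simple function
   takes finitely many values, so that finitely many [z] matter. *)
Let gap n z t := `|sym_quotient (primitive (gz z)) (h_ n) t - gz z t|.

Let gap_sum (s : seq (Y -> R)) : (forall z, z \in s -> H z) ->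
  (forall n, aeint leb I (fun t => \sum_(z <- s) gap n z t)) /\
  (\int[leb]_(t in I) (\sum_(z <- s) gap n z t) @[n --> \oo] --> (0 : R)).
Proof.
elim: s => [|z s IH] sH.
  split; first by move=> n; under eq_fun do rewrite big_nil; exact: aeint0.
  rewrite (_ : (fun n => _) = cst 0); first exact: cvg_cst.
  apply/funext => n; under eq_Rintegral do rewrite big_nil.
  by rewrite /Rintegral integral0.
have Hz : H z by apply: sH; rewrite inE eqxx.
have [si ls] := IH (fun y ys => sH y (mem_behead (s := z :: s) ys)).
have iz n : aeint leb I (gap n z).
  apply: (@aeint_norm _ _ _ leb); apply: (@aeintB _ _ _ leb _ mI).
    apply: aeintW; apply: continuous_itv_integrable.
    apply: (@sym_quotient_continuous _ T) => //.
    by apply: primitive_continuous => //; exact: gz_int.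
  apply: aeintW; apply: (@integrable_sub _ T); [exact: gz_int|exact: ltW|exact: ltW].
split.
  by move=> n; under eq_fun do rewrite big_cons; exact: (@aeintD _ _ _ leb _ mI).
have -> : (fun n => \int[leb]_(t in I) \sum_(z <- z :: s) gap n z t) =
    (fun n => \int[leb]_(t in I) gap n z t + \int[leb]_(t in I) \sum_(z <- s) gap n z t).
  apply/funext => n; under eq_Rintegral do rewrite big_cons.
  by rewrite (@aeint_RintegralD _ _ _ leb _ mI).
have lz : \int[leb]_(t in I) gap n z t @[n --> \oo] --> (0 : R).
  exact: (@sym_quotient_cvg _ T T0 _ a b h_ (gz_int Hz)).
have := cvgD lz ls; rewrite addr0; exact.
Qed.

Let G := L2in_norm leb J gam.

Let Gam n := sym_quotient (primitive gamJ) (h_ n).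

(** The averages of [gam] stay bounded in L^2 uniformly in the step, by
    [quotient_sq] and [sym_quotient_integral_le] for [gam^2]. *)
Let Gam_L2 n : L2in leb I (Gam n) /\ L2in_norm leb I (Gam n) <= G.
Proof.
have cG : {within I, continuous (Gam n)}.
  by apply: (@sym_quotient_continuous _ T) => //; exact: primitive_continuous.
have mG : measurable_fun I (Gam n).
  have /integrableP[/measurable_EFinP] := continuous_itv_integrable cG; exact.
have cq : {within I, continuous (sym_quotient (primitive (fun x => gamJ x ^+ 2)) (h_ n))}.
  by apply: (@sym_quotient_continuous _ T) => //; exact: primitive_continuous.
have cG2 : {within I, continuous (fun t => Gam n t ^+ 2)}.
  by under eq_fun do rewrite expr2; move=> t; apply: cvgM; exact: cG.
have iG2 := continuous_itv_integrable cG2.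
have LG : L2in leb I (Gam n).
  split => //; have /integrableP[_] := iG2.
  apply: le_lt_trans; rewrite le_eqVlt; apply/orP; left; apply/eqP.
  by apply: eq_integral => x _ /=; rewrite ger0_norm ?sqr_ge0.
split => //.
rewrite -(@ler_pXn2r _ 2)// ?nnegrE ?L2in_norm_ge0// !L2in_normK /L2in_dot.
under eq_Rintegral do rewrite -expr2.
under [leRHS]eq_Rintegral do rewrite -expr2.
apply: (@le_trans _ _ (primitive (fun x => gamJ x ^+ 2) T)).
  apply: le_trans (sym_quotient_integral_le T0 gamJ2_int _ (ah n) (bh n) (h_gt0 n) ab) => //.
    apply: le_Rintegral => //; first exact: continuous_itv_integrable.
    by move=> t It; have [? ? ?] := in_range n It; exact: quotient_sq.
  by move=> t; exact: sqr_ge0.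
rewrite /primitive Rintegral_mkcond [leRHS]Rintegral_mkcond le_eqVlt; apply/orP; left; apply/eqP.
congr Rintegral; apply/funext => t; rewrite /gamJ /patch.
have [Jt|Jt] := boolP (t \in J).
  rewrite mem_set//; move/set_mem: Jt; rewrite /J/= !in_itv/= => /andP[/ltW -> /ltW ->] //.
by rewrite expr0n if_same.
Qed.

(** Split [v = w + (v - w)] with [w] simple and [v - w] small in L^2(0,T;H). On
    the finitely many values of [w] the quotients converge in L^1; on [v - w]
    both the quotient and the limit functional are bounded in L^2 by [G]. *)
Let S_lim2 : S_ n @[n --> \oo] --> \int[leb]_(t in I) f0 t.
Proof.
apply/cvgrPdist_le => e e0.
have G0 : 0 <= G by exact: L2in_norm_ge0.
(* Two remainder terms, each at most [G * dl <= e / 4]. *)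
pose dl := e / (4 * (G + 1)).
have dl0 : 0 < dl by rewrite divr_gt0// mulr_gt0//; lra.
have [w [sw Lr wdl]] := simple_limit_approx HN lv Lv dl0.
have Hw t : H (w t) by case: sw.
have [s ws] : exists s : seq (Y -> R), range w = [set` s].
  by apply/finite_seqP; case: sw.
have sH z : z \in s -> H z.
  by move=> zs; have [t _ <-] : range w z by rewrite ws.
have [si ls] := gap_sum sH.
have e2 : 0 < e / 2 by lra.
move: ls => /cvgr_lt /(_ _ e2); apply: filterS => n hn.
rewrite distrC -(@aeint_RintegralB _ _ _ leb _ mI); last 2 first.
- by apply: aeintW; exact: quot_int.
- by apply: aeintW; exact: (@integrableS _ _ _ leb J I _ mJ mI IJ f0_J).
pose rho t := N (v' t - w t).
have [LrI rI] := @L2in_sub _ _ _ leb J I rho mJ mI IJ Lr.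
have [LgI gI] := @L2in_sub _ _ _ leb J I gam mJ mI IJ Lg.
have [LGI GI] := Gam_L2 n.
have i1 : aeint leb I (fun t => Gam n t * rho t).
  by apply: aeintW; exact: (@L2in_prod_int _ _ _ leb I mI _ _ LGI LrI).
have i2 : aeint leb I (fun t => gam t * rho t).
  by apply: aeintW; exact: (@L2in_prod_int _ _ _ leb I mI _ _ LgI LrI).
have i12 := @aeintD _ _ _ leb I mI _ _ i1 i2.
have i3 := si n.
apply: (@le_trans _ _ (\int[leb]_(t in I) ((Gam n t * rho t + gam t * rho t) +
    \sum_(z <- s) gap n z t))).
  apply: (@aeint_normr_le _ _ _ leb I mI).
  - apply: (@aeintB _ _ _ leb I mI); first by apply: aeintW; exact: quot_int.
    by apply: aeintW; exact: (@integrableS _ _ _ leb J I _ mJ mI IJ f0_J).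
  - exact: (@aeintD _ _ _ leb I mI).
  apply: ae_imp vv' => t vvt It; have [th tT hn0] := in_range n It.
  rewrite vvt; last exact: IJ.
  set z := w t; set y := v' t; set De := v (t + h_ n) - v (t - h_ n).
  have Hz : H z by exact: Hw.
  have Hy : H y by exact: Hv'.
  have Hyz : H (y - z) by exact: (sn_memB HN).
  have LDe : L De.
    by apply: (sn_memB LS); apply: vL; apply/andP; split; lra.
  have E1 : dot De y = dot De (y - z) + dot De z.
    by rewrite (bb_Br LB) ?subrK//; exact: HL.
  have E2 : g' t y = g' t (y - z) + g' t z.
    by rewrite (bb_Br HB (Dg' t) Hy Hz) subrK.
  rewrite E1 /f0 -/y E2 mulrDr !quotient_dot//.
  have gzt : gz z t = g' t z by rewrite /gz patchE mem_set//; exact: IJ.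
  set q1 := sym_quotient _ _ _; set q2 := sym_quotient _ _ _.
  have -> : q1 + q2 - (g' t (y - z) + g' t z) = q1 + - g' t (y - z) + (q2 - gz z t).
    by rewrite gzt; move: (g' t _) (g' t _) q1 q2 => *; ring.
  apply: le_trans (ler_normD _ _) _; apply: lerD.
    apply: le_trans (ler_normD _ _) _; rewrite normrN; apply: lerD.
      exact: quotient_le.
    exact: (dual_norm_le HN (Dg' t) Hyz).
  apply: (@le_sum_mem _ _ s (fun z => gap n z t) z).
    by move=> x; exact: normr_ge0.
  by have : range w z; [exists t|rewrite ws].
rewrite (@aeint_RintegralD _ _ _ leb I mI _ _ i12 i3).
rewrite (@aeint_RintegralD _ _ _ leb I mI _ _ i1 i2).
have b1 : \int[leb]_(t in I) (Gam n t * rho t) <= G * dl.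
  apply: le_trans (ler_norm _) _; apply: le_trans (@L2in_CS _ _ _ leb I mI _ _ LGI LrI) _.
  by apply: ler_pM; rewrite ?L2in_norm_ge0//; apply: le_trans rI (ltW wdl).
have b2 : \int[leb]_(t in I) (gam t * rho t) <= G * dl.
  apply: le_trans (ler_norm _) _; apply: le_trans (@L2in_CS _ _ _ leb I mI _ _ LgI LrI) _.
  by apply: ler_pM; rewrite ?L2in_norm_ge0//; apply: le_trans rI (ltW wdl).
have Gdl : G * dl <= e / 4.
  have -> : e / 4 = (G + 1) * dl by rewrite /dl; field; lra.
  by rewrite ler_pM2r//; lra.
move: b1 b2 hn; move: (Rintegral _ _ _) (Rintegral _ _ _) (Rintegral _ _ _) => x1 x2 x3.
move: Gdl; move: (G * dl) => y; lra.
Qed.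

(** Uniqueness of the limit, [S_lim1] against [S_lim2]. *)
Lemma energy_interior : dot (v b) (v b) - dot (v a) (v a) =
  2 * (primitive (f0 \_ J) b - primitive (f0 \_ J) a).
Proof.
have h := cvg_unique (@Rhausdorff R) S_lim1 S_lim2.
have -> : primitive (f0 \_ J) b - primitive (f0 \_ J) a = \int[leb]_(t in I) f0 t.
  rewrite (@primitiveB _ T); [|exact: integrable_restrict0T|exact: ltW|exact: ltW|exact: ltW].
  have fI : leb.-integrable `[a, b] (EFin \o (f0 \_ J)).
    by apply: (@integrable_sub _ T); [exact: integrable_restrict0T|exact: ltW|exact: ltW].
  rewrite Rintegral_itv_obnd_cbnd; last first.
    apply: integrableS fI => //; apply: subset_itvr; by rewrite bnd_simp.
  apply: eq_Rintegral => t /set_mem It; rewrite patchE mem_set//; exact: IJ.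
by rewrite -h; field.
Qed.

End interior.

Let f0 t := g' t (v' t).

Let f0_J : leb.-integrable J (EFin \o f0).
Proof. exact: (pairing_rep_int HD HN HB lg lv Lg Lv). Qed.

Let F := primitive (f0 \_ J).

Let F_within : {within `[0, T], continuous F}.
Proof. by apply: primitive_within => //; exact: integrable_restrict0T. Qed.

(** Constant on ]0, T[ by [energy_interior], hence on [0, T] by continuity. *)
Let Phi t := dot (v t) (v t) - 2 * F t.

Let Phi_interior a b : 0 < a -> a <= b -> b < T -> Phi a = Phi b.
Proof.
move=> a0; rewrite le_eqVlt => /predU1P[-> //|ab] bT.
have := energy_interior a0 ab bT; rewrite -/f0 -/F /Phi.
move: (dot _ _) (dot _ _) (F a) (F b) => *; lra.
Qed.

Let Phi_cst t : 0 <= t <= T -> Phi t = Phi (T / 2).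
Proof.
move=> tT; have T1 : 0 < T by [].
pose r n := t + (T / 2 - t) * n.+1%:R^-1.
have rT n : 0 < r n < T.
  have n1 : n.+1%:R^-1 <= 1 :> R by rewrite invf_le1// ler1n.
  have n0 : 0 < n.+1%:R^-1 :> R by rewrite invr_gt0.
  rewrite /r; move: tT n1 n0; move: (n.+1%:R^-1) => x /andP[? ?] ? ?.
  by apply/andP; split; nra.
have rT' n : 0 <= r n <= T by exact: interior_bounds.
have rt : r n @[n --> \oo] --> t.
  have := cvgD (cvg_cst t) (cvgM (cvg_cst (T / 2 - t)) (@cvg_harmonic R)).
  by rewrite mulr0 addr0; exact.
have Phi_r n : Phi (r n) = Phi (T / 2).
  have /andP[? ?] := rT n; have T20 : 0 < T / 2 by lra.
  have T2T : T / 2 < T by lra.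
  by have [h|h] := leP (r n) (T / 2); [|apply: esym]; apply: Phi_interior => //; exact: ltW.
have lim : Phi (r n) @[n --> \oo] --> Phi t.
  apply: cvgB.
    apply: L2in_dot_cvg => //.
    - by apply: nearW => n; exact: vL.
    - by apply: nearW => n; exact: vL.
    - exact: vL.
    - exact: vL.
    - by apply: v_cvg => //; apply: nearW.
    - by apply: v_cvg => //; apply: nearW.
  apply: cvgM; first exact: cvg_cst.
  have := F_within; move/subspace_continuousP => /(_ t).
  have tI : `[0, T]%classic t by rewrite /= in_itv.
  move=> /(_ tI) Ft; apply: (cvg_comp r F _ Ft).
  move=> U hU; have h : \forall n \near \oo, `[0, T]%classic (r n) -> U (r n) := rt _ hU.
  suff : \forall n \near \oo, U (r n) by [].
  apply: filterS h => n; apply.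
  by rewrite /= in_itv/=; exact: rT'.
have h : Phi (r n) @[n --> \oo] --> Phi (T / 2).
  by rewrite (funext Phi_r); exact: cvg_cst.
exact: (cvg_unique (@Rhausdorff R) lim h).
Qed.

Let energy s t : 0 <= s <= T -> 0 <= t <= T ->
  dot (v t) (v t) - dot (v s) (v s) = 2 * (F t - F s).
Proof.
move=> sT tT; have := Phi_cst sT; rewrite -(Phi_cst tT) /Phi.
move: (dot _ _) (dot _ _) (F s) (F t) => *; lra.
Qed.

Let G := L2in_norm leb J gam.
Let B := L2in_norm leb J (fun t => N (v' t)).

Let prodJ := (fun t => gam t * N (v' t)) \_ J.

Let prodJ_int : leb.-integrable `[0, T] (EFin \o prodJ).
Proof.
by apply: integrable_restrict0T; exact: (@L2in_prod_int _ _ _ leb J mJ _ _ Lg Lv).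
Qed.

Let Nv'_ge0 t : 0 <= N (v' t). Proof. exact: (sn_norm_ge0 HN). Qed.

Let prodJ_ge0 t : 0 <= prodJ t.
Proof. by rewrite /prodJ /patch; case: ifP => // _; rewrite mulr_ge0. Qed.

Let restrict_0T (f : R -> R) : primitive (f \_ J) T = \int[leb]_(t in J) f t.
Proof.
rewrite /primitive Rintegral_mkcond [RHS]Rintegral_mkcond.
congr Rintegral; apply/funext => t; rewrite /patch.
have [Jt|Jt] := boolP (t \in J); last by rewrite if_same.
rewrite mem_set//; move/set_mem: Jt; rewrite /J/= !in_itv/= => /andP[/ltW -> /ltW ->] //.
Qed.

Let F_le s t : 0 <= s -> s <= t -> t <= T -> `|F t - F s| <= G * B.
Proof.
move=> s0 st tT.
have T0' : 0 <= T by exact: ltW.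
rewrite /F (@primitiveB _ T) ?integrable_restrict0T//.
apply: (@le_trans _ _ (\int[leb]_(x in `]s, t]) prodJ x)).
  have i1 : leb.-integrable `]s, t] (EFin \o (f0 \_ J)).
    by apply: (@integrable_sub _ T) => //; exact: integrable_restrict0T.
  apply: (@aeint_normr_le _ _ _ leb) => //.
  - exact: aeintW.
  - by apply: aeintW; exact: (@integrable_sub _ T).
  - apply: aeW => x _; rewrite /prodJ /patch; case: ifP => _; last by rewrite normr0.
    exact: (dual_norm_le HN (Dg' x) (Hv' x)).
rewrite -(@primitiveB _ T)//.
have := @primitive_le _ T prodJ t T prodJ_int prodJ_ge0 (le_trans s0 st) tT (lexx T).
have : 0 <= primitive prodJ s by exact: Rintegral_ge0.
rewrite (restrict_0T (fun t => gam t * N (v' t))).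
have := @L2in_CS _ _ _ leb J mJ _ _ Lg Lv; rewrite /L2in_dot -/G -/B.
set X := Rintegral _ _ _; have := ler_norm X.
move: X (primitive _ _) (primitive _ _) (G * B) => X x y z; move: `|X| => aX; lra.
Qed.

Let restrict_0 (f : R -> R) : primitive f 0 = 0.
Proof. by rewrite /primitive set_itv1 Rintegral_set1. Qed.

Let energy0T : dot (v T) (v T) - dot (v 0) (v 0) = 2 * \int[leb]_(t in J) g t (v t).
Proof.
rewrite energy ?lexx ?(ltW T0)// /F restrict_0 subr0 restrict_0T; congr (_ * _).
by apply: (@Rintegral_ae _ _ _ leb); apply: ae_imp2 vv' gg' => t h1 h2 Jt; rewrite h1// h2.
Qed.

(** Compare [|v(t)|^2] with [|v(s)|^2] by the energy identity and integrate over
    [s], using that the norm of H dominates that of L^2. *)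
Let trace_le t : 0 <= t <= T -> T * dot (v t) (v t) <= B ^+ 2 + 2 * T * (G * B).
Proof.
move=> tT.
have le s : 0 <= s <= T -> dot (v t) (v t) <= dot (v s) (v s) + 2 * (G * B).
  move=> sT; have E := energy sT tT.
  have : `|F t - F s| <= G * B.
    have [st|/ltW ts] := leP s t.
      by apply: F_le => //; [case/andP: sT|case/andP: tT].
    by rewrite distrC; apply: F_le => //; [case/andP: tT|case/andP: sT].
  move: E; have := ler_norm (F t - F s); move: (F t - F s) `|F t - F s| (dot _ _) (dot _ _) (G * B) => *; lra.
have muJE : fine (leb J) = T.
  by rewrite [X in fine X](lebesgue_measure_itv `]0, T[)/= lte_fin T0/= subr0.
have cJ (c : R) : aeint leb J (fun=> c).
  apply: aeintW; have := @L2in_prod_int _ _ _ leb J mJ _ _ (L2_cst c) (L2_cst 1).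
  by under [X in EFin \o X]eq_fun do rewrite mulr1.
have iN : aeint leb J (fun s => N (v' s) ^+ 2).
  by apply: aeintW; exact: (@L2in_sq_int _ _ _ leb J).
have h : \int[leb]_(s in J) (dot (v t) (v t)) <=
    \int[leb]_(s in J) (N (v' s) ^+ 2 + 2 * (G * B)).
  apply: (@aeint_le_Rintegral _ _ _ leb J mJ) => //.
    exact: (@aeintD _ _ _ leb J mJ).
  apply: ae_imp vv' => s vvs Js.
  have sT : 0 <= s <= T by move: Js; rewrite /J/= in_itv/= => /andP[/ltW -> /ltW ->].
  apply: le_trans (le s sT) _; rewrite lerD2r -L2in_normK vvs//.
  by rewrite ler_pXn2r// ?nnegrE ?L2in_norm_ge0//; exact: nrm_le.
move: h; rewrite (@aeint_RintegralD _ _ _ leb J mJ)// !(@Rintegral_cst _ _ _ leb J mJ) muJE.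
have -> : \int[leb]_(s in J) (N (v' s) ^+ 2) = B ^+ 2.
  by rewrite L2in_normK /L2in_dot; apply: eq_Rintegral => s _; rewrite expr2.
move: (dot _ _) (B ^+ 2) (G * B) => x y z h.
by rewrite [leLHS]mulrC (_ : 2 * T * z = 2 * z * T)//; ring.
Qed.

Let result :
  dot (v T) (v T) - dot (v 0) (v 0) = 2 * \int[leb]_(t in J) g t (v t) /\
  forall t, 0 <= t <= T -> T * dot (v t) (v t) <= B ^+ 2 + 2 * T * (G * B).
Proof. by split; [exact: energy0T|exact: trace_le]. Qed.

Lemma lions_magenes_representatives :
  dot (v T) (v T) - dot (v 0) (v 0) = 2 * \int[leb]_(t in J) g t (v t) /\
  forall t, 0 <= t <= T -> T * dot (v t) (v t) <=
    bnorm N T v ^+ 2 + 2 * T * (bnorm (dual_norm H N) T g * bnorm N T v).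
Proof. by rewrite (bnorm_ae N vv') (bnorm_ae (dual_norm H N) gg'); exact: result. Qed.

End representatives.

Lemma lions_magenes :
  dot (v T) (v T) - dot (v 0) (v 0) = 2 * \int[leb]_(t in J) g t (v t) /\
  forall t, 0 <= t <= T -> T * dot (v t) (v t) <=
    bnorm N T v ^+ 2 + 2 * T * (bnorm (dual_norm H N) T g * bnorm N T v).
Proof.
have [v' [lv vv' Lv]] := L2T_rep HN vH; have [g' [lg gg' Lg]] := L2T_rep HD gD.
exact: (lions_magenes_representatives lv vv' Lv lg gg' Lg).
Qed.

End lions_magenes.

(** * Sobolev spaces and the nonlocal form *)

Section open_measurable.
Context (R : realType) (n : nat).

(** The sigma-algebra is generated by the coordinates, so that an open set has to
    be written as a countable union of boxes with rational centres. *)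
Lemma open_measurable_rV (D : set 'rV[R]_n) : open D -> measurable D.
Proof.
move=> oD.
pose box (p : 'rV[rat]_n * nat) : set 'rV[R]_n :=
  [set x | forall i, `|x ord0 i - ratr (p.1 ord0 i)| < p.2.+1%:R^-1].
have mbox p : measurable (box p).
  rewrite (_ : box p = \bigcap_(i in [set: 'I_n])
      ((fun x : 'rV[R]_n => x ord0 i) @^-1`
        `]ratr (p.1 ord0 i) - p.2.+1%:R^-1, ratr (p.1 ord0 i) + p.2.+1%:R^-1[)).
    apply: fin_bigcap_measurable => // i _.
    by rewrite -[X in measurable X]setTI; exact: measurable_coord.
  apply/seteqP; split=> x /= h i.
    by move=> _; rewrite /= in_itv/= -ltr_distl; exact: h.
  by have := h i I; rewrite /= in_itv/= -ltr_distl.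
have -> : D = \bigcup_p (if `[< box p `<=` D >] then box p else set0).
  apply/seteqP; split=> [x Dx|x [p _]]; last by case: asboolP => // h /h.
  have /nbhs_ballP[e /= e0 xeD] : nbhs x D by exact: open_nbhs_nbhs.
  have e20 : 0 < e / 2 by lra.
  have [k _ /(_ k (leqnn k)) hk] := near_infty_natSinv_lt (PosNum e20).
  have k0 : 0 < k.+1%:R^-1 :> R by rewrite invr_gt0.
  have q_ex i : exists q : rat, `|x ord0 i - ratr q| < k.+1%:R^-1.
    have : x ord0 i - k.+1%:R^-1 < x ord0 i by rewrite ltrBlDr ltrDl.
    move=> /rat_in_itvoo[q]; rewrite in_itv/= => /andP[q1 q2].
    exists q; rewrite gtr0_norm ?subr_gt0// ltrBlDr -ltrBlDl; exact: q1.
  have [q hq] := choice q_ex.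
  exists ((\row_i q i), k) => //.
  have bD : box ((\row_i q i), k) `<=` D.
    move=> y hy; apply: xeD; split => // i j; rewrite (ord1 i) /ball/=.
    have := hy j; have := hq j; rewrite /= mxE => h1 h2.
    move: hk => /=; move: (k.+1%:R^-1) h1 h2 => r h1 h2 hr.
    have -> : x ord0 j - y ord0 j = (x ord0 j - ratr (q j)) - (y ord0 j - ratr (q j)) by ring.
    by apply: le_lt_trans (ler_normB _ _) _; lra.
  case: asboolP => // _ i /=; rewrite mxE; exact: hq.
apply: countable_bigcupT_measurable; first exact: countableP.
by move=> p; case: asboolP.
Qed.

End open_measurable.

Section weighted_difference.
Context (R : realType) (n : nat).
Local Notation E := ('rV[R]_n).

Lemma measurable_enorm_diff :
  measurable_fun [set: E * E] (fun p => enorm (p.1 - p.2)).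
Proof.
have h : measurable_fun [set: E * E] (fun p => dotp (p.1 - p.2) (p.1 - p.2)).
  apply: measurable_sum => i.
  have hi : measurable_fun [set: E * E] (fun p : E * E => (p.1 - p.2) ord0 i).
    rewrite (_ : (fun p => _) = (fun p : E * E => p.1 ord0 i - p.2 ord0 i)); last first.
      by apply/funext => p; rewrite !mxE.
    apply: measurable_funB.
      exact: (measurableT_comp (@measurable_coord R n i) measurable_fst).
    exact: (measurableT_comp (@measurable_coord R n i) measurable_snd).
  exact: measurable_funM.
apply: (measurableT_comp _ h).
by apply: continuous_measurable_fun; exact: sqrt_continuous.
Qed.

(** The square root of the kernel is put on each difference quotient, which turns
    the Gagliardo seminorm and the nonlocal form into an L^2 norm and an L^2
    product on pairs of points. *)
Definition weighted_diff (a : R) (v : E -> R) (p : E * E) : R :=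
  (v p.1 - v p.2) * enorm (p.1 - p.2) `^ (a * - 2^-1).

Lemma weighted_diffM a u v p : weighted_diff a u p * weighted_diff a v p =
  (u p.1 - u p.2) * (v p.1 - v p.2) / enorm (p.1 - p.2) `^ a.
Proof.
rewrite /weighted_diff; have -> : (enorm (p.1 - p.2) `^ a)^-1 =
    (enorm (p.1 - p.2) `^ (a * - 2^-1)) ^+ 2.
  by rewrite -powR_mulrn ?powR_ge0// -powRrM -powRN; congr powR; field.
by ring.
Qed.

Lemma weighted_diff_lin a c u v :
  weighted_diff a (c *: u + v) = c *: weighted_diff a u + weighted_diff a v.
Proof.
apply/funext => p.
rewrite [RHS](_ : _ = c * weighted_diff a u p + weighted_diff a v p)//.
rewrite /weighted_diff [(c *: u + v) p.1](_ : _ = c * u p.1 + v p.1)//.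
by rewrite [(c *: u + v) p.2](_ : _ = c * u p.2 + v p.2)//; ring.
Qed.

Lemma measurable_weighted_diff a v (A : set (E * E)) : measurable A ->
  measurable_fun A (fun p : E * E => v p.1) ->
  measurable_fun A (fun p : E * E => v p.2) ->
  measurable_fun A (weighted_diff a v).
Proof.
move=> mA m1 m2; apply: measurable_funM; first exact: measurable_funB.
apply: measurable_funTS; apply: (measurableT_comp (measurable_powR _)).
exact: measurable_enorm_diff.
Qed.

End weighted_difference.

Section sobolev_space.
Context (R : realType) (n : nat) (D : set 'rV[R]_n) (mD : measurable D) (s : R).
Local Notation E := ('rV[R]_n).
Local Notation lebn := (@lebesgue_rV R n).
Local Notation a := (n%:R + 2 * s).
Local Notation wd := (@weighted_diff R n a).
Local Notation L2D := (L2in lebn D).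
Local Notation L2DD := (L2in (lebn \x lebn)%E (D `*` D)).

Let mDD : measurable (D `*` D). Proof. exact: measurableX. Qed.

Lemma measurable_wd v : measurable_fun D v -> measurable_fun (D `*` D) (wd v).
Proof.
move=> mv; apply: measurable_weighted_diff => //.
- apply: (measurable_comp mD _ mv (measurable_funTS measurable_fst)).
  by move=> _ [p [? ?] <-].
- apply: (measurable_comp mD _ mv (measurable_funTS measurable_snd)).
  by move=> _ [p [? ?] <-].
Qed.

Lemma gagliardoE v :
  gagliardo lebn D n s v = (\int[(lebn \x lebn)%E]_(p in D `*` D) (wd v p ^+ 2)%:E)%E.
Proof.
by apply: eq_integral => p _; rewrite [wd v p ^+ 2]expr2 weighted_diffM -expr2.
Qed.

Lemma HsE v : Hs D s v <-> L2D v /\ L2DD (wd v).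
Proof.
rewrite /Hs /slobodeckij /= gagliardoE; split=> [[Lv gv]|[Lv [_ gv]]].
  by split => //; split => //; apply: measurable_wd; case: Lv.
by split.
Qed.

Lemma Hs_normE v : Hs_norm D s v =
  L2in_norm lebn D v + L2in_norm (lebn \x lebn)%E (D `*` D) (wd v).
Proof. by rewrite /Hs_norm /slobodeckij_norm gagliardoE. Qed.

Lemma Hs_seminormed : seminormed (Hs D s) (Hs_norm D s).
Proof.
have S1 := @L2in_seminormed _ _ _ lebn D mD.
have S2 := @L2in_seminormed _ _ _ (lebn \x lebn)%E (D `*` D) mDD.
have wdZ c v : wd (c *: v) = c *: wd v.
  apply/funext => p; rewrite /weighted_diff.
  by rewrite [RHS](_ : _ = c * wd v p)// /weighted_diff -mulrBr mulrA.
have wdD u v : wd (u + v) = wd u + wd v.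
  by have := weighted_diff_lin a 1 u v; rewrite !scale1r.
split.
- apply/HsE; split; first exact: (sn_mem0 S1).
  by rewrite -(scale0r 0) wdZ scale0r; exact: (sn_mem0 S2).
- move=> c x y /HsE[L1 L2] /HsE[L3 L4]; apply/HsE; split; first exact: (sn_lin S1).
  by rewrite weighted_diff_lin; exact: (sn_lin S2).
- move=> c x /HsE[L1 L2]; rewrite !Hs_normE wdZ (sn_normZ S1)// (sn_normZ S2)//.
  by rewrite mulrDr.
- move=> x y /HsE[L1 L2] /HsE[L3 L4]; rewrite !Hs_normE wdD addrACA.
  by apply: lerD; [exact: (sn_normD S1)|exact: (sn_normD S2)].
Qed.

Lemma l2norm_le_Hs_norm v : L2in_norm lebn D v <= Hs_norm D s v.
Proof. by rewrite Hs_normE lerDl L2in_norm_ge0. Qed.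

Lemma Ck_lin k (c : R) (f g : E -> R) : Ck k f -> Ck k g -> Ck k (c *: f + g).
Proof.
elim: k f g => [|k IH] f g [cf df] [cg dg].
  by split => // x; exact: (cvgD (cvgM (cvg_cst c) (cf x)) (cg x)).
split; first by move=> x; exact: (cvgD (cvgM (cvg_cst c) (cf x)) (cg x)).
move=> i; have [df1 df2] := df i; have [dg1 dg2] := dg i.
have dZ x : derivable (c *: f) x (delta_mx ord0 i) by exact: derivableZ.
split; first by move=> x; apply: derivableD.
have -> : (fun x => 'D_(delta_mx ord0 i) (c *: f + g) x) =
    c *: (fun x => 'D_(delta_mx ord0 i) f x) + (fun x => 'D_(delta_mx ord0 i) g x).
  by apply/funext => x; rewrite deriveD// deriveZ.
exact: IH.
Qed.

Lemma smooth_lin (c : R) (f g : E -> R) : smooth f -> smooth g -> smooth (c *: f + g).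
Proof. by move=> sf sg k; exact: Ck_lin. Qed.

Lemma smooth0 : smooth (0 : E -> R).
Proof.
have c0 : continuous (0 : E -> R) by move=> x; exact: (@cst_continuous _ _ (0 : R)).
elim => [|k IH]; first by split.
split => //.
move=> i; split; first by move=> x; have [] := @is_derive_cst R _ _ (0 : R) x (delta_mx ord0 i).
have -> : (fun x : E => 'D_(delta_mx ord0 i) (0 : E -> R) x) = 0.
  by apply/funext => x; exact: derive_cst.
exact: IH.
Qed.

(** Approximating functions may be combined linearly; the tolerance for [x] is
    divided by [|c| + 1] rather than [|c|], which may vanish. *)
Lemma Hs_vanishing_seminormed Z : seminormed (Hs_vanishing D s Z) (Hs_norm D s).
Proof.
have S := Hs_seminormed.
split.
- split; first exact: (sn_mem0 S).
  move=> e e0; exists 0; split => //.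
  + exact: smooth0.
  + exact: (sn_mem0 S).
  + by rewrite subr0 (sn_norm0 S).
- move=> c x y [Hx ax] [Hy ay]; split; first exact: (sn_lin S).
  move=> e e0; have c1 : 0 < `|c| + 1 by rewrite ltr_wpDl.
  have e1 : 0 < e / 2 / (`|c| + 1) by rewrite !divr_gt0.
  have e2 : 0 < e / 2 by rewrite divr_gt0.
  have [f [sf f0 Hf xf]] := ax _ e1; have [g [sg g0 Hg yg]] := ay _ e2.
  exists (c *: f + g); split.
  + exact: smooth_lin.
  + move=> z Zz; rewrite [LHS](_ : _ = c * f z + g z)//.
    by rewrite f0// g0// mulr0 addr0.
  + exact: (sn_lin S).
  + rewrite opprD addrACA -scalerBr.
    have Hxf : Hs D s (x - f) by exact: (sn_memB S).
    have Hyg : Hs D s (y - g) by exact: (sn_memB S).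
    apply: le_lt_trans (sn_normD S (sn_memZ S c Hxf) Hyg) _.
    rewrite (sn_normZ S)//; have := sn_norm_ge0 S Hxf; move: xf yg.
    rewrite ltr_pdivlMr//.
    move: (Hs_norm D s (x - f)) (Hs_norm D s (y - g)) (normr_ge0 c) => p q; nra.
- by move=> c x [Hx _]; exact: (sn_normZ S).
- by move=> x y [Hx _] [Hy _]; exact: (sn_normD S).
Qed.

End sobolev_space.

Section nonlocal_bilinear.
Context (R : realType) (n : nat) (D : set 'rV[R]_n) (mD : measurable D) (s : R).
Local Notation E := ('rV[R]_n).
Local Notation lebn := (@lebesgue_rV R n).
Local Notation lebnn := (lebn \x lebn)%E.
Local Notation wd v := (@weighted_diff R n (n%:R + 2 * s) (v \_ D)).
Let U : set (E * E) := (D `*` setT) `|` (setT `*` D).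
Let mU : measurable U.
Proof. by apply: measurableU; apply: measurableX. Qed.

Hypothesis s0 : 0 <= s.
Context (H : set (E -> R)) (N : (E -> R) -> R) (HN : seminormed H N) (C : R).
Hypothesis Hm : forall v, H v -> measurable_fun D v.
Hypothesis HC : forall u v, H u -> H v ->
  (nonlocal_form D s u v <= (C * N u * N v)%:E)%E.

Let K := c_ns n s / 2.

Let K0 : 0 <= K.
Proof.
have Gam_ge0 z : 0 <= Gamma z :> R.
  by apply: Rintegral_ge0 => t _; rewrite mulr_ge0 ?powR_ge0 ?expR_ge0.
by rewrite /K /c_ns !mulr_ge0 ?invr_ge0 ?mulr_ge0 ?powR_ge0.
Qed.

Let formE u v : nonlocal_form D s u v =
  (K%:E * \int[lebnn]_(p in U) (wd u p * wd v p)%:E)%E.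
Proof. by congr (_ * _)%E; apply: eq_integral => p _; rewrite weighted_diffM. Qed.

(** The energy of [u] is bounded through [HC], an inequality in the extended
    reals, so it is finite if the constant in front of it is not 0. *)
Let wd_L2 u : 0 < K -> H u -> L2in lebnn U (wd u).
Proof.
move=> Kp Hu; have mu : measurable_fun setT (u \_ D).
  by apply/(measurable_restrictT _ mD); exact: Hm.
split.
  apply: measurable_weighted_diff => //; apply: measurable_funTS.
    exact: (measurableT_comp mu measurable_fst).
  exact: (measurableT_comp mu measurable_snd).
have := HC Hu Hu; rewrite formE.
rewrite (_ : integral _ _ _ = \int[lebnn]_(p in U) (wd u p ^+ 2)%:E)%E; last first.
  by apply: eq_integral => p _; rewrite expr2.
set I := integral _ _ _ => le.
have I0 : (0 <= I)%E by apply: integral_ge0 => p _; rewrite lee_fin sqr_ge0.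
rewrite ltey; apply/eqP => Ioo; move: le; rewrite Ioo.
by rewrite gt0_muley ?lte_fin// leye_eq.
Qed.

Let form_dot u v : 0 < K -> H u -> H v ->
  nonlocal_form D s u v = (K * L2in_dot lebnn U (wd u) (wd v))%:E.
Proof.
move=> Kp Hu Hv; rewrite formE [RHS]EFinM; congr (_ * _)%E.
have i := @L2in_prod_int _ _ _ lebnn U mU _ _ (wd_L2 Kp Hu) (wd_L2 Kp Hv).
exact: (@aeint_integral _ _ _ lebnn U mU _ (aeintW i)).
Qed.

Let form0 u v : K = 0 -> nonlocal_form D s u v = 0%:E.
Proof. by rewrite formE => ->; rewrite mul0e. Qed.

Lemma nonlocal_form_fin u v : H u -> H v ->
  nonlocal_form D s u v = (fine (nonlocal_form D s u v))%:E.
Proof.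
move=> Hu Hv; have := K0; rewrite le_eqVlt => /predU1P[/esym K_0|Kp].
  by rewrite form0.
by rewrite form_dot.
Qed.

Let restrict_lin c (u v : E -> R) : (c *: u + v) \_ D = c *: (u \_ D) + (v \_ D).
Proof.
apply/funext => x; rewrite [RHS](_ : _ = c * (u \_ D) x + (v \_ D) x)// /patch.
by case: ifP => // _; rewrite mulr0 addr0.
Qed.

(** The one-sided bound [HC] becomes a bound on the absolute value by applying
    it to [- x]. *)
Lemma nonlocal_form_bilinear :
  bounded_bilinear H N H N (fun u v => fine (nonlocal_form D s u v)) C.
Proof.
have linl c x x' y : H x -> H x' -> H y -> fine (nonlocal_form D s (c *: x + x') y) =
    c * fine (nonlocal_form D s x y) + fine (nonlocal_form D s x' y).
  move=> Hx Hx' Hy; have := K0; rewrite le_eqVlt => /predU1P[/esym K_0|Kp].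
    by rewrite !form0//= mulr0 addr0.
  rewrite !form_dot//=; last exact: (sn_lin HN).
  rewrite restrict_lin weighted_diff_lin.
  rewrite (@L2in_dot_linl _ _ _ lebnn U mU c _ _ _ (wd_L2 Kp Hx) (wd_L2 Kp Hx') (wd_L2 Kp Hy)).
  by ring.
have sym x y : nonlocal_form D s x y = nonlocal_form D s y x.
  by rewrite !formE; congr (_ * _)%E; apply: eq_integral => p _; rewrite mulrC.
split => //.
- by move=> c x y y' Hx Hy Hy'; rewrite !(sym x); exact: linl.
- move=> x y Hx Hy.
  have le u v : H u -> H v -> fine (nonlocal_form D s u v) <= C * N u * N v.
    by move=> Hu Hv; rewrite -lee_fin -nonlocal_form_fin//; exact: HC.
  rewrite ler_norml le// andbT lerNl.
  have HNx : H (- x) by rewrite -scaleN1r; exact: (sn_memZ HN).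
  have := le _ _ HNx Hy; rewrite (sn_normN HN Hx).
  have := linl (-1) x 0 y Hx (sn_mem0 HN) Hy.
  have -> : fine (nonlocal_form D s 0 y) = 0.
    have := linl 1 0 0 y (sn_mem0 HN) (sn_mem0 HN) Hy; rewrite scaler0 addr0 mul1r.
    by move=> h; apply: (@addrI _ (fine (nonlocal_form D s 0 y))); rewrite addr0 -h.
  by rewrite !addr0 scaleN1r mulN1r => ->.
Qed.

End nonlocal_bilinear.

(** * Functions with a weak time derivative *)

Lemma sub_lin (R : realType) (V : lmodType R) (x y : V) : x - y = (-1) *: y + x.
Proof. by rewrite scaleN1r addrC. Qed.

Section parabolic_space.
Context (R : realType) (n : nat) (D : set 'rV[R]_n) (mD : measurable D).
Local Notation E := ('rV[R]_n).
Local Notation lebn := (@lebesgue_rV R n).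
Local Notation leb := (@lebesgue_measure R).
Context (H : set (E -> R)) (N : (E -> R) -> R) (HN : seminormed H N).
Hypothesis HL : H `<=` L2in lebn D.
Hypothesis nrm_le : forall z, H z -> L2in_norm lebn D z <= N z.
Context (T : R) (T0 : 0 < T).
Let J : set R := `]0, T[%classic.
Let mJ : measurable J. Proof. exact: measurable_itv. Qed.
Let LS := @L2in_seminormed _ _ _ lebn D mD.
Let LB := @L2in_bilinear _ _ _ lebn D mD.
Let HD := dual_seminormed HN.
Let HB := dual_pairing HN.

Lemma aeint_bounded_mul (h f : R -> R) (M : R) : measurable_fun J h ->
  (forall t, J t -> `|h t| <= M) -> aeint leb J f -> aeint leb J (fun t => h t * f t).
Proof.
move=> mh hM [f' if' ff']; exists (fun t => h t * f' t); last first.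
  by apply: ae_imp ff' => t e Jt; rewrite e.
have /integrableP[/measurable_EFinP mf' _] := if'.
apply: (@le_integrable _ _ _ leb J mJ _ (EFin \o (fun t => M * f' t))).
- by apply/measurable_EFinP; exact: measurable_funM.
- move=> t Jt /=; rewrite lee_fin !normrM ler_wpM2r//.
  by apply: le_trans (hM t Jt) _; rewrite ler_norm.
- exact: (@integrable_EFinZ _ _ _ leb J mJ).
Qed.

Let continuous_mul (h f : R -> R) : continuous h -> aeint leb J f ->
  aeint leb J (fun t => h t * f t).
Proof.
move=> ch; have [x _ hx] : exists2 x, x \in `[0, T]%R &
    forall t, t \in `[0, T]%R -> `|h t| <= `|h x|.
  apply: (@EVT_max _ (fun x => `|h x|)); first exact: ltW.
  apply: continuous_subspaceT => x; apply: continuous_comp; first exact: ch.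
  exact: norm_continuous.
apply: (@aeint_bounded_mul _ _ `|h x|).
  by apply: measurable_funTS; exact: continuous_measurable_fun.
move=> t; rewrite /J/= in_itv/= => /andP[t0 tT].
by apply: hx; rewrite in_itv/= !ltW.
Qed.

Let test_continuous phi : test_function T phi -> continuous phi /\ continuous (derive1 phi).
Proof.
move=> [sphi _]; split => t; apply/differentiable_continuous/derivable1_diffP.
  exact: (sphi 0%N).
by have := sphi 1%N t; rewrite derive1n1.
Qed.

Lemma L2T_cst z : H z -> L2T H N T (fun=> z).
Proof.
move=> Hz; apply: (rep_L2T (u' := fun=> z)); [exact: simple_limit_cst|exact: aeW|].
split; first exact: measurable_cst.
rewrite (@integral_cst _ _ _ leb)// lte_mul_pinfty ?lee_fin ?sqr_ge0//.
by rewrite [X in (X < _)%E](lebesgue_measure_itv `]0, T[)/= lte_fin T0 -EFinB ltry.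
Qed.

Let dot_bilinear : bounded_bilinear H N H N (L2in_dot lebn D) 1.
Proof.
split.
- by move=> c x x' y Hx Hx' Hy; rewrite (bb_linl LB)//; exact: HL.
- by move=> c x y y' Hx Hy Hy'; rewrite (bb_linr LB)//; exact: HL.
- move=> x y Hx Hy; apply: le_trans (bb_le LB (HL Hx) (HL Hy)) _.
  by rewrite !mul1r; apply: ler_pM; rewrite ?L2in_norm_ge0//; exact: nrm_le.
Qed.

Lemma is_dt_lin c u v g k : W D T H N u -> W D T H N v ->
  is_dt D T H N u g -> is_dt D T H N v k -> is_dt D T H N (c *: u + v) (c *: g + k).
Proof.
move=> [[uL _] uH _] [[vL _] vH _] [gD ug] [kD vk]; split.
  exact: (sn_lin (L2T_seminormed HD T) c gD kD).
move=> eta phi Heta tphi; have [cphi cphi'] := test_continuous tphi.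
have du := pairing_aeint HN HN dot_bilinear uH (L2T_cst Heta).
have dv := pairing_aeint HN HN dot_bilinear vH (L2T_cst Heta).
have pg := pairing_aeint HD HN HB gD (L2T_cst Heta).
have pk := pairing_aeint HD HN HB kD (L2T_cst Heta).
have du' := continuous_mul cphi' du; have dv' := continuous_mul cphi' dv.
have pg' := continuous_mul cphi pg; have pk' := continuous_mul cphi pk.
transitivity (\int[leb]_(t in J) (c * (derive1 phi t * L2in_dot lebn D (u t) eta) +
    derive1 phi t * L2in_dot lebn D (v t) eta)).
  apply: eq_Rintegral => t /set_mem; rewrite /J/= in_itv/= => /andP[t0 tT].
  have tI : 0 <= t <= T by rewrite !ltW.
  have := bb_linl LB c (uL t tI) (vL t tI) (HL Heta).
  by rewrite /l2dot /L2in_dot => ->; ring.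
rewrite (@Rintegral_lin _ _ _ leb J mJ)//.
rewrite (ug _ _ Heta tphi) (vk _ _ Heta tphi).
transitivity (- \int[leb]_(t in J) (c * (phi t * g t eta) + phi t * k t eta)).
  by rewrite (@Rintegral_lin _ _ _ leb J mJ)// opprD mulrN.
congr (- _); apply: eq_Rintegral => t _.
by rewrite [(c *: g + k) t eta](_ : _ = c * g t eta + k t eta)//; ring.
Qed.

Lemma W_lin c u v : W D T H N u -> W D T H N v -> W D T H N (c *: u + v).
Proof.
move=> Wu Wv; have [[uL uC] uH [g ug]] := Wu; have [[vL vC] vH [k vk]] := Wv.
split; last by exists (c *: g + k); exact: is_dt_lin.
- split; first by move=> t tT; exact: (sn_lin LS c (uL t tT) (vL t tT)).
  move=> t tT e e0; have c1 : 0 < `|c| + 1 by rewrite ltr_wpDl.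
  have e1 : 0 < e / 2 / (`|c| + 1) by rewrite !divr_gt0.
  have e2 : 0 < e / 2 by rewrite divr_gt0.
  have [d1 d10 h1] := uC t tT _ e1; have [d2 d20 h2] := vC t tT _ e2.
  exists (Num.min d1 d2); first by rewrite lt_min d10.
  move=> r rT; rewrite lt_min => /andP[r1 r2].
  have A : L2in_norm lebn D (u r - u t) < _ := h1 r rT r1.
  have B : L2in_norm lebn D (v r - v t) < _ := h2 r rT r2.
  have -> : (c *: u + v) r - (c *: u + v) t = c *: (u r - u t) + (v r - v t).
    rewrite [(c *: u + v) r](_ : _ = c *: u r + v r)//.
    rewrite [(c *: u + v) t](_ : _ = c *: u t + v t)//.
    by rewrite opprD addrACA -scalerBr.
  have Lu := sn_memB LS (uL r rT) (uL t tT).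
  have Lv := sn_memB LS (vL r rT) (vL t tT).
  apply: le_lt_trans (sn_normD LS (sn_memZ LS c Lu) Lv) _; rewrite (sn_normZ LS)//.
  move: A B (sn_norm_ge0 LS Lu); rewrite ltr_pdivlMr//.
  move: (L2in_norm lebn D (u r - u t)) (L2in_norm lebn D (v r - v t)) (normr_ge0 c).
  by move=> x y; nra.
- exact: (sn_lin (L2T_seminormed HN T) c uH vH).
Qed.

Lemma W_sub u v : W D T H N u -> W D T H N v -> W D T H N (u - v).
Proof. by move=> Wu Wv; have := W_lin (-1) Wv Wu; rewrite -sub_lin. Qed.

Lemma is_dt_sub u v g k : W D T H N u -> W D T H N v ->
  is_dt D T H N u g -> is_dt D T H N v k -> is_dt D T H N (u - v) (g - k).
Proof.
move=> Wu Wv ug vk; have := is_dt_lin (-1) Wv Wu vk ug.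
by rewrite -!sub_lin.
Qed.

Lemma W_dt v : W D T H N v -> is_dt D T H N v (dt D T H N v).
Proof. by case=> _ _ [g vg]; apply: (@xgetI _ 0 _ g). Qed.

Lemma W_energy v g : W D T H N v -> is_dt D T H N v g ->
  l2norm lebn D (v T) ^+ 2 - l2norm lebn D (v 0) ^+ 2 =
    2 * \int[leb]_(t in J) g t (v t) /\
  forall t, 0 <= t <= T -> T * l2norm lebn D (v t) ^+ 2 <=
    bnorm N T v ^+ 2 + 2 * T * (bnorm (dual_norm H N) T g * bnorm N T v).
Proof.
move=> [[vL vC] vH _] [gD vg].
have [h1 h2] := lions_magenes mD HN HL nrm_le T0 vL vC vH gD vg.
split.
  rewrite -h1; congr (_ - _); exact: L2in_normK.
move=> t tT; apply: le_trans (h2 t tT).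
by rewrite le_eqVlt; apply/orP; left; apply/eqP; congr (_ * _); exact: L2in_normK.
Qed.

(** Polarization of the energy identity. As its right side does not mention [g]
    and [k], it determines the integral of a time derivative of [u] against
    members of W(0,T), whereas [is_dt] only tests with products of a function of
    time and a function of space. *)
Lemma W_energy_polar u v g k : W D T H N u -> W D T H N v ->
  is_dt D T H N u g -> is_dt D T H N v k ->
  \int[leb]_(t in J) (g t (v t) + k t (u t)) =
  l2dot lebn D (u T) (v T) - l2dot lebn D (u 0) (v 0).
Proof.
move=> Wu Wv ug vk.
have Wuv := W_lin 1 Wu Wv; have uvgk := is_dt_lin 1 Wu Wv ug vk.
have [E1 _] := W_energy Wu ug; have [E2 _] := W_energy Wv vk.
have [E3 _] := W_energy Wuv uvgk.
have [[uL _] uH _] := Wu; have [[vL _] vH _] := Wv.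
have [gD _] := ug; have [kD _] := vk.
have TT : 0 <= T <= T by apply/andP; split; [exact: ltW|].
have T00 : 0 <= (0 : R) <= T by apply/andP; split; [|exact: ltW].
have sq t : 0 <= t <= T -> l2norm lebn D ((1 *: u + v) t) ^+ 2 =
    l2norm lebn D (u t) ^+ 2 + 2 * l2dot lebn D (u t) (v t) + l2norm lebn D (v t) ^+ 2.
  move=> tT; have Lu := uL t tT; have Lv := vL t tT.
  have Luv := sn_lin LS 1 Lu Lv.
  rewrite [(1 *: u + v) t](_ : _ = 1 *: u t + v t)//.
  have nE x : l2norm lebn D x ^+ 2 = L2in_dot lebn D x x by exact: L2in_normK.
  rewrite !nE (bb_linl LB)// (bb_linr LB)// (bb_linr LB)//.
  rewrite (L2in_dotC _ _ (v t) (u t)) -/(L2in_dot lebn D (u t) (v t)) !mul1r.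
  by rewrite /l2dot -/(L2in_dot lebn D (u t) (v t)); ring.
have gu := pairing_aeint HD HN HB gD uH; have gv := pairing_aeint HD HN HB gD vH.
have ku := pairing_aeint HD HN HB kD uH; have kv := pairing_aeint HD HN HB kD vH.
have E4 : \int[leb]_(t in J) (1 *: g + k) t ((1 *: u + v) t) =
    \int[leb]_(t in J) g t (u t) + \int[leb]_(t in J) (g t (v t) + k t (u t)) +
    \int[leb]_(t in J) k t (v t).
  have gvku := @aeintD _ _ _ leb J mJ _ _ gv ku.
  rewrite -(@aeint_RintegralD _ _ _ leb J mJ)// -(@aeint_RintegralD _ _ _ leb J mJ)//; last first.
    exact: (@aeintD _ _ _ leb J mJ).
  have [u' [lu uu' _]] := L2T_rep HN uH; have [v' [lv vv' _]] := L2T_rep HN vH.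
  have [g' [lg gg' _]] := L2T_rep HD gD; have [k' [lk kk' _]] := L2T_rep HD kD.
  apply: (@Rintegral_ae _ _ _ leb).
  have h1 : \forall t \ae leb, J t -> u t = u' t /\ v t = v' t.
    by apply: ae_imp2 uu' vv' => t a b Jt; split; [exact: a|exact: b].
  have h2 : \forall t \ae leb, J t -> g t = g' t /\ k t = k' t.
    by apply: ae_imp2 gg' kk' => t a b Jt; split; [exact: a|exact: b].
  apply: ae_imp2 h1 h2 => t h1 h2 Jt; have [a b] := h1 Jt; have [e f] := h2 Jt.
  have Hu : H (u t) by rewrite a; exact: (simple_limit_mem lu).
  have Hv : H (v t) by rewrite b; exact: (simple_limit_mem lv).
  have Dg : dual H N (g t) by rewrite e; exact: (simple_limit_mem lg).
  have Dk : dual H N (k t) by rewrite f; exact: (simple_limit_mem lk).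
  rewrite [(1 *: u + v) t](_ : _ = 1 *: u t + v t)//.
  rewrite [(1 *: g + k) t _](_ : _ = 1 * g t (1 *: u t + v t) + k t (1 *: u t + v t))//.
  by rewrite Dg.1// Dk.1//; ring.
move: E3; rewrite E4 (sq T TT) (sq 0 T00).
move: E1 E2; move: (l2norm _ _ _ ^+ 2) (l2norm _ _ _ ^+ 2) (l2norm _ _ _ ^+ 2) (l2norm _ _ _ ^+ 2).
move: (l2dot _ _ _ _) (l2dot _ _ _ _) (Rintegral _ _ _) (Rintegral _ _ _) (Rintegral _ _ _).
move=> *; lra.
Qed.

End parabolic_space.

(** * The error estimate *)

Section arithmetic.
Context (R : realType) (alpha c kappa : R).
Hypotheses (alpha0 : 0 < alpha) (c0 : 0 <= c) (kappa0 : 0 <= kappa).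

(** [M1] bounds [X + alpha x^2], and [M2] bounds [E + e^2], in units of the
   sum of squares on the right of [error_arithmetic]. *)
Let M1 := kappa + 3 * (1 + c ^+ 2) / alpha.
Let M2 := 2 * kappa + 2 * M1 + 2 + 2 * M1 / alpha.
Definition error_constant := M2 + 1 + M2 / 2.

Let k3_ge0 : 0 <= 3 * (1 + c ^+ 2) / alpha.
Proof. by rewrite divr_ge0 ?mulr_ge0 ?addr_ge0 ?sqr_ge0// ltW. Qed.

Let M1_ge0 : 0 <= M1.
Proof. by rewrite /M1 addr_ge0. Qed.

Let M2_ge0 : 0 <= M2.
Proof.
have : 0 <= 2 * M1 / alpha by rewrite divr_ge0 ?mulr_ge0// ltW.
by move: M1_ge0 kappa0; rewrite /M2; lra.
Qed.

Lemma error_constant_gt0 : 0 < error_constant.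
Proof. by move: M2_ge0; rewrite /error_constant; lra. Qed.

(** The two applications of Young's inequality. In the error estimate [a], [b],
    [l1], [l2] are the norms of [dt eta], [eta], [g1], [g2], and [x], [e] those of
    [xi], [u - uh]; [X], [X0], [Y], [Y0] are the squared L^2 norms of [xi] and
    [eta] at times [T] and 0, and [E] is that of [u - uh] at time [T]. *)
Lemma error_arithmetic (a b l1 l2 x X X0 Y Y0 e E S : R) :
  0 <= a -> 0 <= b -> 0 <= l1 -> 0 <= l2 -> 0 <= x -> 0 <= X -> 0 <= e ->
  2^-1 * (X - X0) + alpha * x ^+ 2 <= (a + c * b + l1) * x ->
  X0 <= Y0 -> Y0 <= kappa * (a ^+ 2 + b ^+ 2) -> Y <= kappa * (a ^+ 2 + b ^+ 2) ->
  e <= b + x -> E <= 2 * Y + 2 * X -> - ((l1 + l2) * e) <= S ->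
  E + e ^+ 2 <= error_constant * (a ^+ 2 + b ^+ 2 + l1 ^+ 2 + l2 ^+ 2) + S.
Proof.
move=> a0 b0 l10 l20 x0 X_0 e0 h1 h2 h3 h4 h5 h6 h7.
have [al0 ce0 ka0] : [/\ 0 < alpha, 0 <= c & 0 <= kappa] by [].
set q := a ^+ 2 + b ^+ 2 + l1 ^+ 2 + l2 ^+ 2.
have q0 : 0 <= q by rewrite !addr_ge0 ?sqr_ge0.
have ab_q : a ^+ 2 + b ^+ 2 <= q by rewrite /q -addrA lerDl addr_ge0 ?sqr_ge0.
have b_q : b ^+ 2 <= q by have := sqr_ge0 a; rewrite /q in ab_q *; lra.
have l_q : l1 ^+ 2 + l2 ^+ 2 <= q.
  by have := sqr_ge0 a; have := sqr_ge0 b; rewrite /q; lra.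
have kq : kappa * (a ^+ 2 + b ^+ 2) <= kappa * q by rewrite ler_wpM2l.
(* Only half of the coercivity term is spent here. *)
have y1 : (a + c * b + l1) * x <= alpha / 2 * x ^+ 2 + 3 * (1 + c ^+ 2) / alpha / 2 * q.
  have s3 : (a + c * b + l1) ^+ 2 <= 3 * (1 + c ^+ 2) * q.
    have A1 : (a + c * b + l1) ^+ 2 <= 3 * (a ^+ 2 + c ^+ 2 * b ^+ 2 + l1 ^+ 2).
      have := sqr_ge0 (a - c * b); have := sqr_ge0 (a - l1); have := sqr_ge0 (c * b - l1).
      by rewrite !expr2; nra.
    apply: le_trans A1 _; rewrite -mulrA ler_wpM2l//.
    have := sqr_ge0 a; have := sqr_ge0 b; have := sqr_ge0 l1; have := sqr_ge0 l2; have := sqr_ge0 c.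
    rewrite /q; move: (a ^+ 2) (b ^+ 2) (l1 ^+ 2) (l2 ^+ 2) (c ^+ 2) => A B L1 L2 c2 *.
    have : 0 <= c2 * A by rewrite mulr_ge0.
    have : 0 <= c2 * L1 by rewrite mulr_ge0.
    have : 0 <= c2 * L2 by rewrite mulr_ge0.
    by rewrite mulrDl mul1r !mulrDr; lra.
  set z := a + c * b + l1 in s3 *.
  have h : z * x <= alpha / 2 * x ^+ 2 + z ^+ 2 / alpha / 2.
    rewrite -subr_ge0.
    have -> : alpha / 2 * x ^+ 2 + z ^+ 2 / alpha / 2 - z * x = (alpha * x - z) ^+ 2 / (2 * alpha).
      by field; lra.
    by rewrite divr_ge0 ?sqr_ge0// mulr_ge0// ltW.
  apply: le_trans h _; rewrite lerD2l.
  have -> : 3 * (1 + c ^+ 2) / alpha / 2 * q = 3 * (1 + c ^+ 2) * q / alpha / 2 by field; lra.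
  by rewrite ler_pM2r// ler_pM2r ?invr_gt0.
have x2 := sqr_ge0 x.
set k3 := 3 * (1 + c ^+ 2) / alpha in y1.
have XM : X + alpha * x ^+ 2 <= M1 * q.
  rewrite /M1 -/k3 mulrDl; move: y1 h1 h2 h3 kq.
  by rewrite (_ : k3 / 2 * q = (k3 * q) / 2); [lra|ring].
have ax : 0 <= alpha * x ^+ 2 by rewrite mulr_ge0// ltW.
have XM' : X <= M1 * q by lra.
have xM : x ^+ 2 <= M1 / alpha * q.
  by rewrite mulrAC ler_pdivlMr// mulrC; lra.
have e2 : e ^+ 2 <= 2 * b ^+ 2 + 2 * x ^+ 2.
  have : e ^+ 2 <= (b + x) ^+ 2 by rewrite ler_pXn2r ?nnegrE// addr_ge0.
  by have := sqr_ge0 (b - x); rewrite !expr2; nra.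
have M2E : M2 * q = 2 * (kappa * q) + 2 * (M1 * q) + 2 * q + 2 * (M1 / alpha * q).
  by rewrite /M2; ring.
have main : E + e ^+ 2 <= M2 * q by rewrite M2E; lra.
have E_e : e ^+ 2 <= M2 * q.
  by rewrite M2E; move: (mulr_ge0 kappa0 q0) (mulr_ge0 M1_ge0 q0); lra.
have y2 : (l1 + l2) * e <= q + M2 * q / 2.
  have : (l1 + l2) * e <= l1 ^+ 2 + l2 ^+ 2 + e ^+ 2 / 2.
    by have := sqr_ge0 (l1 + l2 - e); have := sqr_ge0 (l1 - l2); rewrite !expr2; nra.
  by lra.
have -> : error_constant * q = M2 * q + q + M2 * q / 2 by rewrite /error_constant; ring.
by move: main E_e y2 h7; move: (M2 * q) ((l1 + l2) * e) (e ^+ 2) => *; lra.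
Qed.

End arithmetic.

(** The error equation for [xi], on the level of the integrals: the terms in
    [u], [uh] and [vh] carry these letters, those in [eta] and [xi] the letters
    [e] and [x]. *)
Lemma galerkin_arith (R : realFieldType) (iu iuh ivh fu fuh fvh la laH F g1 de X X0 fe fx : R) :
  iu + fu + la = F -> iuh + fuh + laH = F -> la - laH = g1 -> iu - ivh = de ->
  X - X0 = 2 * (ivh - iuh) -> fe = fu - fvh -> fx = fvh - fuh ->
  de + 2^-1 * (X - X0) + (fe + fx) + g1 = 0.
Proof. by move=> *; lra. Qed.

Lemma energy_arith (R : realFieldType) (p X X0 q r s a b c l1 x al : R) :
  p + 2^-1 * (X - X0) + (q + r) + s = 0 ->
  `|p| <= `|1| * a * x -> `|q| <= `|c| * b * x -> `|s| <= `|1| * l1 * x -> al * x ^+ 2 <= r ->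
  2^-1 * (X - X0) + al * x ^+ 2 <= (a + `|c| * b + l1) * x.
Proof.
move=> E; rewrite normr1 !mul1r => hp hq hs hr; rewrite !mulrDl.
move: hp hq hs; rewrite !ler_norml => /andP[? ?] /andP[? ?] /andP[? ?]; lra.
Qed.

Lemma trace_arith (R : realFieldType) (T y a b : R) : 0 < T -> 0 <= a -> 0 <= b ->
  T * y <= b ^+ 2 + 2 * T * (a * b) -> y <= (T^-1 + 1) * (a ^+ 2 + b ^+ 2).
Proof.
move=> T0 a0 b0 h; have Ti : 0 <= T^-1 by rewrite invr_ge0 ltW.
have {}h : y <= T^-1 * b ^+ 2 + 2 * (a * b).
  rewrite -(ler_pM2l T0); apply: le_trans h _.
  by rewrite mulrDr [T * (T^-1 * _)]mulrA divff ?gt_eqF// mul1r; lra.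
apply: le_trans h _; rewrite mulrDl mul1r mulrDr.
have := mulr_ge0 Ti (sqr_ge0 a); have := sqr_ge0 (a - b); rewrite sqrrB.
by move: (T^-1 * a ^+ 2) (T^-1 * b ^+ 2) (a ^+ 2) (b ^+ 2) => *; lra.
Qed.

(** The sum of the two variational inequalities, where for instance [muHuh] is
    the value of [b(muH, uh)]. The value of [b(la, uh)] drops out. *)
Lemma residual_arith (R : realFieldType)
    (lau law laHu laHuh laHw muu muw muHu muHuh muHw g1u g1h g2u g2h l1 l2 e d1 d2 : R) :
  muu - lau <= muw - law -> muHuh - laHuh <= muHw - laHw ->
  lau - laHu = g1u -> lau - muHu = g2u ->
  (exists lauh, lauh - laHuh = g1h /\ lauh - muHuh = g2h) ->
  d1 = g1u - g1h -> d2 = g2u - g2h ->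
  `|d1| <= `|1| * l1 * e -> `|d2| <= `|1| * l2 * e ->
  - ((l1 + l2) * e) <= - (muHu - lau - (muHw - law)) - (muu - laHu - (muw - laHw)).
Proof.
move=> h1 h2 h3 h4 [lauh [h5 h6]] h7 h8; rewrite normr1 !mul1r mulrDl.
by rewrite !ler_norml => /andP[? ?] /andP[? ?]; lra.
Qed.

Lemma Vh_sub (R : realType) (n : nat) (P : setting R n) Th u v : seminormed (Hsp P) (Hnorm P) ->
  Vh P Th u -> Vh P Th v -> Vh P Th (u - v).
Proof.
move=> HN [Hu [f [cf lf uf]]] [Hv [g [cg lg vg]]]; split; first exact: (sn_memB HN).
exists (f - g); split.
- by move=> x; exact: (cvgB (cf x) (cg x)).
- move=> K KT; have [l1 [c1 e1]] := lf K KT; have [l2 [c2 e2]] := lg K KT.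
  exists (l1 - l2), (c1 - c2) => x Kx.
  rewrite [LHS](_ : _ = f x - g x)// e1// e2//.
  rewrite /dotp opprD addrACA -sumrB; congr (_ + _).
  by apply: eq_bigr => i _; rewrite !mxE mulrBl.
- apply: ae_imp2 uf vg => x h1 h2 Ox.
  by rewrite [LHS](_ : _ = u x - v x)// h1// h2.
Qed.

Section error_estimate.
Context (R : realType) (n : nat) (P : setting R n) (C alpha : R).
Hypotheses (hP : admissible P) (ha : continuous_coercive P C alpha).
Local Notation E := ('rV[R]_n).
Local Notation D := (Om P).
Local Notation T := (Tend P).
Local Notation H := (Hsp P).
Local Notation N := (Hnorm P).
Local Notation ND := (dual_norm H N).
Local Notation lebn := (@lebesgue_rV R n).
Local Notation leb := (@lebesgue_measure R).
Let J : set R := `]0, T[%classic.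
Let mJ : measurable J. Proof. exact: measurable_itv. Qed.

Let T0 : 0 < T. Proof. by case: hP. Qed.

Let mD : measurable D.
Proof. by case: hP => _ _ _ [_ oD _ _ _] _; exact: open_measurable_rV. Qed.

Let HN : seminormed H N.
Proof. exact: Hs_vanishing_seminormed. Qed.

Let HL : H `<=` L2in lebn D.
Proof. by move=> v [/(HsE mD)[]]. Qed.

Let nrm_le z : H z -> L2in_norm lebn D z <= N z.
Proof. by move=> _; exact: l2norm_le_Hs_norm. Qed.

Let s0 : 0 <= sorder P.
Proof. by case: hP => _ /andP[/ltW]. Qed.

Let Hm v : H v -> measurable_fun D v.
Proof. by move=> /HL[]. Qed.

Let HCont u v : H u -> H v -> (aform P u v <= (C * N u * N v)%:E)%E.
Proof. by case: ha => _ h _; exact: h. Qed.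

Let form u v : R := fine (aform P u v).

Let AB : bounded_bilinear H N H N form C.
Proof. exact: (nonlocal_form_bilinear mD s0 HN Hm HCont). Qed.

Let DB := dual_pairing HN.
Let HD := dual_seminormed HN.

Let alpha0 : 0 < alpha. Proof. by case: ha. Qed.

Let coercive u : H u -> alpha * N u ^+ 2 <= form u u.
Proof.
move=> Hu; case: ha => _ _ /(_ u Hu).
by rewrite [aform P u u](nonlocal_form_fin mD s0 Hm HCont Hu Hu) lee_fin.
Qed.

Let LS := @L2in_seminormed _ _ _ lebn D mD.
Let LB := @L2in_bilinear _ _ _ lebn D mD.

Let coercive_integral v : L2T H N T v ->
  alpha * bnorm N T v ^+ 2 <= \int[leb]_(t in J) form (v t) (v t).
Proof.
move=> Lv; have [v' [lv vv' Lv']] := L2T_rep HN Lv.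
have Hv' t : H (v' t) by exact: (simple_limit_mem lv).
have i1 : leb.-integrable J (EFin \o (fun t => N (v' t) ^+ 2)).
  exact: (@L2in_sq_int _ _ _ leb J).
rewrite (bnorm_ae N vv') /bnorm L2in_normK /L2in_dot.
rewrite (_ : Rintegral _ _ _ = \int[leb]_(t in J) (N (v' t) ^+ 2)); last first.
  by apply: eq_Rintegral => t _; rewrite expr2.
rewrite -(@RintegralZl _ _ _ leb J _ _ mJ i1).
apply: (@aeint_le_Rintegral _ _ _ leb J mJ).
- by apply: aeintW; exact: (@integrable_EFinZ _ _ _ leb J mJ).
- exact: (pairing_aeint HN HN AB Lv Lv).
- by apply: ae_imp vv' => t e Jt; rewrite e//; exact: coercive.
Qed.

Section solutions.
Context (Th : seq 'M[R]_(n.+1, n)) (f : R -> (E -> R) -> R) (u0 w : E -> R)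
  (u uh vh : R -> E -> R) (la laH mu muH : multiplier R n)
  (g1 g2 : R -> (E -> R) -> R).
Hypotheses (Wu : Wsp P u) (Wuh : Whsp P Th uh) (Wvh : Whsp P Th vh).
Hypothesis eqc : forall v, Wsp P v ->
  \int[leb]_(t in J) (dtW P u t (v t) + form (u t) (v t)) + int_b P la v =
  \int[leb]_(t in J) f t (v t).
Hypothesis eqd : forall v, Whsp P Th v ->
  \int[leb]_(t in J) (dtW P uh t (v t) + form (uh t) (v t)) + int_b P laH v =
  \int[leb]_(t in J) f t (v t).
Hypothesis ineqc : int_b P (mu - la) u <= int_pair (mu - la) w.
Hypothesis ineqd : int_b P (muH - laH) uh <= int_pair (muH - laH) w.
Hypothesis L2u0 : L2 lebn D u0.
Hypothesis init : \forall x \ae lebn, D x -> u 0 x = u0 x.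
Hypothesis inith : forall phi, Vh P Th phi -> l2dot lebn D (uh 0 - u0) phi = 0.
Hypothesis g1D : L2_dual T H N g1.
Hypothesis g1E : forall v, Wsp P v ->
  int_b P (la - laH) v = \int[leb]_(t in J) g1 t (v t).
Hypothesis g2D : L2_dual T H N g2.
Hypothesis g2E : forall v, Wsp P v ->
  int_b P (la - muH) v = \int[leb]_(t in J) g2 t (v t).

Let xi := vh - uh.
Let eta := u - vh.
Let err := u - uh.

Let Wuh' : Wsp P uh. Proof. by case: Wuh. Qed.
Let Wvh' : Wsp P vh. Proof. by case: Wvh. Qed.
Let Wxi : Wsp P xi. Proof. exact: (W_sub mD HN HL nrm_le T0 Wvh' Wuh'). Qed.
Let Weta : Wsp P eta. Proof. exact: (W_sub mD HN HL nrm_le T0 Wu Wvh'). Qed.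
Let Werr : Wsp P err. Proof. exact: (W_sub mD HN HL nrm_le T0 Wu Wuh'). Qed.

Let Whxi : Whsp P Th xi.
Proof.
split; first exact: Wxi.
case: Wvh => _ hv; case: Wuh => _ hu.
by apply: ae_imp2 hv hu => t h1 h2 tT; apply: (Vh_sub HN); [exact: h1|exact: h2].
Qed.

Let L2H v : Wsp P v -> L2T H N T v. Proof. by case. Qed.
Let L2v v t : Wsp P v -> 0 <= t <= T -> L2in lebn D (v t).
Proof. by case=> -[h _] _ _; exact: h. Qed.

Let dtu := dtW P u.
Let dtuh := dtW P uh.
Let dtvh := dtW P vh.
Let dteta := dtW P eta.
Let is_dtu : is_dt D T H N u dtu. Proof. exact: (W_dt Wu). Qed.
Let is_dtuh : is_dt D T H N uh dtuh. Proof. exact: (W_dt Wuh'). Qed.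
Let is_dtvh : is_dt D T H N vh dtvh. Proof. exact: (W_dt Wvh'). Qed.
Let is_dteta : is_dt D T H N eta dteta. Proof. exact: (W_dt Weta). Qed.

Let T00 : 0 <= (0 : R) <= T. Proof. by apply/andP; split; [|exact: ltW]. Qed.
Let TT : 0 <= T <= T. Proof. by apply/andP; split; [exact: ltW|]. Qed.

Let pairB g k v : L2_dual T H N g -> L2_dual T H N k -> L2T H N T v ->
  \int[leb]_(t in J) (g - k) t (v t) =
  \int[leb]_(t in J) g t (v t) - \int[leb]_(t in J) k t (v t).
Proof.
move=> gD kD vH; rewrite sub_lin.
by rewrite (pairing_Rintegral_linl HD HN DB (-1) kD gD vH) mulN1r addrC.
Qed.

Let pairBr g v1 v2 : L2_dual T H N g -> L2T H N T v1 -> L2T H N T v2 ->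
  \int[leb]_(t in J) g t ((v1 - v2) t) =
  \int[leb]_(t in J) g t (v1 t) - \int[leb]_(t in J) g t (v2 t).
Proof.
move=> gD v1H v2H; rewrite sub_lin.
by rewrite (pairing_Rintegral_linr HD HN DB (-1) gD v2H v1H) mulN1r addrC.
Qed.

Let formBl v1 v2 v : L2T H N T v1 -> L2T H N T v2 -> L2T H N T v ->
  \int[leb]_(t in J) form ((v1 - v2) t) (v t) =
  \int[leb]_(t in J) form (v1 t) (v t) - \int[leb]_(t in J) form (v2 t) (v t).
Proof.
move=> v1H v2H vH; rewrite sub_lin.
by rewrite (pairing_Rintegral_linl HN HN AB (-1) v2H v1H vH) mulN1r addrC.
Qed.

(** The derivative chosen for [u - vh] need not be the difference of those
    chosen for [u] and [vh], but it integrates in the same way against [xi]. *)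
Let dt_uniqueness : \int[leb]_(t in J) (dtu - dtvh) t (xi t) =
  \int[leb]_(t in J) dteta t (xi t).
Proof.
have is_dtxi := W_dt Wxi.
have is_dt' := is_dt_sub mD HN HL nrm_le T0 Wu Wvh' is_dtu is_dtvh.
have E1 := W_energy_polar mD HN HL nrm_le T0 Weta Wxi is_dteta is_dtxi.
have E2 := W_energy_polar mD HN HL nrm_le T0 Weta Wxi is_dt' is_dtxi.
have [d1 _] := is_dteta; have [d2 _] := is_dt'; have [d3 _] := is_dtxi.
have i1 := pairing_aeint HD HN DB d1 (L2H Wxi).
have i2 := pairing_aeint HD HN DB d2 (L2H Wxi).
have i3 := pairing_aeint HD HN DB d3 (L2H Weta).
rewrite (@aeint_RintegralD _ _ _ leb J mJ _ _ i1 i3) in E1.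
rewrite (@aeint_RintegralD _ _ _ leb J mJ _ _ i2 i3) in E2.
by move: E2; rewrite -E1 => /addIr.
Qed.

Let galerkin :
  \int[leb]_(t in J) dteta t (xi t) +
  2^-1 * (l2norm lebn D (xi T) ^+ 2 - l2norm lebn D (xi 0) ^+ 2) +
  (\int[leb]_(t in J) form (eta t) (xi t) + \int[leb]_(t in J) form (xi t) (xi t)) +
  \int[leb]_(t in J) g1 t (xi t) = 0.
Proof.
have c := eqc Wxi; have d := eqd Whxi.
have [du _] := is_dtu; have [duh _] := is_dtuh; have [dvh _] := is_dtvh.
have b : int_b P la xi - int_b P laH xi = \int[leb]_(t in J) g1 t (xi t) by rewrite -g1E.
have p1 := pairing_aeint HD HN DB du (L2H Wxi).
have p2 := pairing_aeint HD HN DB duh (L2H Wxi).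
have a1 := pairing_aeint HN HN AB (L2H Wu) (L2H Wxi).
have a2 := pairing_aeint HN HN AB (L2H Wuh') (L2H Wxi).
rewrite (@aeint_RintegralD _ _ _ leb J mJ _ _ p1 a1) in c.
rewrite (@aeint_RintegralD _ _ _ leb J mJ _ _ p2 a2) in d.
have e1 := dt_uniqueness; rewrite (pairB du dvh (L2H Wxi)) in e1.
have is_dtxi := is_dt_sub mD HN HL nrm_le T0 Wvh' Wuh' is_dtvh is_dtuh.
have [e2 _] := W_energy mD HN HL nrm_le T0 Wxi is_dtxi.
rewrite (pairB dvh duh (L2H Wxi)) in e2.
have e3 := formBl (L2H Wu) (L2H Wvh') (L2H Wxi).
have e4 := formBl (L2H Wvh') (L2H Wuh') (L2H Wxi).
exact: (galerkin_arith c d b e1 e2 e3 e4).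
Qed.

Let energy : 2^-1 * (l2norm lebn D (xi T) ^+ 2 - l2norm lebn D (xi 0) ^+ 2) +
    alpha * bnorm N T xi ^+ 2 <=
  (bnorm ND T dteta + `|C| * bnorm N T eta + bnorm ND T g1) * bnorm N T xi.
Proof.
have [d _] := is_dteta.
exact: (energy_arith galerkin (pairing_le HD HN DB d (L2H Wxi))
  (pairing_le HN HN AB (L2H Weta) (L2H Wxi)) (pairing_le HD HN DB g1D (L2H Wxi))
  (coercive_integral (L2H Wxi))).
Qed.

Let z := uh 0 - u0.
Let Lz : L2in lebn D z.
Proof. exact: (sn_memB LS (L2v Wuh' T00) L2u0). Qed.

(** [xi(t)] lies in the discrete space for almost every [t] only, so that
    orthogonality at time 0 is a limit along suitable [t -> 0]. *)
Let orthogonal : L2in_dot lebn D z (xi 0) = 0.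
Proof.
apply/eqP; rewrite -normr_le0; apply/ler_addgt0Pr => e e0; rewrite add0r.
have [[xiL xiC] _ _] := Wxi.
have n0 : 0 <= L2in_norm lebn D z by exact: L2in_norm_ge0.
have e1 : 0 < e / (L2in_norm lebn D z + 1) by rewrite divr_gt0// ltr_wpDl.
have [dl dl0 hdl] := xiC 0 T00 _ e1.
have [t [t0 tdl tT Vt]] : exists t, [/\ 0 < t, t < dl, t < T & Vh P Th (xi t)].
  pose m := Num.min dl T; have m0 : 0 < m by rewrite lt_min dl0 T0.
  (* Otherwise the null set of exceptional times would contain ]0, m[. *)
  apply: contrapT => ne.
  have [_ [A [mA A0 hA]]] := Whxi.
  have sub : `]0, m[%classic `<=` A.
    move=> t; rewrite /= in_itv/= => /andP[t0]; rewrite lt_min => /andP[tdl tT].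
    apply: hA => /= h; apply: ne; exists t; split => //; apply: h.
    by rewrite t0.
  have : (leb `]0%R, m[%classic <= leb A)%E by apply: le_measure; rewrite ?inE.
  rewrite A0 [X in (X <= _)%E](lebesgue_measure_itv `]0, m[)/= lte_fin m0 -EFinB lee_fin.
  by rewrite subr0 leNgt m0.
have tI : 0 <= t <= T by rewrite !ltW.
have Lt := L2v Wxi tI; have L0 := L2v Wxi T00.
have -> : L2in_dot lebn D z (xi 0) = L2in_dot lebn D z (xi 0 - xi t).
  by rewrite (bb_Br LB Lz L0 Lt) [X in _ - X](inith Vt) subr0.
apply: le_trans (L2in_CS mD Lz (sn_memB LS L0 Lt)) _.
have lt1 : L2in_norm lebn D (xi 0 - xi t) < e / (L2in_norm lebn D z + 1).
  rewrite (sn_distC LS L0 Lt); apply: hdl => //.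
  by rewrite subr0 gtr0_norm.
apply: (@le_trans _ _ ((L2in_norm lebn D z + 1) * (e / (L2in_norm lebn D z + 1)))).
  by apply: ler_pM; rewrite ?L2in_norm_ge0 ?lerDl// ltW.
by rewrite mulrC divfK// gt_eqF// ltr_wpDl.
Qed.

(** [|xi(0)|^2 = (vh(0) - u0, xi(0)) = - (eta(0), xi(0))]. *)
Let initial : l2norm lebn D (xi 0) ^+ 2 <= l2norm lebn D (eta 0) ^+ 2.
Proof.
have Lx := L2v Wxi T00; have Le := L2v Weta T00.
have Lu := L2v Wu T00; have Lvh := L2v Wvh' T00; have Luh := L2v Wuh' T00.
have E1 : L2in_dot lebn D (xi 0) (xi 0) = - L2in_dot lebn D (eta 0) (xi 0).
  have -> : L2in_dot lebn D (eta 0) (xi 0) = L2in_dot lebn D (u0 - vh 0) (xi 0).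
    apply: Rintegral_ae; apply: ae_imp init => x h Dx.
    by rewrite [eta 0 x](_ : _ = u 0 x - vh 0 x)// h.
  have -> : L2in_dot lebn D (xi 0) (xi 0) =
      L2in_dot lebn D (vh 0) (xi 0) - L2in_dot lebn D (uh 0) (xi 0).
    exact: (bb_Bl LB Lvh Luh Lx).
  rewrite (bb_Bl LB L2u0 Lvh Lx).
  have := orthogonal; rewrite (bb_Bl LB Luh L2u0 Lx).
  by move: (L2in_dot _ _ _ _) (L2in_dot _ _ _ _) (L2in_dot _ _ _ _) => x1 x2 x3; lra.
have le : L2in_norm lebn D (xi 0) ^+ 2 <= L2in_norm lebn D (eta 0) * L2in_norm lebn D (xi 0).
  rewrite L2in_normK E1; apply: le_trans (L2in_CS mD Le Lx).
  by rewrite -normrN; exact: ler_norm.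
have a0 : 0 <= L2in_norm lebn D (xi 0) by exact: L2in_norm_ge0.
have b0 : 0 <= L2in_norm lebn D (eta 0) by exact: L2in_norm_ge0.
suff : L2in_norm lebn D (xi 0) ^+ 2 <= L2in_norm lebn D (eta 0) ^+ 2 by [].
by move: le a0 b0; move: (L2in_norm _ _ _) (L2in_norm _ _ _) => x y le x0 y0; nra.
Qed.

Let trace t : 0 <= t <= T -> l2norm lebn D (eta t) ^+ 2 <=
  (T^-1 + 1) * (bnorm ND T dteta ^+ 2 + bnorm N T eta ^+ 2).
Proof.
move=> tT; apply: trace_arith => //; [exact: L2in_norm_ge0|exact: L2in_norm_ge0|].
by have [_ h] := W_energy mD HN HL nrm_le T0 Weta is_dteta; exact: h.
Qed.

Let residual : - ((bnorm ND T g1 + bnorm ND T g2) * bnorm N T err) <=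
  - (int_b P (muH - la) u - int_pair (muH - la) w) -
    (int_b P (mu - laH) u - int_pair (mu - laH) w).
Proof.
have d1 := pairBr g1D (L2H Wu) (L2H Wuh'); have d2 := pairBr g2D (L2H Wu) (L2H Wuh').
apply: (residual_arith ineqc ineqd (g1E Wu) (g2E Wu) _ d1 d2
  (pairing_le HD HN DB g1D (L2H Werr)) (pairing_le HD HN DB g2D (L2H Werr))).
exists (int_b P la uh); split; [exact: (g1E Wuh')|exact: (g2E Wuh')].
Qed.

Let errE : err = eta + xi.
Proof. by rewrite /err /eta /xi addrA subrK. Qed.

Let bnorm_err : bnorm N T err <= bnorm N T eta + bnorm N T xi.
Proof.
by rewrite errE; exact: (sn_normD (L2T_seminormed HN T) (L2H Weta) (L2H Wxi)).
Qed.

Let final_err : l2norm lebn D (err T) ^+ 2 <=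
  2 * l2norm lebn D (eta T) ^+ 2 + 2 * l2norm lebn D (xi T) ^+ 2.
Proof.
have Lx := L2v Wxi TT; have Le := L2v Weta TT.
have -> : err T = eta T + xi T by rewrite errE.
have : L2in_norm lebn D (eta T + xi T) <= _ := sn_normD LS Le Lx.
have : 0 <= L2in_norm lebn D (eta T + xi T) by exact: L2in_norm_ge0.
suff H0 : forall x y k : R, 0 <= k -> k <= x + y -> k ^+ 2 <= 2 * x ^+ 2 + 2 * y ^+ 2.
  by move=> h1 h2; exact: H0.
move=> x y k k0 kxy; have : k ^+ 2 <= (x + y) ^+ 2.
  by rewrite ler_pXn2r ?nnegrE//; exact: le_trans kxy.
by have := sqr_ge0 (x - y); rewrite sqrrB sqrrD; lra.
Qed.

Lemma error_estimate_representatives :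
  l2norm lebn D (u T - uh T) ^+ 2 + bnorm N T (u - uh) ^+ 2 <=
  error_constant alpha `|C| (T^-1 + 1) *
    (bnorm ND T (dtW P (u - vh)) ^+ 2 + bnorm N T (u - vh) ^+ 2 +
     bnorm ND T g1 ^+ 2 + bnorm ND T g2 ^+ 2) +
  (- (int_b P (muH - la) u - int_pair (muH - la) w) -
    (int_b P (mu - laH) u - int_pair (mu - laH) w)).
Proof.
have k0 : 0 <= T^-1 + 1 by rewrite addr_ge0// invr_ge0 ltW.
apply: (@error_arithmetic _ alpha `|C| (T^-1 + 1) alpha0 (normr_ge0 C) k0 _ _ _ _
  (bnorm N T xi) (l2norm lebn D (xi T) ^+ 2) (l2norm lebn D (xi 0) ^+ 2)
  (l2norm lebn D (eta T) ^+ 2) (l2norm lebn D (eta 0) ^+ 2)).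
- exact: L2in_norm_ge0.
- exact: L2in_norm_ge0.
- exact: L2in_norm_ge0.
- exact: L2in_norm_ge0.
- exact: L2in_norm_ge0.
- exact: sqr_ge0.
- exact: L2in_norm_ge0.
- exact: energy.
- exact: initial.
- exact: (trace T00).
- exact: (trace TT).
- exact: bnorm_err.
- exact: final_err.
- exact: residual.
Qed.

End solutions.
End error_estimate.

(** Passes from all representatives of the multipliers to the infima of their
    norms; if one of these is [+oo], so is the right side, because [c] is
    positive. *)
Lemma ge0_inf_le (R : realType) (I1 I2 : Type) (A1 : set I1) (A2 : set I2)
    (q1 : I1 -> R) (q2 : I2 -> R) (c x l s : R) : 0 < c ->
  (forall i, 0 <= q1 i) -> (forall i, 0 <= q2 i) ->
  (forall i j, A1 i -> A2 j -> l <= c * (x + q1 i + q2 j) + s) ->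
  (l%:E <= c%:E * (x%:E + ereal_inf [set (q1 i)%:E | i in A1] +
                   ereal_inf [set (q2 j)%:E | j in A2]) + s%:E)%E.
Proof.
move=> c0 q10 q20 h.
have inf0 (I : Type) (A : set I) (q : I -> R) : (forall i, 0 <= q i) ->
    (0 <= ereal_inf [set (q i)%:E | i in A])%E.
  by move=> q0; apply: le_ereal_inf_tmp => _ [i _ <-]; rewrite lee_fin.
have := inf0 _ A1 _ q10; have := inf0 _ A2 _ q20.
set m2 := ereal_inf _; set m1 := ereal_inf _ => m20 m10.
have m1Ny : m1 != -oo%E by rewrite -ltNye (lt_le_trans _ m10)// ltNy0.
have m2Ny : m2 != -oo%E by rewrite -ltNye (lt_le_trans _ m20)// ltNy0.
have [m1oo|m1oo] := eqVneq m1 +oo%E.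
  by rewrite m1oo addey// addye// gt0_muley ?lte_fin// addye// leey.
have [m2oo|m2oo] := eqVneq m2 +oo%E.
  rewrite m2oo addey ?gt0_muley ?lte_fin ?addye ?leey//.
  by rewrite -ltNye (lt_le_trans _ (leeD (lexx x%:E) m10))// adde0 ltNyr.
have fm1 : m1 \is a fin_num by rewrite fin_numE m1Ny m1oo.
have fm2 : m2 \is a fin_num by rewrite fin_numE m2Ny m2oo.
suff le_fine : l <= c * (x + fine m1 + fine m2) + s.
  by move: le_fine; rewrite -lee_fin EFinD EFinM !EFinD !fineK.
apply/ler_addgt0Pr => e e0; have e1 : 0 < e / (2 * c) by rewrite divr_gt0// mulr_gt0.
have [_ [i Ai <-] hi] := lb_ereal_inf_adherent e1 fm1.
have [_ [j Aj <-] hj] := lb_ereal_inf_adherent e1 fm2.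
rewrite -/m1 -(fineK fm1) -EFinD lte_fin in hi.
rewrite -/m2 -(fineK fm2) -EFinD lte_fin in hj.
apply: le_trans (h i j Ai Aj) _.
apply: (@le_trans _ _ (c * (x + (fine m1 + e / (2 * c)) + (fine m2 + e / (2 * c))) + s)).
  by rewrite lerD2r ler_pM2l//; move: hi hj; move: (fine m1) (fine m2) => *; lra.
by rewrite le_eqVlt; apply/orP; left; apply/eqP; field; rewrite gt_eqF.
Qed.

Theorem lemma6p14 (R : realType) (n : nat) (P : setting R n)
    (C alpha kappa : R)
    (hP : admissible P) (ha : continuous_coercive P C alpha) :
  exists C1 C2 : R, [/\ 0 < C1, 0 < C2 &
  forall (Th TH : seq 'M[R]_(n.+1, n)) (GH : seq 'M[R]_(n.-1.+1, n))
    (F : 'rV[R]_n -> R) (f : R -> ('rV[R]_n -> R) -> R)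
    (u0 w : 'rV[R]_n -> R)
    (u uh : R -> 'rV[R]_n -> R) (la laH : multiplier R n),
  mesh_ok P kappa Th TH GH ->
  data_ok P F f u0 w ->
  mixed_solution P (Wsp P) (Lam P F) f w u la ->
  (\forall x \ae @lebesgue_rV R n, Om P x -> u 0 x = u0 x) ->
  mixed_solution P (Whsp P Th) (LamH P F TH GH) f w uh laH ->
  (forall phi, Vh P Th phi ->
     l2dot (@lebesgue_rV R n) (Om P) (uh 0 - u0) phi = 0) ->
  forall (vh : R -> 'rV[R]_n -> R) (muH mu : multiplier R n),
  Whsp P Th vh -> LamH P F TH GH muH -> Lam P F mu ->
  ((l2norm (@lebesgue_rV R n) (Om P) (u (Tend P) - uh (Tend P))%R ^+ 2)%:E +
     L2T_sq (Hnorm P) (Tend P) (u - uh)%R <=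
   C1%:E *
     (L2T_sq (dual_norm (Hsp P) (Hnorm P)) (Tend P) (dtW P (u - vh)%R) +
      L2T_sq (Hnorm P) (Tend P) (u - vh)%R +
      mult_normsq P (la - laH)%R + mult_normsq P (la - muH)%R) +
   C2%:E *
     (- (int_b P (muH - la) u - int_pair (muH - la) w) -
        (int_b P (mu - laH) u - int_pair (mu - laH) w))%:E)%E].
Proof.
have T0 : 0 < Tend P by case: hP.
have al0 : 0 < alpha by case: ha.
have k0 : 0 <= (Tend P)^-1 + 1 by rewrite addr_ge0// invr_ge0 ltW.
have C10 := error_constant_gt0 `|C| al0 k0.
exists (error_constant alpha `|C| ((Tend P)^-1 + 1)), 1; split => //.
move=> Th TH GH F f u0 w u uh la laH _ [_ Lu0 _ _] [Wu _ eqc ineqc] init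
  [Wuh _ eqd ineqd] inith vh muH mu Wvh LmuH Lmu.
have mD : measurable (Om P).
  by case: hP => _ _ _ [_ oD _ _ _] _; exact: open_measurable_rV.
have HN : seminormed (Hsp P) (Hnorm P) by exact: Hs_vanishing_seminormed.
have HL : Hsp P `<=` L2in (@lebesgue_rV R n) (Om P) by move=> v [/(HsE mD)[]].
have nrm_le v : Hsp P v -> L2in_norm (@lebesgue_rV R n) (Om P) v <= Hnorm P v.
  by move=> _; exact: l2norm_le_Hs_norm.
have Weta := W_sub mD HN HL nrm_le T0 Wu Wvh.1.
have Werr := W_sub mD HN HL nrm_le T0 Wu Wuh.1.
have [Leta Lerr] : L2T (Hsp P) (Hnorm P) (Tend P) (u - vh) /\
    L2T (Hsp P) (Hnorm P) (Tend P) (u - uh) by case: Weta; case: Werr.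
have [deta _] := W_dt Weta.
rewrite mul1e (L2T_sqE Lerr) (L2T_sqE Leta) (L2T_sqE deta) -!EFinD.
have msqE (nu : multiplier R n) : mult_normsq P nu = ereal_inf
    [set (bnorm (dual_norm (Hsp P) (Hnorm P)) (Tend P) g ^+ 2)%:E | g in
      [set g | L2_dual (Tend P) (Hsp P) (Hnorm P) g /\
        forall v, Wsp P v ->
          int_b P nu v = \int[@lebesgue_measure R]_(t in `]0, Tend P[) g t (v t)]].
  congr ereal_inf; apply/seteqP; split=> [_ [g [gD gE] <-]|_ [g [gD gE] <-]];
    by exists g => //; rewrite (L2T_sqE gD).
rewrite !msqE; apply: ge0_inf_le => //.
- by move=> g; exact: sqr_ge0.
- by move=> g; exact: sqr_ge0.
move=> g1 g2 [g1D g1E] [g2D g2E].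
exact: (error_estimate_representatives hP ha Wu Wuh Wvh eqc eqd (ineqc mu Lmu)
  (ineqd muH LmuH) Lu0 init inith g1D g1E g2D g2E).
Qed.
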